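(* Fix $q \geq 0$ and $p>0$. Let $X$ be a spectrally negative Lévy process with Gaussian coefficient $\sigma$ and Lévy measure $\nu$ on $(0,\infty)$, and suppose that the tail of the Lévy measure, $x\mapsto\nu(x,\infty)$, $x \in (0,\infty)$, is log-convex. Let $$b_\infty^\ast=\sup\left\{b\ge0\colon W^{(q)\prime}(b)\le W^{(q)\prime}(x)\text{ for all }x\ge0\right\},$$ $$b_p^\ast=\sup\left\{b\ge0\colon Z_q^\prime(b,\Phi(p+q))\le Z_q^\prime(x,\Phi(p+q))\text{ for all }x\ge0\right\}.$$ Then $0\le b_p^\ast\le b_\infty^\ast$. Further, $b_p^\ast>0$ if and only if one of the following three cases holds: (a) $\sigma>0$ and $\left(\Phi(p+q)\right)^2/p<2/\sigma^2$; (b) $\sigma=0$ and $\nu(0,\infty)=\infty$; (c) $\sigma=0$, $\nu(0,\infty)<\infty$ and $$\frac{c\,\Phi(p+q)}{p}\left(\Phi(p+q)-\frac{p}{c}\right)<\frac{q+\nu(0,\infty)}{c},$$ where $c=\gamma+\int_0^1x\,\nu(\mathrm{d}x)$.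
   Context: $X=\{X_t,t\ge0\}$ is a spectrally negative Lévy process (a Lévy process with no positive jumps and, as in the usual definition, without monotone paths) with Laplace exponent $$\psi(\theta)=\gamma\theta+\tfrac12\sigma^2\theta^2+\int_0^\infty\left(\mathrm{e}^{-\theta z}-1+\theta z\mathbf{1}_{(0,1]}(z)\right)\nu(\mathrm{d}z),$$ i.e. $\mathbb{E}[\mathrm{e}^{\theta X_t}]=\mathrm{e}^{t\psi(\theta)}$ for $\theta\ge0$, $X_0=0$, where $\gamma\in\mathbb{R}$, $\sigma\ge0$ and the Lévy measure $\nu$ is a $\sigma$-finite measure on $(0,\infty)$ with $\int_0^\infty(1\wedge x^2)\,\nu(\mathrm{d}x)<\infty$. A function $f\colon(0,\infty)\to(0,\infty)$ is log-convex if $\log f$ is convex on $(0,\infty)$. For $r\ge0$, $\Phi(r)=\sup\{\lambda\ge0\colon\psi(\lambda)=r\}$. For $q\ge0$, the $q$-scale function $W^{(q)}$ is the function that vanishes on $(-\infty,0)$, is continuous on $[0,\infty)$, and satisfies $\int_0^\infty\mathrm{e}^{-\theta x}W^{(q)}(x)\,\mathrm{d}x=(\psi(\theta)-q)^{-1}$ for all $\theta>\Phi(q)$. $W^{(q)\prime}$ is its derivative on $(0,\infty)$, and $W^{(q)\prime}(0)$ is understood as $W^{(q)\prime}(0+)\in(0,\infty]$. For $x\in\mathbb{R}$ and $\theta\ge0$, $$Z_q(x,\theta)=\mathrm{e}^{\theta x}\left(1-(\psi(\theta)-q)\int_0^x\mathrm{e}^{-\theta y}W^{(q)}(y)\,\mathrm{d}y\right),$$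 so $Z_q(x,\theta)=\mathrm{e}^{\theta x}$ for $x\le0$. $Z_q^\prime(x,\theta)$ is the derivative with respect to the first argument; for $x>0$, $Z_q^\prime(x,\Phi(p+q))=\Phi(p+q)Z_q(x,\Phi(p+q))-pW^{(q)}(x)$, and one sets $Z_q^\prime(0,\Phi(p+q))=\Phi(p+q)-pW^{(q)}(0+)$.
   Formalization: The criterion for b_p^*>0 is stated only when W^{(q)}' is not constant on (0,∞) (it fails when q=0 and W^{(q)} is affine on [0,∞)); and when no b≥0 attains the minimum, the supremum defining b_∞^* or b_p^* is taken to be +∞. *)

(* Defs.v *)
From HB Require Import structures.
From mathcomp Require Export all_boot all_order all_algebra.
From mathcomp Require Export all_classical all_reals all_analysis.

Set Implicit Arguments.
Unset Strict Implicit.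
Unset Printing Implicit Defensive.

Export Order.TTheory GRing.Theory Num.Theory.
Export numFieldNormedType.Exports.

Local Open Scope classical_set_scope.
Local Open Scope ring_scope.

(* A measure on (0, oo) is encoded as a measure on R that does not charge
   (-oo, 0]. *)
Definition levy_measure (R : realType) (nu : {measure set R -> \bar R}) : Prop :=
  [/\ nu `]-oo, 0]%classic = 0%E,
      sigma_finite [set: R] nu &
      (\int[nu]_(x in `]0%R, +oo[) (Num.min 1 (x ^+ 2))%:E < +oo)%E].

Definition laplace_exponent (R : realType) (gamma sigma : R)
    (nu : {measure set R -> \bar R}) (theta : R) : R :=
  gamma * theta + 2^-1 * sigma ^+ 2 * theta ^+ 2 +
  \int[nu]_(z in `]0, +oo[)
    (expR (- (theta * z)) - 1 + theta * z * \1_`]0, 1]%classic z).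

(* For a Levy measure the tail is finite at every x > 0, so that [fine] loses
   nothing there. *)
Definition tail (R : realType) (nu : {measure set R -> \bar R}) (x : R) : R :=
  fine (nu `]x, +oo[%classic).

Definition log_convex (R : realType) (f : R -> R) : Prop :=
  (forall x, 0 < x -> 0 < f x) /\
  convex_function (`]0, +oo[%classic : set R) (fun x => ln (f x) : R^o).

Section levy_process.
Context d (T : measurableType d) (R : realType) (P : probability T R).
(* Processes are indexed by R; only the times t >= 0 are ever constrained. *)
Implicit Type X : R -> {RV P >-> R}.

(* As the A i may be taken to be the whole line, the product rule for all n
   increments entails the one for every subfamily. *)
Definition independent_increments X : Prop :=
  forall (n : nat) (t : nat -> R) (A : nat -> set R),
    0 <= t 0%N -> (forall i, t i <= t i.+1) -> (forall i, measurable (A i)) ->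
    P (\bigcap_(i in `I_n) [set w | A i (X (t i.+1) w - X (t i) w)%R]) =
    (\prod_(i < n) P [set w | A i (X (t i.+1) w - X (t i) w)%R])%E.

Definition stationary_increments X : Prop :=
  forall (s t : R) (A : set R), 0 <= s -> 0 <= t -> measurable A ->
    P [set w | A (X (s + t) w - X s w)] = P [set w | A (X t w)].

Definition cadlag (x : R -> R) : Prop :=
  (forall t, 0 <= t -> x s @[s --> t^'+] --> x t) /\
  (forall t, 0 < t -> cvg (x s @[s --> t^'-])).

Definition levy_process X : Prop :=
  [/\ {ae P, forall w, X 0 w = 0},
      independent_increments X,
      stationary_increments X &
      {ae P, forall w, cadlag (fun t => X t w)}].

Definition no_positive_jumps (x : R -> R) : Prop :=
  forall t, 0 < t -> x t <= lim (x s @[s --> t^'-]).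

Definition nondecreasing_path (x : R -> R) : Prop :=
  forall s t, 0 <= s -> s <= t -> x s <= x t.

Definition nonincreasing_path (x : R -> R) : Prop :=
  forall s t, 0 <= s -> s <= t -> x t <= x s.

Definition spectrally_negative_levy X : Prop :=
  [/\ levy_process X,
      {ae P, forall w, no_positive_jumps (fun t => X t w)},
      ~ {ae P, forall w, nondecreasing_path (fun t => X t w)} &
      ~ {ae P, forall w, nonincreasing_path (fun t => X t w)}].

Definition has_laplace_exponent X (psi : R -> R) : Prop :=
  forall t theta, 0 <= t -> 0 <= theta ->
    'E_P[fun w => expR (theta * X t w)]%E = (expR (t * psi theta))%:E.

End levy_process.

Section scale_functions.
Context (R : realType).
Implicit Types (psi W : R -> R) (q p theta x : R).

Definition right_inverse psi (r : R) : R :=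
  sup [set lambda | 0 <= lambda /\ psi lambda = r].

Definition scale_function psi q W : Prop :=
  [/\ forall x, x < 0 -> W x = 0,
      {within `[0, +oo[%classic, continuous W} &
      forall theta, right_inverse psi q < theta ->
        (\int[@lebesgue_measure R]_(x in `[0%R, +oo[)
           (expR (- (theta * x)) * W x)%:E = ((psi theta - q)^-1)%:E)%E].

(* Extended-real valued, since W'(0+) may be +oo. *)
Definition scale_deriv W x : \bar R :=
  if 0 < x then (derive1 W x)%:E else lim ((derive1 W y)%:E @[y --> 0^'+]).

Definition Zfun psi q W x theta : R :=
  expR (theta * x) *
  (1 - (psi theta - q) *
       \int[@lebesgue_measure R]_(y in `[0, x]) (expR (- (theta * y)) * W y)).

(* x |-> Z_q'(x, Phi(p + q)), with its conventional value at 0. *)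
Definition Z_deriv psi q p W x : R :=
  let theta := right_inverse psi (p + q) in
  if 0 < x then derive1 (fun y => Zfun psi q W y theta) x
  else theta - p * lim (W y @[y --> 0^'+]).

Definition minimizers (f : R -> \bar R) : set R :=
  [set b | 0 <= b /\ forall x, 0 <= x -> (f b <= f x)%E].

(* When f has no minimizer on [0, oo) the value is +oo, not sup set0 = -oo.
   This occurs only for q = 0 and psi'(0+) >= 0, where both derivatives may
   decrease strictly and approach their infimum at infinity; any other
   convention would make b_p >= 0, or the criterion for b_p > 0, fail there. *)
Definition last_minimizer (f : R -> \bar R) : \bar R :=
  if pselect (minimizers f !=set0) then ereal_sup (EFin @` minimizers f)
  else +oo%E.

(* Without this the criterion for b_p > 0 fails: take q = 0, sigma = 0,
   nu(dz) = c mu^2 e^(- mu z) dz and drift c > 0, so that psi'(0+) = 0.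
   Then psi(theta) = c theta^2 / (theta + mu), W(x) = (1 + mu x) / c,
   W' = mu / c and Z_0'(., Phi(p)) = p mu / (c Phi(p)) are constant on
   [0, oo), so b_p = +oo, whereas both sides of the inequality in case (c)
   are equal to mu. *)
Definition nonconstant_scale_deriv W : Prop :=
  exists x y : R, [/\ 0 < x, 0 < y & derive1 W x <> derive1 W y].

Definition b_infty W : \bar R := last_minimizer (scale_deriv W).

Definition b_poisson psi q p W : \bar R :=
  last_minimizer (fun x => (Z_deriv psi q p W x)%:E).

End scale_functions.

(* Main.v *)
From HB Require Import structures.
Require Import Defs.
From mathcomp Require Import ring lra measurable_realfun.

Set Implicit Arguments.
Unset Strict Implicit.
Unset Printing Implicit Defensive.

Local Open Scope classical_set_scope.
Local Open Scope ring_scope.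

(** Write w for the derivative of W, th for Phi(p + q) and m for the function
    x |-> Z_q'(x, th).

    Convexity of w. All that is known of W is its Laplace transform
    1 / (psi - q). Substitute lam (1 - z) for the variable, with lam large. As
    a power series in z, lam times the transform of W has as coefficients the
    averages of W under the Erlang laws of rate lam ([erlang_mean]), and
    (psi - q) / (1 - z) has the coefficient psi lam - q followed by the
    negatives of some positive weights f_k ([renewal_weight]). That the product
    of psi - q and the transform is 1 becomes a renewal equation
    (psi lam - q) u_(n+1) = sum_j f_(n-j) u_j for the increments u_n of these
    averages. By Fubini, f_k is, up to the constant q and to a Gaussian term at
    k = 0, the average of the Levy tail under an Erlang law, and such averages
    of a log-convex function form a log-convex sequence
    ([erlang_mixture_log_convex]). A renewal sequence with log-convex weights
    is log-convex ([renewal_log_convex]), hence convex. When lam tends to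
    infinity the Erlang laws concentrate ([erlang_approx]) and convexity passes
    to the limit: every increment x |-> W (x + c) - W x is convex
    ([scale_increment_convex]), which forces W to be differentiable on (0, oo)
    with a convex derivative ([derive_increment_convex]).

    Comparison of the barriers. Since
    m x = p th int_0^oo e^(- th y) (W (y + x) - W x) dy, the function m is
    convex, and m' = th m - p w. Beyond the last minimizer of w the convex
    function w increases strictly, so the increments of W grow, and m increases
    strictly there ([increasing_of_rise]): no minimizer of m lies beyond the
    last one of w.

    Positivity. Since m is convex, the last minimizer of m is positive as soon
    as m goes below m 0. The converse fails only if m is constant on
    an interval [0, b], and then the equation m' = th m - p w makes w constant
    ([constant_of_two_minima]). By convexity, m goes below m 0 exactly when
    th m(0) - p w(0+) < 0, where m 0 = th - p W 0; in particular it does when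
    w(0+) is infinite. Finally W 0 is the limit of n / (psi n - q) and w(0+)
    that of n^2 / (psi n - q) - n W 0, again by concentration of Erlang laws.
    If sigma > 0 these limits are 0 and 2 / sigma^2. If sigma = 0 and nu is
    finite they are 1 / c and (q + nu(0, oo)) / c^2. If sigma = 0 and nu is
    infinite then w(0+) is infinite, because a finite limit would bound the
    tail of nu ([infinite_activity_unbounded]).

    The probabilistic hypotheses enter only through the existence of a point
    where psi is positive ([laplace_exponent_positive]): otherwise all the
    exponential moments of X_t would be at most 1, so that X_t <= 0 almost
    surely, and the paths would be nonincreasing, which is excluded. *)

(** * Erlang laws *)

Section erlang.
Context {R : realType}.
Implicit Types (lam x y : R) (k : nat).
Local Notation mu := (@lebesgue_measure R).

(** Density and distribution function of a sum of k + 1 independent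
    exponential variables of rate lam. *)
Definition erlang_pdf lam k y : R :=
  lam * expR (- (lam * y)) * ((lam * y) ^+ k / k`!%:R).

Definition erlang_cdf lam k y : R :=
  1 - expR (- (lam * y)) * \sum_(j < k.+1) (lam * y) ^+ j / j`!%:R.

(** The rules of differentiation are restated for functions given
    pointwise, so that the derivative of an explicit expression is obtained by
    composing terms. *)
Lemma is_derive_eq1 (f : R -> R) x d d' : is_derive x 1 f d' -> d' = d -> is_derive x 1 f d.
Proof. by move=> + <-. Qed.

Lemma is_derive_derive1 (f : R -> R) x d : is_derive x 1 f d -> derive1 f x = d.
Proof. by move=> [_ <-]; rewrite derive1E. Qed.

Lemma is_derive_derivable (f : R -> R) x d : is_derive x 1 f d -> derivable f x 1.
Proof. by case. Qed.

Lemma is_derive_mulc (c x : R) : is_derive x 1 (fun y => c * y) c.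
Proof.
by apply: (is_derive_eq1 (is_deriveZ c (is_derive_id x 1))); rewrite /GRing.scale/= mulr1.
Qed.

Lemma is_derive_add (f g : R -> R) (x df dg : R) : is_derive x 1 f df ->
  is_derive x 1 g dg -> is_derive x 1 (fun y => f y + g y) (df + dg).
Proof. exact: is_deriveD. Qed.

Lemma is_derive_sub (f g : R -> R) (x df dg : R) : is_derive x 1 f df ->
  is_derive x 1 g dg -> is_derive x 1 (fun y => f y - g y) (df - dg).
Proof. exact: is_deriveB. Qed.

Lemma is_derive_opp (f : R -> R) (x df : R) : is_derive x 1 f df ->
  is_derive x 1 (fun y => - f y) (- df).
Proof. exact: is_deriveN. Qed.

Lemma is_derive_const (c x : R) : is_derive x 1 (fun=> c) 0.
Proof. exact: is_derive_cst. Qed.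

Lemma is_derive_mul (f g : R -> R) (x df dg : R) : is_derive x 1 f df ->
  is_derive x 1 g dg -> is_derive x 1 (fun y => f y * g y) (df * g x + f x * dg).
Proof.
move=> Hf Hg; apply: (is_derive_eq1 (is_deriveM Hf Hg)).
by rewrite /GRing.scale/=; ring.
Qed.

Lemma is_derive_exp_comp (f : R -> R) (x df : R) : is_derive x 1 f df ->
  is_derive x 1 (fun y => expR (f y)) (expR (f x) * df).
Proof. by move=> Hf; exact: (is_derive1_comp (is_derive_expR (f x)) Hf). Qed.

Lemma is_derive_pow (f : R -> R) (x df : R) k : is_derive x 1 f df ->
  is_derive x 1 (fun y => f y ^+ k.+1) (k.+1%:R * f x ^+ k * df).
Proof.
move=> Hf; have := is_deriveX k.+1 Hf.
by rewrite /GRing.scale/= -fctE.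
Qed.

Lemma is_derive_expR_monomial lam (c : R) k y :
  is_derive y 1 (fun y => expR (- (lam * y)) * ((lam * y) ^+ k.+1 * c))
   (lam * expR (- (lam * y)) * (k.+1%:R * (lam * y) ^+ k * c - (lam * y) ^+ k.+1 * c)).
Proof.
have H1 := is_derive_exp_comp (is_derive_opp (is_derive_mulc lam y)).
have H2 := is_derive_mul (is_derive_pow k (is_derive_mulc lam y)) (is_derive_const c y).
apply: (is_derive_eq1 (is_derive_mul H1 H2)).
ring.
Qed.

Lemma is_derive_erlang_cdf lam k y :
  is_derive y 1 (erlang_cdf lam k) (erlang_pdf lam k y).
Proof.
elim: k y => [|k IH] y.
  rewrite /erlang_cdf /erlang_pdf.
  have -> : (fun y => 1 - expR (- (lam * y)) * \sum_(j < 1) (lam * y) ^+ j / j`!%:R)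
    = (fun y => 1 - expR (- (lam * y))).
    by apply/funext => z; rewrite big_ord1 expr0 fact0 divr1 mulr1.
  have H1 := is_derive_exp_comp (is_derive_opp (is_derive_mulc lam y)).
  apply: (is_derive_eq1 (is_derive_sub (is_derive_const 1 y) H1)).
  by rewrite expr0 fact0 divr1 mulr1; ring.
have -> : erlang_cdf lam k.+1 = (fun y => erlang_cdf lam k y -
    expR (- (lam * y)) * ((lam * y) ^+ k.+1 / k.+1`!%:R)).
  by apply/funext => z; rewrite /erlang_cdf big_ord_recr/=; ring.
have H := is_derive_sub (IH y) (is_derive_expR_monomial lam (k.+1`!%:R)^-1 k y).
apply: (is_derive_eq1 H).
rewrite /erlang_pdf factS natrM.
have k0 : k`!%:R != 0 :> R by rewrite pnatr_eq0 -lt0n fact_gt0.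
have k1 : k.+1%:R != 0 :> R by rewrite pnatr_eq0.
move: (k.+1%:R : R) (k`!%:R : R) k0 k1 => a b b0 a0.
field.
by rewrite b0 a0.
Qed.

Lemma erlang_pdf_ge0 lam k y : 0 <= lam -> 0 <= y -> 0 <= erlang_pdf lam k y.
Proof.
move=> l0 y0; rewrite /erlang_pdf !mulr_ge0 ?expR_ge0 ?exprn_ge0 ?mulr_ge0//.
Qed.

Lemma erlang_cdf0 lam k : erlang_cdf lam k 0 = 0.
Proof.
rewrite /erlang_cdf mulr0 oppr0 expR0 mul1r big_ord_recl expr0 fact0 divr1.
rewrite big1 ?addr0 ?subrr// => i _.
by rewrite expr0n /= mul0r.
Qed.

Lemma continuous_erlang_cdf lam k : continuous (erlang_cdf lam k).
Proof.
move=> x; have := is_derive_erlang_cdf lam k x => -[d _].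
exact/differentiable_continuous/derivable1_diffP.
Qed.

Lemma is_derive_continuous (f : R -> R) x d : is_derive x 1 f d -> {for x, continuous f}.
Proof. by move=> [df _]; exact/differentiable_continuous/derivable1_diffP. Qed.

Lemma continuous_expR_mulc (c : R) : continuous (fun y => expR (c * y)).
Proof.
move=> x; apply: (is_derive_continuous (is_derive_exp_comp (is_derive_mulc c x))).
Qed.

Lemma continuous_erlang_pdf lam k : continuous (erlang_pdf lam k).
Proof.
move=> x; rewrite /erlang_pdf.
have H1 := is_derive_exp_comp (is_derive_opp (is_derive_mulc lam x)).
have H2 := is_derive_mul (is_derive_const lam x) H1.
case: k => [|k].
  have H3 := is_derive_mul H2 (is_derive_const (1 / 0`!%:R) x).
  exact: (is_derive_continuous H3).
have H3 := is_derive_mul (is_derive_pow k (is_derive_mulc lam x)) (is_derive_const (k.+1`!%:R)^-1 x).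
exact: (is_derive_continuous (is_derive_mul H2 H3)).
Qed.

Lemma continuous_measurable (f : R -> R) (D : set R) : measurable D -> continuous f -> measurable_fun D f.
Proof. by move=> mD cf; apply: measurable_funTS; exact: continuous_measurable_fun. Qed.

(** Mean value theorem for g - f. *)
Lemma ler_of_is_derive (f g df dg : R -> R) (a b : R) : a <= b ->
  (forall x, is_derive x 1 f (df x)) -> (forall x, is_derive x 1 g (dg x)) ->
  (forall x, a < x -> x < b -> df x <= dg x) -> f b - f a <= g b - g a.
Proof.
rewrite le_eqVlt => /predU1P[->|ab] Hf Hg H; first by rewrite !subrr.
have HD x : is_derive x 1 (fun x => g x - f x) (dg x - df x).
  exact: is_derive_sub.
have Hc : {within `[a, b], continuous (fun x => g x - f x)}.
  by apply: continuous_subspaceT => x; exact: (is_derive_continuous (HD x)).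
have [c] := @MVT R _ _ a b ab (fun x _ => HD x) Hc.
rewrite in_itv/= => /andP[ac cb] E.
have : 0 <= (dg c - df c) * (b - a).
  by rewrite mulr_ge0// subr_ge0 ?(ltW ab)// H.
rewrite -E; lra.
Qed.

Lemma erlang_cdf_nd lam k x y : 0 <= lam -> 0 <= x -> x <= y ->
  erlang_cdf lam k x <= erlang_cdf lam k y.
Proof.
move=> l0 x0 xy.
have := @ler_of_is_derive (cst 0) (erlang_cdf lam k) (cst 0) (erlang_pdf lam k) x y xy.
rewrite /= subrr subr_ge0; apply.
- by move=> z; exact: is_derive_erlang_cdf.
by move=> z xz _; apply: erlang_pdf_ge0 => //; by apply/ltW; exact: le_lt_trans xz.
Qed.

Lemma erlang_cdf_ge0 lam k y : 0 <= lam -> 0 <= y -> 0 <= erlang_cdf lam k y.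
Proof. by move=> l0 y0; rewrite -(erlang_cdf0 lam k) erlang_cdf_nd. Qed.

Lemma erlang_cdf_le1 lam k y : 0 <= lam -> 0 <= y -> erlang_cdf lam k y <= 1.
Proof.
move=> l0 y0; rewrite gerBl mulr_ge0 ?expR_ge0// sumr_ge0// => i _.
by rewrite divr_ge0// exprn_ge0// mulr_ge0.
Qed.

(** x^k / k! is one of the terms of the exponential series. *)
Lemma expR_monomial_le1 (x : R) k : 0 <= x -> expR (- x) * (x ^+ k / k`!%:R) <= 1.
Proof.
move=> x0; rewrite expRN mulrC ler_pdivrMr ?expR_gt0// mul1r.
case: k => [|k]; first by rewrite expr0 fact0 divr1 -expR0 ler_expR.
by apply: le_trans (expR_ge1Dxn k x0); rewrite lerDr.
Qed.

(** Compare the derivatives, using e^(- t) / k! <= 1 <= k + 1. *)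
Lemma erlang_cdf_le lam k y : 0 <= lam -> 0 <= y ->
  erlang_cdf lam k y <= (lam * y) ^+ k.+1.
Proof.
move=> l0 y0.
have := @ler_of_is_derive (erlang_cdf lam k) (fun y => (lam * y) ^+ k.+1)
  (erlang_pdf lam k) (fun y => lam * (k.+1%:R * (lam * y) ^+ k)) 0 y y0.
rewrite erlang_cdf0 mulr0 expr0n/= !subr0; apply.
- by move=> x; exact: is_derive_erlang_cdf.
- move=> x; apply: (is_derive_eq1 (is_derive_pow k (is_derive_mulc lam x))).
  by ring.
move=> x x0 _; rewrite /erlang_pdf -mulrA ler_wpM2l//.
have lx : 0 <= lam * x by rewrite mulr_ge0// ltW.
apply: le_trans (_ : (lam * x) ^+ k <= _); last first.
  by rewrite ler_peMl ?exprn_ge0// ler1n.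
rewrite mulrCA ler_piMr ?exprn_ge0// mulr_ile1 ?expR_ge0 ?invr_ge0//.
  by rewrite expR_le1 oppr_le0.
by rewrite invf_le1 ?ler1n ?ltr0n fact_gt0.
Qed.

Lemma erlang_cdf_gt0 lam k y : 0 < lam -> 0 < y -> 0 < erlang_cdf lam k y.
Proof.
move=> l0 y0.
have Hc : {within `[0, y], continuous (erlang_cdf lam k)}.
  by apply: continuous_subspaceT; exact: continuous_erlang_cdf.
have [c] := @MVT R _ _ 0 y y0 (fun x _ => is_derive_erlang_cdf lam k x) Hc.
rewrite in_itv/= erlang_cdf0 !subr0 => /andP[c0 _] ->.
rewrite /erlang_pdf !mulr_gt0 ?expR_gt0 ?exprn_gt0 ?mulr_gt0//.
Qed.

(** The bound on the monomial of degree k + 1, divided by lam y. *)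
Lemma erlang_pdf_step lam k y : 0 < lam -> 0 < y ->
  expR (- (lam * y)) * ((lam * y) ^+ k / k`!%:R) <= k.+1%:R / (lam * y).
Proof.
move=> l0 y0; have ly : 0 < lam * y by rewrite mulr_gt0.
rewrite ler_pdivlMr//.
have := expR_monomial_le1 k.+1 (ltW ly).
rewrite factS natrM exprS invfM [X in _ * (_ * X)]mulrC => H.
have -> : expR (- (lam * y)) * ((lam * y) ^+ k / k`!%:R) * (lam * y) =
  k.+1%:R * (expR (- (lam * y)) * (lam * y * (lam * y) ^+ k * ((k`!%:R)^-1 / k.+1%:R))).
  have k1 : k.+1%:R != 0 :> R by rewrite pnatr_eq0.
  move: (k.+1%:R : R) ((k`!%:R)^-1 : R) k1 => a b a0.
  by field.
by rewrite ler_piMr.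
Qed.

Lemma cvgy_erlang_cdf lam k : 0 < lam -> erlang_cdf lam k y @[y --> +oo] --> (1 : R).
Proof.
move=> l0.
have H j : expR (- (lam * y)) * ((lam * y) ^+ j / j`!%:R) @[y --> +oo] --> (0 : R).
  apply/cvgrPdist_le => e e0; near=> y.
  have y0 : 0 < y by near: y; exact: nbhs_pinfty_gt.
  rewrite sub0r normrN ger0_norm; last first.
    by rewrite mulr_ge0 ?expR_ge0// divr_ge0// exprn_ge0// mulr_ge0 ?ltW.
  apply: le_trans (erlang_pdf_step j l0 y0) _.
  rewrite ler_pdivrMr ?mulr_gt0// mulrA -ler_pdivrMl ?mulr_gt0//.
rewrite /erlang_cdf -[X in _ --> X]subr0; apply: cvgB; first exact: cvg_cst.
under eq_fun do rewrite mulr_sumr.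
have : forall n, \sum_(i < n) (expR (- (lam * y)) * ((lam * y) ^+ i / i`!%:R)) @[y --> +oo] --> (0 : R).
elim=> [|n IH].
  by under eq_fun do rewrite big_ord0; exact: cvg_cst.
under eq_fun do rewrite big_ord_recr/=.
by have := cvgD IH (H n); rewrite addr0; exact.
exact.
Unshelve. all: by end_near. Qed.

Lemma integral_erlang_pdf lam k : 0 < lam ->
  (\int[mu]_(x in `[0%R, +oo[) (erlang_pdf lam k x)%:E = 1%:E)%E.
Proof.
move=> l0.
rewrite (@ge0_continuous_FTC2y R (erlang_pdf lam k) (erlang_cdf lam k) 0 1).
- by rewrite erlang_cdf0 sube0.
- by move=> x x0; apply: erlang_pdf_ge0 => //; exact: ltW.
- by apply: continuous_subspaceT; exact: continuous_erlang_pdf.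
- exact: cvgy_erlang_cdf.
- by move=> x x0; have := is_derive_erlang_cdf lam k x => -[].
- apply: cvg_at_right_filter; exact: continuous_erlang_cdf.
- by move=> x _; exact: (is_derive_derive1 (is_derive_erlang_cdf lam k x)).
Qed.

Lemma integral_erlang_pdf_itv lam k y : 0 <= y ->
  (\int[mu]_(x in `[0%R, y]) (erlang_pdf lam k x)%:E = (erlang_cdf lam k y)%:E)%E.
Proof.
rewrite le_eqVlt => /predU1P[<-|y0].
  by rewrite set_itv1 integral_set1 erlang_cdf0.
rewrite (@continuous_FTC2 R (erlang_pdf lam k) (erlang_cdf lam k) 0 y y0).
- by rewrite erlang_cdf0 sube0.
- by apply: continuous_subspaceT; exact: continuous_erlang_pdf.
- split.
  + by move=> x _; have := is_derive_erlang_cdf lam k x => -[].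
  + by apply: cvg_at_right_filter; exact: continuous_erlang_cdf.
  + by apply: cvg_at_left_filter; exact: continuous_erlang_cdf.
- by move=> x _; exact: (is_derive_derive1 (is_derive_erlang_cdf lam k x)).
Qed.

End erlang.

(** * Renewal sequences with log-convex weights *)

Section renewal.
Context {R : realFieldType}.
Implicit Types (a f u : nat -> R).

(** Log-convexity means that the ratios of consecutive terms increase. *)
Lemma log_convex_ratio a n : (forall k, 0 < a k) ->
  (forall k, (k < n)%N -> a k.+1 ^+ 2 <= a k * a k.+2) ->
  forall j, (j <= n)%N -> a j.+1 / a j <= a n.+1 / a n.
Proof.
move=> a0; elim: n => [|n IH] H j; first by rewrite leqn0 => /eqP ->.
rewrite leq_eqVlt => /predU1P[->//|]; rewrite ltnS => jn.
apply: le_trans (IH _ _ jn) _ => [k kn|]; first by rewrite H// ltnS ltnW.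
by rewrite ler_pdivrMr// mulrAC ler_pdivlMr// mulrC -expr2 mulrC H.
Qed.

Lemma renewal_gt0 c f u : 0 < c -> (forall k, 0 < f k) -> 0 < u 0%N ->
  (forall n, c * u n.+1 = \sum_(j < n.+1) f (n - j)%N * u j) ->
  forall n, 0 < u n.
Proof.
move=> c0 f0 u0 H; suff : forall n k, (k <= n)%N -> 0 < u k.
  by move=> K n; exact: K (leqnn n).
elim=> [|n IH] k; first by rewrite leqn0 => /eqP ->.
rewrite leq_eqVlt ltnS => /predU1P[->|]; last exact: IH.
rewrite -(pmulr_rgt0 _ c0) H big_ord_recl/= ltr_pwDl ?mulr_gt0//.
by apply: sumr_ge0 => i _; rewrite mulr_ge0// ltW// IH.
Qed.

(** Kaluza's theorem. Let r = u_(n+1) / u_n and d_j = u_(j+1) - r u_j; by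
    induction d_j <= 0 for j <= n, with d_n = 0. The renewal equation gives
    c (u_(m+2) - r u_(m+1)) = f_(m+1) u_0 + sum_(j <= m) f_(m-j) d_j for every
    m. At m = n - 1 the left-hand side vanishes, which expresses u_0 through
    the d_j; inserting this at m = n leaves a sum over j < n of the terms
    (f_(n-j) - (f_(n+1) / f_n) f_(n-1-j)) d_j, in which both factors are
    nonpositive because the ratios of f increase. *)
Lemma renewal_log_convex c f u : 0 < c -> (forall k, 0 < f k) ->
  (forall k, f k.+1 ^+ 2 <= f k * f k.+2) -> 0 < u 0%N ->
  (forall n, c * u n.+1 = \sum_(j < n.+1) f (n - j)%N * u j) ->
  forall n, u n.+1 ^+ 2 <= u n * u n.+2.
Proof.
move=> c0 f0 fc u0 H; have up := renewal_gt0 c0 f0 u0 H.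
suff K n : forall k, (k < n)%N -> u k.+1 ^+ 2 <= u k * u k.+2.
  by move=> n; exact: (K n.+1).
elim: n => // n IH k; rewrite ltnS leq_eqVlt => /predU1P[->|]; last exact: IH.
have Hr := log_convex_ratio up IH.
set r := u n.+1 / u n in Hr.
pose d j := u j.+1 - r * u j.
have d_le0 j : (j <= n)%N -> d j <= 0.
  by move=> jn; rewrite subr_le0 -ler_pdivrMr// Hr.
have dn : d n = 0 by rewrite /d /r mulfVK ?subrr// gt_eqF.
suff : 0 <= c * (u n.+2 - r * u n.+1).
  rewrite pmulr_rge0// subr_ge0 /r mulrAC ler_pdivrMr// => h.
  by rewrite expr2 [leRHS]mulrC.
have E m : c * (u m.+2 - r * u m.+1) = f m.+1 * u 0%N + \sum_(j < m.+1) f (m - j)%N * d j.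
  rewrite mulrBr mulrCA !H big_ord_recl/= subn0 mulr_sumr -addrA -sumrB.
  congr (_ + _); apply: eq_bigr => j _.
  by rewrite /bump/= add1n subSS /d; ring.
rewrite E big_ord_recr/= dn mulr0 addr0.
have dn' : u n.+1 - r * u n = 0 by [].
clearbody r; clear IH; case: n Hr d_le0 dn dn' => [|n] Hr d_le0 dn dn'.
  by rewrite big_ord0 addr0 mulr_ge0// ltW.
have := E n; rewrite dn' mulr0 => /eqP.
rewrite eq_sym addr_eq0 => /eqP E0.
have {E0}E0 : f n.+2 * u 0%N = - \sum_(j < n.+1) (f n.+2 / f n.+1) * (f (n - j)%N * d j).
  by rewrite -mulr_sumr -mulrN -E0 mulrA mulfVK// gt_eqF.
rewrite E0 addrC -sumrB sumr_ge0// => j _.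
have jn : (j <= n)%N by rewrite -ltnS.
have hr : f (n.+1 - j)%N <= (f n.+2 / f n.+1) * f (n - j)%N.
  rewrite -ler_pdivrMr// subSn//.
  by apply: log_convex_ratio => //; rewrite (leq_trans (leq_subr _ _)).
rewrite mulrA -mulrBl mulr_le0// ?d_le0 ?(leq_trans jn)//.
by rewrite subr_le0.
Qed.

(** The inequality of arithmetic and geometric means. *)
Lemma log_convex_convex a n : 0 < a n -> 0 < a n.+2 ->
  a n.+1 ^+ 2 <= a n * a n.+2 -> a n.+1 + a n.+1 <= a n + a n.+2.
Proof. move: (a n) (a n.+1) (a n.+2) => x y z x0 z0 H.
rewrite leNgt; apply/negP => h.
have h1 : 0 < (y + y - (x + z)) * (y + y + (x + z)) by rewrite mulr_gt0; lra.
have h2 : 0 <= (x - z) ^+ 2 by rewrite sqr_ge0.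
nra. Qed.
End renewal.

Section poly_coef.
Context {R : realFieldType}.

(** Near 0 the bound forces the constant coefficient to vanish; dividing by
    the variable lowers n by one. With this lemma two power series can be
    multiplied and compared through their truncations. *)
Lemma coef_eq0_of_bound (p : {poly R}) (C e : R) n : 0 < e ->
  (forall z, 0 < z -> z < e -> `|p.[z]| <= C * z ^+ n) ->
  forall i, (i < n)%N -> p`_i = 0.
Proof.
move=> e0; elim: n p => // n IH p H.
have [q Hq] : exists q : {poly R}, p = q * 'X + (p.[0])%:P.
  have /factor_theorem[q Hq] : root (p - (p.[0])%:P) 0.
    by rewrite /root !hornerE subrr.
  by exists q; rewrite -[LHS](subrK (p.[0])%:P) Hq subr0.
have p0 : p.[0] = 0.
  apply/eqP; rewrite -normr_le0 leNgt; apply/negP => p0.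
  pose M := \sum_(i < size q) `|q`_i|.
  have qM z : 0 < z -> z <= 1 -> `|q.[z]| <= M.
    move=> z0 z1; rewrite horner_coef (le_trans (ler_norm_sum _ _ _))//.
    apply: ler_sum => i _; rewrite normrM ler_piMr// normrX gtr0_norm// exprn_ile1//.
    exact: ltW.
  have M0 : 0 <= M by apply: sumr_ge0.
  pose B := `|C| + M + 1.
  have B0 : 0 < B by rewrite ltr_wpDl// addr_ge0.
  pose z := Num.min (Num.min (e / 2) 1) (`|p.[0]| / (B * 2)).
  have z0 : 0 < z by rewrite !lt_min ltr01 !divr_gt0// mulr_gt0.
  have z1 : z <= 1 by rewrite !ge_min lexx orbT.
  have ze : z < e.
    by rewrite (@le_lt_trans _ _ (e / 2))// ?ltr_pdivrMr ?ltr_pMr ?ltr1n// !ge_min lexx.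
  have zB : z * B < `|p.[0]|.
    have : z <= `|p.[0]| / (B * 2) by rewrite !ge_min lexx orbT.
    rewrite ler_pdivlMr ?mulr_gt0//; lra.
  have : `|p.[0]| <= z * B.
    rewrite -[p.[0]](addKr (q.[z] * z)) addrC.
    have -> : q.[z] * z + p.[0] = p.[z] by rewrite [in RHS]Hq !hornerE.
    apply: le_trans (ler_normB _ _) _; rewrite normrM (gtr0_norm z0).
    have h1 := H z z0 ze; have h2 := qM z z0 z1.
    have h3 : C * z ^+ n.+1 <= `|C| * z.
      apply: le_trans (ler_norm _) _; rewrite normrM ler_wpM2l// normrX gtr0_norm//.
      rewrite exprS ler_piMr//; first exact: ltW.
      by rewrite exprn_ile1//; exact: ltW.
    have h4 : `|q.[z]| * z <= M * z by rewrite ler_wpM2r//; exact: ltW.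
    rewrite /B; lra.
  by rewrite leNgt zB.
move: Hq; rewrite p0 addr0 => Hq.
case=> [|i] hi; first by rewrite -horner_coef0.
rewrite Hq coefMX/=; apply: (IH q) => // z z0 ze.
have := H z z0 ze.
by rewrite Hq !hornerE normrM (gtr0_norm z0) exprSr mulrA ler_pM2r.
Qed.
End poly_coef.

(** * Concentration of Erlang laws *)

Section approximate_identity.
Context {R : realType}.
Implicit Types (lam x y : R) (k : nat).
Local Notation mu := (@lebesgue_measure R).

(** The rate r is free: it tilts an Erlang density to another
    exponential rate. *)
Lemma exprn_fact_le (r t : R) k : 0 < r -> 0 <= t ->
  t ^+ k / k`!%:R <= r^-1 ^+ k * expR (r * t).
Proof.
move=> r0 t0; have := @expR_monomial_le1 R (r * t) k.
rewrite mulr_ge0 ?(ltW r0)// => /(_ isT).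
rewrite expRN mulrC ler_pdivrMr ?expR_gt0// mul1r exprMn => h.
rewrite exprVn ler_pdivlMl ?exprn_gt0//.
by rewrite mulrA.
Qed.

(** Tilting at rate r = 1 - th / lam. *)
Lemma erlang_pdf_le_exp lam th k y : 0 <= th -> th < lam -> 0 <= y ->
  erlang_pdf lam k y <= lam * ((1 - th / lam)^-1 ^+ k) * expR (- (th * y)).
Proof.
move=> th0 thl y0; have l0 : 0 < lam by exact: le_lt_trans thl.
have r0 : 0 < 1 - th / lam by rewrite subr_gt0 ltr_pdivrMr// mul1r.
rewrite /erlang_pdf -!mulrA; apply: (ler_wpM2l (ltW l0)).
have h := exprn_fact_le k r0 (mulr_ge0 (ltW l0) y0).
have := ler_wpM2l (expR_ge0 (- (lam * y))) h.
move=> /le_trans; apply; rewrite mulrCA -expRD ler_wpM2l//.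
  by rewrite exprn_ge0// invr_ge0 ltW.
rewrite ler_expR; suff -> : (1 - th / lam) * (lam * y) = lam * y - th * y by lra.
by field; rewrite gt_eqF.
Qed.

(** Chernoff bound: if k is close to lam x, an Erlang variable is at distance
    dl from x only with a probability exponentially small in lam. The
    density is tilted by 1 / (1 + ep) on the right of x and by 1 + ep on the
    left. The factor e^(- th y) is split off so that the bound can be integrated
    against a function of exponential growth. *)
Lemma erlang_pdf_away x dl ep tau th lam y k :
  let a := ep / (1 + ep) in
  0 <= x -> 0 < dl -> 0 < ep -> 0 < lam ->
  th <= tau * lam -> 0 <= tau -> tau <= a ->
  lam * (x - tau) <= k%:R -> k%:R <= lam * (x + tau) ->
  0 <= y -> dl <= `|y - x| ->
  erlang_pdf lam k y <= lam * expR (- (lam * (a * (dl - x * ep) - tau * (ep + x + dl))))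
                         * expR (- (th * y)).
Proof.
move=> a x0 d0 e0 l0 thl t0 ta kl ku y0 dyx.
have e1 : 0 < 1 + ep by lra.
have a0 : 0 < a by rewrite divr_gt0.
have ae : a * (1 + ep) = ep by rewrite /a mulfVK// gt_eqF.
have a1 : 1 - a = (1 + ep)^-1 by rewrite /a; field; rewrite gt_eqF.
clearbody a.
have ly0 : 0 <= lam * y by rewrite mulr_ge0// ltW.
rewrite /erlang_pdf -!mulrA; apply: (ler_wpM2l (ltW l0)).
move: dyx; rewrite ler_normr => /orP[dyx|dyx].
- have r0 : 0 < (1 + ep)^-1 by rewrite invr_gt0.
  have h := exprn_fact_le k r0 ly0.
  have := ler_wpM2l (expR_ge0 (- (lam * y))) h.
  move=> /le_trans; apply; rewrite invrK.
  have h1 : (1 + ep) ^+ k <= expR (ep * k%:R).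
    by rewrite expRM_natr lerXn2r ?nnegrE ?expR_ge0 ?(ltW e1)// expR_ge1Dx.
  have := ler_wpM2r (expR_ge0 ((1 + ep)^-1 * (lam * y))) h1.
  move/(ler_wpM2l (expR_ge0 (- (lam * y)))) => /le_trans; apply.
  rewrite -!expRD ler_expR -a1.
  have h2 : ep * k%:R <= ep * (lam * (x + tau)) by rewrite ler_wpM2l// ltW.
  have h3 : (a * lam - th) * (x + dl) <= (a * lam - th) * y.
    rewrite ler_wpM2l; [by []| |lra].
    by rewrite subr_ge0 (le_trans thl)// ler_wpM2r// ltW.
  have h4 : th * (x + dl) <= tau * lam * (x + dl) by rewrite ler_wpM2r//; lra.
  have h6 : lam * x * (a * (1 + ep)) = lam * x * ep by rewrite ae.
  lra.
- have h := exprn_fact_le k e1 ly0.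
  have := ler_wpM2l (expR_ge0 (- (lam * y))) h.
  move=> /le_trans; apply.
  have h1 : (1 + ep)^-1 ^+ k <= expR (- a * k%:R).
    rewrite expRM_natr lerXn2r ?nnegrE ?expR_ge0 ?invr_ge0 ?(ltW e1)//.
    by rewrite -a1; have := expR_ge1Dx (- a); lra.
  have := ler_wpM2r (expR_ge0 ((1 + ep) * (lam * y))) h1.
  move/(ler_wpM2l (expR_ge0 (- (lam * y)))) => /le_trans; apply.
  rewrite -!expRD ler_expR.
  have h2 : a * (lam * (x - tau)) <= a * k%:R by rewrite ler_wpM2l// ltW.
  have h3 : ep * lam * y <= ep * lam * (x - dl).
    by rewrite ler_wpM2l// ?mulr_ge0 ?(ltW l0) ?(ltW e0)//; lra.
  have h4 : th * y <= tau * lam * y by rewrite ler_wpM2r//; lra.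
  have h5 : tau * lam * y <= tau * lam * (x - dl).
    by rewrite ler_wpM2l// ?mulr_ge0 ?(ltW l0)//; lra.
  have h6 : lam * x * (a * (1 + ep)) = lam * x * ep by rewrite ae.
  have h7 : 0 <= (ep - a) * (lam * (dl + tau)).
    rewrite !mulr_ge0 ?(ltW l0)//; last lra.
    by rewrite -{1}ae mulrDr mulr1 addrAC subrr add0r mulr_ge0// ltW.
  have h8 : 0 <= lam * tau * dl by rewrite !mulr_ge0// ltW.
  lra.
Qed.
End approximate_identity.

Section real_integrable.
Context d (T : measurableType d) {R : realType}.
Variables (nu : {measure set T -> \bar R}) (A : set T).
Hypothesis mA : measurable A.
Implicit Types f g : T -> R.

Lemma integrable_dominated f g (C : R) :
  measurable_fun A f -> nu.-integrable A (EFin \o g) ->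
  (forall t, A t -> `|f t| <= C * g t) -> nu.-integrable A (EFin \o f).
Proof.
move=> mf ig H.
apply: (@le_integrable _ _ _ nu A mA (EFin \o f) (fun t => C%:E * (EFin \o g) t)%E).
- exact/measurable_EFinP.
- by move=> t At /=; rewrite lee_fin (le_trans (H t At))//; exact: ler_norm.
- exact: integrableZl.
Qed.

Lemma integrable_mulc (c : R) f : nu.-integrable A (EFin \o f) ->
  nu.-integrable A (EFin \o (fun t => c * f t)).
Proof. by move=> If; exact: (integrableZl mA c If). Qed.

Lemma integrable_add f g : nu.-integrable A (EFin \o f) ->
  nu.-integrable A (EFin \o g) -> nu.-integrable A (EFin \o (fun t => f t + g t)).
Proof. by move=> If Ig; exact: (integrableD mA If Ig). Qed.

Lemma integrable_opp f : nu.-integrable A (EFin \o f) ->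
  nu.-integrable A (EFin \o (fun t => - f t)).
Proof. by move=> If; exact: (integrableN If). Qed.

Lemma integrable_sub f g : nu.-integrable A (EFin \o f) ->
  nu.-integrable A (EFin \o g) -> nu.-integrable A (EFin \o (fun t => f t - g t)).
Proof. by move=> If Ig; exact: (integrable_add If (integrable_opp Ig)). Qed.
End real_integrable.

Section erlang_approximation.
Context {R : realType}.
Implicit Types (lam th x y : R) (k : nat) (f : R -> R).
Local Notation mu := (@lebesgue_measure R).
Local Notation D := (`[0%R, +oo[%classic : set R).

Definition exp_integrable th f :=
  mu.-integrable D (EFin \o (fun y => expR (- (th * y)) * f y)).

Lemma continuous_expRN_mulc th : continuous (fun y : R => expR (- (th * y))).
Proof.
move=> x; exact: (is_derive_continuous (is_derive_exp_comp (is_derive_opp (is_derive_mulc th x)))).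
Qed.

Lemma exp_integrable_measurable th f : exp_integrable th f -> measurable_fun D f.
Proof.
move=> /measurable_int /measurable_EFinP mf.
have -> : f = (fun y => expR (th * y) * (expR (- (th * y)) * f y)).
  by apply/funext => y; rewrite mulrA -expRD subrr expR0 mul1r.
apply: measurable_funM => //.
by apply: continuous_measurable => //; exact: continuous_expR_mulc.
Qed.

Lemma exp_integrable_le th f (h : R -> R) (C : R) : exp_integrable th f ->
  measurable_fun D h -> (forall y, 0 <= y -> `|h y| <= C * (expR (- (th * y)) * `|f y|)) ->
  mu.-integrable D (EFin \o h).
Proof.
move=> If mh H; apply: (integrable_dominated (C := C) _ _ (integrable_norm If)) => //.
move=> y; rewrite /= in_itv/= andbT => y0.
by rewrite normrM (gtr0_norm (expR_gt0 _)) H.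
Qed.

Lemma exp_integrable_mono th th' f : th <= th' -> exp_integrable th f -> exp_integrable th' f.
Proof.
move=> tt If; apply: (exp_integrable_le (C := 1) If).
  apply: measurable_funM; last exact: exp_integrable_measurable If.
  by apply: continuous_measurable => //; exact: continuous_expRN_mulc.
move=> y y0; rewrite mul1r normrM (gtr0_norm (expR_gt0 _)) ler_wpM2r//.
by rewrite ler_expR lerN2 ler_wpM2r.
Qed.

Lemma exp_integrable_const th (c : R) : 0 < th -> exp_integrable th (cst c).
Proof.
move=> th0; suff : mu.-integrable D (EFin \o erlang_pdf th 0).
  move=> IK; apply: (integrable_dominated (C := `|c| / th) _ _ IK) => //.
    apply: measurable_funM => //.
    by apply: continuous_measurable => //; exact: continuous_expRN_mulc.
  move=> x _; rewrite /erlang_pdf expr0 fact0 divr1 mulr1 normrM (gtr0_norm (expR_gt0 _)).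
  by rewrite mulrA mulfVK ?gt_eqF// mulrC.
have mf : measurable_fun D (erlang_pdf th 0).
  by apply: continuous_measurable => //; exact: continuous_erlang_pdf.
apply/integrableP; split; first exact/measurable_EFinP.
have := @integral_fin_num_abs _ _ _ mu D (erlang_pdf th 0) _ mf.
by move=> ->//; rewrite integral_erlang_pdf.
Qed.

Lemma exp_integrableD th f g : exp_integrable th f -> exp_integrable th g ->
  exp_integrable th (fun y => f y + g y).
Proof.
move=> If Ig; apply: eq_integrable (integrable_add _ If Ig) => // y _ /=.
by rewrite mulrDr EFinD.
Qed.

Lemma exp_integrableN th f : exp_integrable th f -> exp_integrable th (fun y => - f y).
Proof.
move=> If; apply: eq_integrable (integrableN If) => // y _ /=.
by rewrite mulrN EFinN.
Qed.

Lemma integrable_erlang_pdf_mul th lam k f : 0 <= th -> th < lam -> exp_integrable th f ->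
  mu.-integrable D (EFin \o (fun y => erlang_pdf lam k y * f y)).
Proof.
move=> t0 tl If; have l0 : 0 <= lam by apply: le_trans (ltW tl).
apply: (exp_integrable_le (C := lam * (1 - th / lam)^-1 ^+ k) If).
  apply: measurable_funM; last exact: exp_integrable_measurable If.
  by apply: continuous_measurable => //; exact: continuous_erlang_pdf.
move=> y y0; rewrite normrM mulrA ler_wpM2r// ger0_norm ?erlang_pdf_ge0//.
exact: erlang_pdf_le_exp.
Qed.

Lemma integrable_erlang_pdf lam k : 0 < lam -> mu.-integrable D (EFin \o erlang_pdf lam k).
Proof.
move=> l0; have h2 : 0 < lam / 2 by rewrite divr_gt0.
have := integrable_erlang_pdf_mul k (ltW h2) _ (exp_integrable_const 1 h2).
move=> /(_ lam); rewrite ltr_pdivrMr// ltr_pMr// ltr1n => /(_ isT).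
by apply: eq_integrable => // y _ /=; rewrite mulr1.
Qed.

Lemma Rintegral_erlang_pdf lam k : 0 < lam -> \int[mu]_(x in D) erlang_pdf lam k x = 1.
Proof. by move=> l0; rewrite /Rintegral integral_erlang_pdf. Qed.

(** By t^2 / 2 <= e^t. *)
Lemma cvg_natmul_expR (eta c : R) : 0 < eta ->
  n%:R * expR (- (n%:R * eta)) * c @[n --> \oo] --> 0.
Proof.
move=> e0; apply/cvgrPdist_le => e ep; near=> n.
have n0 : (0 < n)%N by near: n; exact: nbhs_infty_gt.
have n0R : 0 < n%:R :> R by rewrite ltr0n.
rewrite sub0r normrN !normrM (gtr0_norm (expR_gt0 _)) (gtr0_norm n0R).
have ne : 0 < n%:R * eta by rewrite mulr_gt0.
have := expR_monomial_le1 2 (ltW ne).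
rewrite -ler_pdivlMr ?divr_gt0 ?exprn_gt0// div1r invf_div => h.
have := ler_wpM2r (normr_ge0 c) (ler_wpM2l (ltW n0R) h).
move/le_trans; apply.
have -> : n%:R * (2`!%:R / (n%:R * eta) ^+ 2) * `|c| =
  (2 / eta ^+ 2 * `|c|) / n%:R.
  by rewrite (_ : 2`!%:R = 2)//; field; rewrite !gt_eqF.
rewrite ler_pdivrMr// -ler_pdivrMl//.
by near: n; exact: nbhs_infty_ger.
Unshelve. all: by end_near. Qed.

(** Here ep is small enough for dl - x ep to be positive, and tau small enough
    for the deviation of k_n / n from x to cost at most half of the resulting
    exponent. *)
Lemma erlang_concentrate (th x dl : R) (k : nat -> nat) : 0 <= th -> 0 <= x -> 0 < dl ->
  (k n)%:R / n%:R @[n --> \oo] --> x ->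
  exists2 eta : R, 0 < eta & \forall n \near \oo, forall y, 0 <= y -> dl <= `|y - x| ->
     erlang_pdf n%:R (k n) y <= n%:R * expR (- (n%:R * eta)) * expR (- (th * y)).
Proof.
move=> th0 x0 d0 kx.
pose ep := dl / (2 * (x + dl)).
have xd : 0 < x + dl by rewrite ltr_wpDl.
have ep0 : 0 < ep by rewrite divr_gt0// mulr_gt0.
have xep : 0 < dl - x * ep.
  rewrite subr_gt0 /ep mulrA ltr_pdivrMr ?mulr_gt0// mulrC.
  by rewrite ltr_pM2l//; lra.
pose a := ep / (1 + ep).
have a0 : 0 < a by rewrite divr_gt0// addr_gt0.
pose S := ep + x + dl.
have S0 : 0 < S by rewrite /S; lra.
pose tau := Num.min a (a * (dl - x * ep) / (2 * S)).
have tau0 : 0 < tau by rewrite lt_min a0 divr_gt0// mulr_gt0.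
exists (a * (dl - x * ep) / 2); first by rewrite divr_gt0// mulr_gt0.
near=> n => y y0 dy.
have n0 : (0 < n)%N by near: n; exact: nbhs_infty_gt.
have n0R : 0 < n%:R :> R by rewrite ltr0n.
have kn : `|x - (k n)%:R / n%:R| <= tau.
  by near: n; move/cvgrPdist_le: kx; exact.
have [k1 k2] : n%:R * (x - tau) <= (k n)%:R /\ (k n)%:R <= n%:R * (x + tau).
  move: kn; rewrite ler_norml => /andP[h1 h2].
  split; first by rewrite mulrC -ler_pdivlMr//; lra.
  by rewrite mulrC -ler_pdivrMr//; lra.
have thn : th <= tau * n%:R.
  by rewrite mulrC -ler_pdivrMr//; near: n; exact: nbhs_infty_ger.
have ta : tau <= a by rewrite ge_min lexx.
apply: le_trans (erlang_pdf_away x0 d0 ep0 n0R thn (ltW tau0) ta k1 k2 y0 dy) _.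
rewrite ler_wpM2r ?expR_ge0// ler_wpM2l ?(ltW n0R)// ler_expR lerN2 ler_wpM2l ?(ltW n0R)//.
rewrite -/a.
have : tau * S <= a * (dl - x * ep) / 2.
  rewrite -ler_pdivlMr//.
  have : tau <= a * (dl - x * ep) / (2 * S) by rewrite ge_min lexx orbT.
  by rewrite invfM mulrA.
rewrite /S; lra.
Unshelve. all: by end_near. Qed.

(** The Erlang laws of rate n and order k_n, with k_n / n close to x, form an
    approximate identity at x: f is almost f x at distance less than dl
    from x, and the rest of the mass is exponentially small even against
    e^(th y). *)
Theorem erlang_approx (th x : R) f (k : nat -> nat) : 0 < th -> 0 <= x ->
  exp_integrable th f ->
  (forall e, 0 < e -> exists2 dl, 0 < dl & forall y, 0 <= y -> `|y - x| < dl -> `|f y - f x| <= e) ->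
  (k n)%:R / n%:R @[n --> \oo] --> x ->
  \int[mu]_(y in D) (erlang_pdf n%:R (k n) y * f y) @[n --> \oo] --> f x.
Proof.
move=> th0 x0 If cf kx.
pose g y := f y - f x.
have Ig : exp_integrable th g.
  apply: exp_integrableD => //; exact: exp_integrableN (exp_integrable_const _ th0).
pose M := \int[mu]_(y in D) (expR (- (th * y)) * `|g y|).
have INg : mu.-integrable D (EFin \o (fun y => expR (- (th * y)) * `|g y|)).
  apply: eq_integrable (integrable_norm Ig) => // y _ /=.
  by rewrite normrM (gtr0_norm (expR_gt0 _)).
apply/cvgrPdist_le => e e0.
have e20 : 0 < e / 2 by rewrite divr_gt0.
have [dl d0 Hd] := cf _ e20.
have [eta eta0 He] := erlang_concentrate (ltW th0) x0 d0 kx.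
have Hc := cvg_natmul_expR M eta0.
near=> n.
have tn : th < n%:R by near: n; exact: nbhs_infty_gtr.
have n0R : 0 < n%:R :> R by exact: lt_trans tn.
have IK := integrable_erlang_pdf (k n) n0R.
have IKf := integrable_erlang_pdf_mul (k n) (ltW th0) tn If.
have IKg := integrable_erlang_pdf_mul (k n) (ltW th0) tn Ig.
have -> : f x - \int[mu]_(y in D) (erlang_pdf n%:R (k n) y * f y) =
   - \int[mu]_(y in D) (erlang_pdf n%:R (k n) y * g y).
  have -> : \int[mu]_(y in D) (erlang_pdf n%:R (k n) y * g y) =
    \int[mu]_(y in D) (erlang_pdf n%:R (k n) y * f y - f x * erlang_pdf n%:R (k n) y).
    by apply: eq_Rintegral => y _; rewrite /g; ring.
  rewrite RintegralB//; last exact: integrable_mulc.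
  rewrite RintegralZl// Rintegral_erlang_pdf// mulr1; ring.
rewrite normrN.
apply: (le_trans (le_normr_Rintegral _ IKg)) => //.
have HB : forall y, 0 <= y -> dl <= `|y - x| -> erlang_pdf n%:R (k n) y <=
    n%:R * expR (- (n%:R * eta)) * expR (- (th * y)).
  by near: n; exact: He.
pose B := n%:R * expR (- (n%:R * eta)).
have I1 : mu.-integrable D (EFin \o (fun y => e / 2 * erlang_pdf n%:R (k n) y)) by exact: integrable_mulc.
have I2 : mu.-integrable D (EFin \o (fun y => B * (expR (- (th * y)) * `|g y|))) by exact: integrable_mulc.
apply: (@le_trans _ _ (\int[mu]_(y in D) (e / 2 * erlang_pdf n%:R (k n) y +
    B * (expR (- (th * y)) * `|g y|)))).
  apply: le_Rintegral => //.
  - exact: integrable_norm.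
  - exact: integrable_add I1 I2.
  move=> y; rewrite /= in_itv/= andbT => y0.
  have K0 := erlang_pdf_ge0 (k n) (ltW n0R) y0.
  have B0 : 0 <= B by rewrite mulr_ge0 ?expR_ge0 ?(ltW n0R).
  rewrite normrM (ger0_norm K0).
  have [yd|yd] := ltP `|y - x| dl.
    have := Hd y y0 yd; rewrite -/(g y) => hg.
    rewrite ler_wpDr//; first by rewrite mulr_ge0// mulr_ge0 ?expR_ge0.
    by rewrite mulrC ler_wpM2r.
  rewrite ler_wpDl//; first by rewrite mulr_ge0// ltW.
  rewrite mulrA ler_wpM2r//.
  exact: HB.
rewrite RintegralD// RintegralZl// RintegralZl// Rintegral_erlang_pdf// mulr1 -/M.
have : `|0 - n%:R * expR (- (n%:R * eta)) * M| <= e / 2.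
  by near: n; move/cvgrPdist_le: Hc; exact.
rewrite -/B sub0r normrN => /(le_trans (ler_norm _)); lra.
Unshelve. all: by end_near. Qed.
End erlang_approximation.

(** * Levy measures and the integrand of the Laplace exponent *)

Section exp_inequalities.
Context {R : realType}.
Implicit Types (u v t : R).

Lemma expRN_le1 u : 0 <= u -> expR (- u) <= 1.
Proof. by move=> u0; rewrite expR_le1 oppr_le0. Qed.

(** From 1 + t <= e^t at t = u and t = - u. *)
Lemma expRN_taylor2 u : 0 <= u -> 0 <= expR (- u) - 1 + u <= u ^+ 2.
Proof.
move=> u0; have h := expR_ge1Dx (- u); apply/andP; split; first lra.
have h2 := expR_ge1Dx u.
have u1 : 0 < 1 + u by lra.
have : expR (- u) <= (1 + u)^-1 by rewrite expRN lef_pV2// ?posrE ?expR_gt0.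
have : (1 + u)^-1 <= 1 - u + u ^+ 2.
  rewrite -[leLHS]mul1r ler_pdivrMr//.
  have : 0 <= u ^+ 3 by rewrite exprn_ge0.
  rewrite (_ : (1 - u + u ^+ 2) * (1 + u) = 1 + u ^+ 3); [lra|ring].
lra.
Qed.

(** Convexity of the exponential between - u and 0. *)
Lemma expRN_star t u : 0 <= t -> t <= 1 -> expR (- (t * u)) <= 1 - t + t * expR (- u).
Proof.
move=> t0 t1.
have h1 := expR_ge1Dx (t * u).
have h2 := expR_ge1Dx (- ((1 - t) * u)).
have e0 := expR_ge0 (- (t * u)).
have : (1 + t * u) * expR (- (t * u)) <= 1.
  apply: le_trans (ler_wpM2r e0 h1) _.
  by rewrite -expRD subrr expR0.
have : (1 - (1 - t) * u) * expR (- (t * u)) <= expR (- u).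
  apply: le_trans (ler_wpM2r e0 h2) _.
  by rewrite -expRD ler_expR; lra.
move=> /(ler_wpM2l t0) H2 H1.
have t1' : 0 <= 1 - t by lra.
have := ler_wpM2l t1' H1.
set E := expR (- (t * u)) in H1 H2 *; lra.
Qed.

Lemma expRN_lipschitz u v : u <= v ->
  (v - u) * expR (- v) <= expR (- u) - expR (- v) <= (v - u) * expR (- u).
Proof.
move=> uv.
have h1 := ler_wpM2r (expR_ge0 (- v)) (expR_ge1Dx (v - u)).
have h2 := ler_wpM2r (expR_ge0 (- u)) (expR_ge1Dx (u - v)).
rewrite -!expRD (_ : v - u - v = - u) in h1; last lra.
rewrite -!expRD (_ : u - v - u = - v) in h2; last lra.
apply/andP; split; lra.
Qed.
End exp_inequalities.

Section levy.
Context {R : realType} (nu : {measure set R -> \bar R}) (hnu : levy_measure nu).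
Local Notation D := (`]0%R, +oo[%classic : set R).
Implicit Types (x y z th lam : R).

Definition min1sq x : R := Num.min 1 (x ^+ 2).

Lemma min1sq_ge0 x : 0 <= min1sq x.
Proof. by rewrite le_min ler01 sqr_ge0. Qed.

Lemma min1sq_small x : 0 <= x -> x <= 1 -> min1sq x = x ^+ 2.
Proof. by move=> x0 x1; apply/min_idPr; rewrite exprn_ile1. Qed.

Lemma min1sq_large x : 1 <= x -> min1sq x = 1.
Proof. by move=> x1; apply/min_idPl; rewrite exprn_ege1. Qed.

Lemma measurable_min1sq : measurable_fun D min1sq.
Proof.
by apply: measurable_minr.
Qed.

Lemma integrable_min1sq : nu.-integrable D (EFin \o min1sq).
Proof.
case: hnu => _ _ h; apply/integrableP; split.
  by apply/measurable_EFinP; exact: measurable_min1sq.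
rewrite [ltLHS](_ : _ = \int[nu]_(x in D) (Num.min 1 (x ^+ 2))%:E)%E//.
by apply: eq_integral => x _; rewrite /= ger0_norm// min1sq_ge0.
Qed.

Lemma levy_integrable (f : R -> R) (C : R) : measurable_fun D f ->
  (forall x, 0 < x -> `|f x| <= C * min1sq x) -> nu.-integrable D (EFin \o f).
Proof.
move=> mf H; apply: (integrable_dominated (C := C) _ mf integrable_min1sq) => //.
by move=> x; rewrite /= in_itv/= andbT; exact: H.
Qed.

(** Markov inequality for the integrable function min(1, x^2). *)
Lemma levy_tail_fin x : 0 < x -> (nu `]x, +oo[%classic < +oo)%E.
Proof.
move=> x0; case: hnu => _ _ h.
pose c := min1sq x.
have c0 : 0 < c by rewrite lt_min ltr01 exprn_gt0.
have : (c%:E * nu `]x, +oo[%classic <= \int[nu]_(x in D) (min1sq x)%:E)%E.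
  rewrite -integral_cst//.
  apply: (@le_trans _ _ (\int[nu]_(x in `]x, +oo[) (min1sq x)%:E)%E).
    apply: ge0_le_integral => //.
    - by move=> y _; rewrite lee_fin ltW.
    - apply/measurable_EFinP; apply: measurable_funS measurable_min1sq => //.
      by move=> y; rewrite /= !in_itv/= !andbT => xy; exact: lt_trans xy.
    move=> y; rewrite /= in_itv/= andbT => xy; rewrite lee_fin /c /min1sq.
    rewrite le_min !ge_min lexx/=; apply/orP; right.
    by rewrite ler_pXn2r ?nnegrE ?ltW// (lt_trans x0).
  apply: ge0_subset_integral => //.
  - by apply/measurable_EFinP; exact: measurable_min1sq.
  - by move=> y _; rewrite lee_fin min1sq_ge0.
  by move=> y; rewrite /= !in_itv/= !andbT => xy; exact: lt_trans xy.
move=> /le_lt_trans/(_ h).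
case: (nu _) (measure_ge0 nu `]x, +oo[%classic) => [r _ _|_|//]; first exact: ltry.
by rewrite gt0_muley ?lte_fin.
Qed.

Lemma tailE x : 0 < x -> (tail nu x)%:E = nu `]x, +oo[%classic.
Proof.
by move=> x0; rewrite /tail fineK// ge0_fin_numE ?measure_ge0// levy_tail_fin.
Qed.

Definition levy_kernel th z : R := expR (- (th * z)) - 1 + th * z * \1_`]0, 1]%classic z.

Lemma measurable_levy_kernel th : measurable_fun D (levy_kernel th).
Proof.
apply: measurable_funD.
  apply: measurable_funB => //; apply: continuous_measurable => //.
  exact: continuous_expRN_mulc.
by apply: measurable_funM; [exact: measurable_funM|exact: measurable_indic].
Qed.

Lemma levy_kernel_small th z : 0 < z -> z <= 1 -> levy_kernel th z = expR (- (th * z)) - 1 + th * z.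
Proof. by move=> z0 z1; rewrite /levy_kernel indicE mem_set ?mulr1//= in_itv/= z0. Qed.

Lemma levy_kernel_large th z : 1 < z -> levy_kernel th z = expR (- (th * z)) - 1.
Proof.
move=> z1; rewrite /levy_kernel indicE memNset ?mulr0 ?addr0//= in_itv/=.
by apply/negP; rewrite negb_and -ltNge z1 orbT.
Qed.

Lemma levy_kernel_bound th z : 0 <= th -> 0 < z -> `|levy_kernel th z| <= (1 + th ^+ 2) * min1sq z.
Proof.
move=> t0 z0; have [z1|z1] := leP z 1.
  rewrite levy_kernel_small// (min1sq_small (ltW z0) z1).
  have /andP[h1 h2] := expRN_taylor2 (mulr_ge0 t0 (ltW z0)).
  rewrite ger0_norm// (le_trans h2)// exprMn ler_wpM2r ?sqr_ge0//; lra.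
rewrite levy_kernel_large// (min1sq_large (ltW z1)) mulr1 ler0_norm; last first.
  by rewrite subr_le0 expRN_le1// mulr_ge0// ltW.
have := expR_ge0 (- (th * z)); have := sqr_ge0 th; lra.
Qed.

Lemma integrable_levy_kernel th : 0 <= th -> nu.-integrable D (EFin \o levy_kernel th).
Proof.
move=> t0; apply: (levy_integrable (C := 1 + th ^+ 2)); first exact: measurable_levy_kernel.
by move=> z; exact: levy_kernel_bound.
Qed.

Lemma levy_kernel_star t th z : 0 <= t -> t <= 1 -> 0 <= th -> 0 < z ->
  levy_kernel (t * th) z <= t * levy_kernel th z.
Proof.
move=> t0 t1 th0 z0; have h := @expRN_star R t (th * z) t0 t1.
rewrite /levy_kernel; move: (\1_ _ _) => i.
rewrite -!mulrA; lra.
Qed.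

Lemma levy_kernel_lipschitz a b th th' z : 0 < a -> a <= th -> th <= th' -> th' <= b -> 0 < z ->
  `|levy_kernel th' z - levy_kernel th z| <= (th' - th) * (b + a^-1) * min1sq z.
Proof.
move=> a0 ath tht thb z0.
have tz : th * z <= th' * z by rewrite ler_wpM2r// ltW.
have /andP[h1 h2] := expRN_lipschitz tz.
have th0 : 0 < th by exact: lt_le_trans ath.
have th'0 : 0 < th' by exact: lt_le_trans tht.
have ai : 0 < a^-1 by rewrite invr_gt0.
have [z1|z1] := leP z 1.
  rewrite !levy_kernel_small// (min1sq_small (ltW z0) z1).
  have -> : expR (- (th' * z)) - 1 + th' * z - (expR (- (th * z)) - 1 + th * z) =
    (th' * z - th * z) - (expR (- (th * z)) - expR (- (th' * z))) by lra.
  have e1 := expR_ge1Dx (- (th' * z)).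
  have e2 : expR (- (th * z)) <= 1 by rewrite expRN_le1// mulr_ge0// ltW.
  have d0 : 0 <= th' * z - th * z by lra.
  have h3 := ler_wpM2l d0 e1; have h4 := ler_wpM2l d0 e2.
  rewrite ger0_norm; last lra.
  apply: (@le_trans _ _ ((th' * z - th * z) * (th' * z))); first lra.
  have -> : (th' * z - th * z) * (th' * z) = (th' - th) * th' * z ^+ 2 by ring.
  rewrite ler_wpM2r ?sqr_ge0// ler_wpM2l ?subr_ge0//; lra.
rewrite !levy_kernel_large// (min1sq_large (ltW z1)) mulr1.
rewrite (_ : _ - _ = - (expR (- (th * z)) - expR (- (th' * z)))); last lra.
have h0 : 0 <= (th' * z - th * z) * expR (- (th' * z)).
  by rewrite mulr_ge0 ?expR_ge0// subr_ge0.
rewrite normrN ger0_norm; last lra.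
rewrite (le_trans h2)// -mulrBl -mulrA ler_wpM2l ?subr_ge0//.
suff -> : z * expR (- (th * z)) <= b + a^-1 by [].
have := expR_monomial_le1 1 (mulr_ge0 (ltW th0) (ltW z0)).
  rewrite expr1 (_ : 1`!%:R = 1)// divr1 => h.
  have : th * (z * expR (- (th * z))) <= 1 by move: h; lra.
  rewrite -ler_pdivlMl// mulr1 => h'.
  have : th^-1 <= a^-1 by rewrite lef_pV2.
  lra.
Qed.
End levy.

(** * The right inverse of the Laplace exponent *)

Section star_shaped.
Context {R : realType} (psi : R -> R).
Hypothesis star : forall t th, 0 <= t -> t <= 1 -> 0 <= th -> psi (t * th) <= t * psi th.
Hypothesis cont : forall a b, 0 < a -> a <= b -> {within `[a, b], continuous psi}.
Variable th0 : R.
Hypotheses (th00 : 0 < th0) (psi_th0 : 0 < psi th0).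
Implicit Types (a b q r s t : R).

(** The Laplace exponent is convex and vanishes at 0. What matters is the
    resulting inequality psi (t th) <= t psi th: psi s / s is nondecreasing, so
    that psi, once positive, increases to infinity. *)
Lemma star_ratio s t : 0 < s -> s <= t -> psi s <= s / t * psi t.
Proof.
move=> s0 st; have t0 : 0 < t by exact: lt_le_trans st.
have {1}-> : s = s / t * t by rewrite mulfVK// gt_eqF.
by apply: star; rewrite ?ler_pdivrMr ?mul1r ?divr_ge0 ?(ltW s0) ?(ltW t0).
Qed.

Lemma star_unbounded r : exists2 M, th0 <= M & r < psi M.
Proof.
pose M := Num.max th0 ((r + 1) / (psi th0 / th0)).
have M0 : th0 <= M by rewrite le_max lexx.
exists M => //; have M00 : 0 < M by exact: lt_le_trans M0.
have h := star_ratio th00 M0.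
have k0 : 0 < psi th0 / th0 by rewrite divr_gt0.
have : (r + 1) / (psi th0 / th0) <= M by rewrite le_max lexx orbT.
rewrite ler_pdivrMr// => h2; have : M * (psi th0 / th0) <= psi M.
  rewrite mulrA ler_pdivrMr//; move: h; rewrite mulrAC ler_pdivlMr//.
  by rewrite mulrC [X in _ <= X]mulrC.
lra.
Qed.

Lemma star_small r : 0 < r -> exists2 t, 0 < t <= th0 & psi t < r.
Proof.
move=> r0; pose t := Num.min 1 (r / (psi th0 * 2)).
have t0 : 0 < t by rewrite lt_min ltr01 divr_gt0// mulr_gt0.
have t1 : t <= 1 by rewrite ge_min lexx.
exists (t * th0); first by rewrite mulr_gt0//= ler_piMl// ltW.
apply: le_lt_trans (star (ltW t0) t1 (ltW th00)) _.
have : t <= r / (psi th0 * 2) by rewrite ge_min lexx orbT.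
rewrite ler_pdivlMr ?mulr_gt0//; lra.
Qed.

Lemma star_gt s t q : 0 < s -> s <= t -> 0 <= q -> q < psi s -> q < psi t.
Proof.
move=> s0 st q0 qs; have t0 := lt_le_trans s0 st.
have h := star_ratio s0 st.
have : s * psi s <= s * psi t.
  apply: (@le_trans _ _ (t * psi s)).
    by rewrite ler_wpM2r// (le_trans q0)// ltW.
  by move: h; rewrite mulrAC ler_pdivlMr// [psi s * t]mulrC.
by rewrite ler_pM2l// => /(lt_le_trans qs).
Qed.

Lemma right_inverse_ge0 q : 0 <= right_inverse psi q.
Proof.
rewrite /right_inverse.
case: (pselect ([set l | 0 <= l /\ psi l = q] !=set0)) => [[x [x0 px]]|h].
  have [hs|hs] := pselect (has_sup [set l | 0 <= l /\ psi l = q]).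
    by apply: (le_trans x0); apply: ub_le_sup; [case: hs|split].
  by rewrite sup_out.
by rewrite sup_out// => -[].
Qed.

Lemma star_root_le s l q : 0 < s -> 0 <= q -> q < psi s -> psi l = q -> l <= s.
Proof.
move=> s0 q0 qs pl; rewrite leNgt; apply/negP => sl.
by have := star_gt s0 (ltW sl) q0 qs; rewrite pl ltxx.
Qed.

Lemma right_inverse_le s q : 0 < s -> 0 <= q -> q < psi s -> right_inverse psi q <= s.
Proof.
move=> s0 q0 qs; rewrite /right_inverse.
case: (pselect ([set l | 0 <= l /\ psi l = q] !=set0)) => h.
  by apply: ge_sup => // l [_ pl]; exact: (star_root_le s0 q0 qs pl).
by rewrite sup_out; [exact: ltW|case].
Qed.

Lemma star_ivt a b v : 0 < a -> a <= b -> psi a <= v -> v <= psi b ->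
  exists2 c, a <= c <= b & psi c = v.
Proof.
move=> a0 ab av vb.
have [|c] := @IVT R psi a b v ab (cont a0 ab).
  by rewrite ge_min av/= le_max vb orbT.
by rewrite in_itv/= => h e; exists c.
Qed.

(** Were psi s <= q at some s beyond the last root, the intermediate value
    theorem would produce a root to the right of s. *)
Lemma right_inverse_gt s q : 0 <= q -> right_inverse psi q < s -> q < psi s.
Proof.
move=> q0 hs; have s0 : 0 < s by apply: le_lt_trans hs; exact: right_inverse_ge0.
rewrite ltNge; apply/negP => sq.
have [M M0 qM] := star_unbounded q.
have MM0 : 0 < M by exact: lt_le_trans M0.
have sM : s <= M.
  rewrite leNgt; apply/negP => Ms.
  by have := star_gt MM0 (ltW Ms) q0 qM; rewrite ltNge sq.
have [c /andP[sc cM] pc] := star_ivt s0 sM sq (ltW qM).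
have : c <= right_inverse psi q.
  apply: ub_le_sup; last by split => //; rewrite (le_trans (ltW s0)).
  by exists M => l [_ pl]; exact: (star_root_le MM0 q0 qM pl).
by rewrite leNgt (lt_le_trans hs sc).
Qed.

(** For r > 0 there is exactly one positive root: two roots a < b would
    contradict psi a <= (a / b) psi b. *)
Lemma psi_right_inverse r : 0 < r -> psi (right_inverse psi r) = r /\ 0 < right_inverse psi r.
Proof.
move=> r0; have [t /andP[t0 tth] pt] := star_small r0.
have [M M0 rM] := star_unbounded r.
have [c /andP[tc cM] pc] := star_ivt t0 (le_trans tth M0) (ltW pt) (ltW rM).
have c0 : 0 < c by exact: lt_le_trans tc.
suff -> : right_inverse psi r = c by [].
rewrite /right_inverse (_ : [set l | _] = [set c]) ?sup1//.
apply/seteqP; split => [l [l0 pl]|l ->] /=; last by split => //; exact: ltW.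
have noroot a b : 0 < a -> a < b -> psi a = r -> psi b = r -> False.
  move=> a0 ab pa pb; have := star_ratio a0 (ltW ab).
  rewrite pa pb -[leLHS]mul1r ler_pM2r// ler_pdivlMr ?(lt_trans a0)// mul1r.
  by rewrite leNgt ab.
have lpos : 0 < l.
  rewrite lt_neqAle l0 andbT; apply/eqP => l00; have := star (lexx 0) ler01 (ltW th00).
  by rewrite !mul0r l00 pl; lra.
by have [lc|cl|//] := ltgtP l c; [case: (noroot l c)|case: (noroot c l)].
Qed.

(** A root of psi = q + p / 2 separates the two. *)
Lemma right_inverse_lt p q : 0 <= q -> 0 < p -> right_inverse psi q < right_inverse psi (p + q).
Proof.
move=> q0 p0; have pq0 : 0 < p + q by lra.
have [pF F0] := psi_right_inverse pq0.
set F := right_inverse psi (p + q) in pF F0 *.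
have r0 : 0 < q + p / 2 by lra.
have [t /andP[t0 tth] pt] := star_small r0.
have tF : t <= F.
  rewrite leNgt; apply/negP => Ft.
  have qF : q + p / 2 < psi F by rewrite pF; lra.
  by have := star_gt F0 (ltW Ft) (ltW r0) qF; rewrite ltNge (ltW pt).
have qpF : q + p / 2 <= psi F by rewrite pF; lra.
have [c /andP[tc cF] pc] := star_ivt t0 tF (ltW pt) qpF.
have c0 : 0 < c by exact: lt_le_trans tc.
have qc : q < psi c by rewrite pc; lra.
apply: le_lt_trans (right_inverse_le c0 q0 qc) _.
rewrite lt_neqAle cF andbT; apply/eqP => cFe; move: pc; rewrite cFe pF; lra.
Qed.
End star_shaped.

Section laplace_exponent_facts.
Context {R : realType} (nu : {measure set R -> \bar R}) (hnu : levy_measure nu).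
Variables (gamma sigma : R).
Local Notation D := (`]0%R, +oo[%classic : set R).
Local Notation psi := (laplace_exponent gamma sigma nu).

Lemma laplace_exponentE th : psi th = gamma * th + 2^-1 * sigma ^+ 2 * th ^+ 2 +
  \int[nu]_(z in D) levy_kernel th z.
Proof. by []. Qed.

Lemma laplace_exponent_star t th : 0 <= t -> t <= 1 -> 0 <= th -> psi (t * th) <= t * psi th.
Proof.
move=> t0 t1 th0; rewrite !laplace_exponentE.
have tth0 : 0 <= t * th by rewrite mulr_ge0.
have : \int[nu]_(z in D) levy_kernel (t * th) z <= t * \int[nu]_(z in D) levy_kernel th z.
  rewrite -RintegralZl//; last exact: integrable_levy_kernel.
  apply: le_Rintegral => //; first exact: integrable_levy_kernel.
    by apply: integrable_mulc => //; exact: integrable_levy_kernel.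
  by move=> z; rewrite /= in_itv/= andbT; exact: levy_kernel_star.
have : 2^-1 * sigma ^+ 2 * (t * th) ^+ 2 <= t * (2^-1 * sigma ^+ 2 * th ^+ 2).
  have h : 0 <= 2^-1 * sigma ^+ 2 * th ^+ 2.
    by apply: mulr_ge0; [apply: mulr_ge0; rewrite ?sqr_ge0|exact: sqr_ge0].
  by rewrite exprMn mulrCA ler_wpM2r// expr2 ler_piMr.
lra.
Qed.

Lemma laplace_exponent_lipschitz a b th th' : 0 < a -> a <= th -> th <= th' -> th' <= b ->
  `|psi th' - psi th| <= (th' - th) * (`|gamma| + sigma ^+ 2 * b +
     (b + a^-1) * \int[nu]_(z in D) min1sq z).
Proof.
move=> a0 ath tht thb; rewrite !laplace_exponentE.
have th0 : 0 < th by exact: lt_le_trans ath.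
have th'0 : 0 < th' by exact: lt_le_trans tht.
have I1 := integrable_levy_kernel hnu (ltW th0).
have I2 := integrable_levy_kernel hnu (ltW th'0).
have Ilip : `|\int[nu]_(z in D) levy_kernel th' z - \int[nu]_(z in D) levy_kernel th z| <=
   (th' - th) * (b + a^-1) * \int[nu]_(z in D) min1sq z.
  rewrite -RintegralB// -RintegralZl//; last exact: integrable_min1sq.
  have I3 := integrable_sub (measurable_itv _) I2 I1.
  apply: le_trans (le_normr_Rintegral _ _) _ => //.
  apply: le_Rintegral => //; first exact: integrable_norm.
    by apply: integrable_mulc => //; exact: integrable_min1sq.
  by move=> z; rewrite /= in_itv/= andbT; exact: levy_kernel_lipschitz.
move: Ilip; set A := \int[nu]_(z in D) levy_kernel th' z; set B := \int[nu]_(z in D) levy_kernel th z.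
set M := \int[nu]_(z in D) min1sq z => Ilip.
have -> : gamma * th' + 2^-1 * sigma ^+ 2 * th' ^+ 2 + A -
  (gamma * th + 2^-1 * sigma ^+ 2 * th ^+ 2 + B) =
  (th' - th) * gamma + (th' - th) * (sigma ^+ 2 * (2^-1 * (th + th'))) + (A - B) by ring.
have d0 : 0 <= th' - th by rewrite subr_ge0.
rewrite [leRHS]mulrDr [X in _ <= X + _]mulrDr.
apply: le_trans (ler_normD _ _) _; rewrite mulrA; apply: lerD => //.
apply: le_trans (ler_normD _ _) _; apply: lerD.
  by rewrite normrM (ger0_norm d0).
rewrite normrM (ger0_norm d0) ler_wpM2l// normrM.
rewrite (ger0_norm (sqr_ge0 _)) ler_wpM2l ?sqr_ge0//.
rewrite ger0_norm; lra.
Qed.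

Lemma laplace_exponent_continuous a b : 0 < a -> a <= b -> {within `[a, b], continuous psi}.
Proof.
move=> a0 ab; set K := `|gamma| + sigma ^+ 2 * b + (b + a^-1) * \int[nu]_(z in D) min1sq z.
have K0 : 0 <= K.
  have ai : 0 < a^-1 by rewrite invr_gt0.
  have I0 : 0 <= \int[nu]_(z in D) min1sq z.
    by apply: Rintegral_ge0 => z _; exact: min1sq_ge0.
  by rewrite !addr_ge0// mulr_ge0 ?sqr_ge0//; lra.
have lip x y : a <= x <= b -> a <= y <= b -> `|psi x - psi y| <= K * `|x - y|.
  move=> /andP[ax xb] /andP[ay yb]; have [xy|yx] := leP x y.
    rewrite distrC mulrC [`|x - y|]distrC (@ger0_norm _ (y - x)) ?subr_ge0//.
    exact: laplace_exponent_lipschitz.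
  rewrite mulrC (@ger0_norm _ (x - y)) ?subr_ge0 ?(ltW yx)//.
  by apply: laplace_exponent_lipschitz => //; exact: ltW.
apply/subspace_continuousP => x; rewrite /= in_itv/= => xab.
apply/cvgrPdist_le => e e0.
rewrite near_withinE; near=> y => /=; rewrite in_itv/= => yab.
apply: le_trans (lip _ _ xab yab) _.
have : `|x - y| <= e / (K + 1).
  near: y; apply: (@cvgr_dist_le _ _ _ (nbhs x) _ id x) => //.
  by rewrite divr_gt0// ltr_wpDl.
rewrite ler_pdivlMr ?ltr_wpDl// => h.
have := normr_ge0 (x - y); lra.
Unshelve. all: by end_near. Qed.
End laplace_exponent_facts.

(** * Levy integrals in terms of the tail *)

Section tail_fubini.
Context {R : realType} (nu : {measure set R -> \bar R}) (hnu : levy_measure nu).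
Local Notation D := (`]0%R, +oo[%classic : set R).
Local Notation mu := (@lebesgue_measure R).
Implicit Types (lam x y : R) (k : nat).

(** Fubini on the set of the pairs x < y, as G y is the integral of g
    over (0, y). *)
Lemma layer_cake (g G : R -> R) : measurable_fun setT g ->
  (forall x, 0 < x -> 0 <= g x) ->
  (forall y, 0 < y -> (\int[mu]_(x in `]0%R, y[) (g x)%:E = (G y)%:E)%E) ->
  (\int[nu]_(y in D) (G y)%:E = \int[mu]_(x in D) ((g x)%:E * nu `]x, +oo[%classic))%E.
Proof.
move=> mg g0 HG.
have sf : sigma_finite [set: R] nu by case: hnu.
(* Fubini requires nu to be bundled with its sigma-finiteness. *)
pose H1 := isSFinite.Build _ _ _ (nu : set R -> \bar R) (sfinite_measure_sigma_finite sf).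
pose H3 := isSigmaFinite.Build _ _ _ (nu : set R -> \bar R) sf.
pose nu' := HB.pack_for (SigmaFiniteMeasure.type R R) (Measure.sort nu) H1 H3.
pose f (p : measurableTypeR R * R) : \bar R := if (0 < p.1) && (p.1 < p.2) then (g p.1)%:E else 0%E.
have mf : measurable_fun setT f.
  apply: measurable_fun_ifT.
  - apply: measurable_and.
      by apply: measurable_fun_ltr => //; exact: measurable_fst.
    apply: measurable_fun_ltr; [exact: measurable_fst|exact: measurable_snd].
  - apply/measurable_EFinP; exact: (measurableT_comp mg measurable_fst).
  - exact: measurable_cst.
have f0 p : (0 <= f p)%E.
  rewrite /f; case: ifP => // /andP[p0 _]; rewrite lee_fin g0//.
have := @fubini_tonelli _ _ (measurableTypeR R) R R mu nu' f mf f0.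
have nuE : nu = nu' :> {measure set R -> \bar R} by exact: eq_measure.
have -> : (\int[mu]_x \int[nu']_y f (x, y))%E = (\int[mu]_(x in D) ((g x)%:E * nu `]x, +oo[%classic))%E.
  rewrite [RHS]integral_mkcond; apply: eq_integral => x _.
  rewrite patchE; case: ifPn => [|].
    rewrite inE/= in_itv/= andbT => x0.
    rewrite -integral_cst// [RHS]integral_mkcond nuE; apply: eq_integral => y _.
    rewrite patchE /f/= x0/=; case: ifPn => [xy|xy].
      by rewrite mem_set//= in_itv/= xy.
    by rewrite memNset//= in_itv/= andbT; apply/negP.
  rewrite notin_setE/= in_itv/= andbT => /negP/negbTE x0.
  by rewrite integral0_eq// => y _; rewrite /f/= x0.
move=> ->; rewrite [LHS]integral_mkcond nuE; apply: eq_integral => y _.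
rewrite patchE; case: ifPn => [|].
  rewrite inE/= in_itv/= andbT => y0.
  rewrite -(HG y y0) integral_mkcond; apply: eq_integral => x _.
  rewrite patchE /f/=; case: ifPn.
    by rewrite inE/= in_itv/= => ->.
  by rewrite notin_setE/= in_itv/= => /negP/negbTE ->.
rewrite notin_setE/= in_itv/= andbT => /negP y0.
rewrite integral0_eq// => x _; rewrite /f/=; case: ifPn => // /andP[x0 xy].
by rewrite (lt_trans x0 xy) in y0.
Qed.

Lemma tail_nonincreasing x y : 0 < x -> x <= y -> tail nu y <= tail nu x.
Proof.
move=> x0 xy; have y0 := lt_le_trans x0 xy.
rewrite -lee_fin !tailE//; apply: le_measure; rewrite ?inE//.
by apply: subset_itv => //; rewrite bnd_simp.
Qed.

Lemma measurable_tail : measurable_fun D (tail nu).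
Proof.
apply: (measurability (@RGenCInfty.G R)) => [|/= _ [_] [r] -> <-].
  exact: RGenCInfty.measurableE.
apply: is_interval_measurable => s t/=.
rewrite !in_itv/= !andbT => -[s0 fs] [t0 ft] u /andP[su ut].
have u0 := lt_le_trans s0 su.
by rewrite !in_itv/= !andbT; split => //; apply: (le_trans ft); exact: tail_nonincreasing.
Qed.

(** Near 0 the distribution function of order k + 1 is O(y^(k+2)), so order at
    least one is what makes it integrable for a Levy measure. *)
Lemma erlang_cdf_levy_bound lam k y : 0 < lam -> 0 < y ->
  `|erlang_cdf lam k.+1 y| <= (1 + lam ^+ k.+2) * min1sq y.
Proof.
move=> l0 y0; rewrite (ger0_norm (erlang_cdf_ge0 _ (ltW l0) (ltW y0))).
have p0 : 0 < lam ^+ k.+2 by rewrite exprn_gt0.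
have [y1|y1] := leP y 1.
  rewrite (min1sq_small (ltW y0) y1).
  apply: le_trans (erlang_cdf_le k.+1 (ltW l0) (ltW y0)) _.
  rewrite exprMn; apply: (@le_trans _ _ (lam ^+ k.+2 * y ^+ 2)).
    by rewrite ler_wpM2l ?(ltW p0)// ler_wiXn2l// ltW.
  by rewrite ler_wpM2r ?sqr_ge0//; lra.
rewrite (min1sq_large (ltW y1)) mulr1.
have := erlang_cdf_le1 k.+1 (ltW l0) (ltW y0); lra.
Qed.

Lemma integrable_erlang_cdf lam k : 0 < lam ->
  nu.-integrable D (EFin \o erlang_cdf lam k.+1).
Proof.
move=> l0; apply: (levy_integrable hnu (C := 1 + lam ^+ k.+2)).
  by apply: continuous_measurable => //; exact: continuous_erlang_cdf.
by move=> y y0; exact: erlang_cdf_levy_bound.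
Qed.

Lemma erlang_cdf_tail lam k : 0 < lam ->
  (\int[nu]_(y in D) (erlang_cdf lam k y)%:E =
   \int[mu]_(x in D) (erlang_pdf lam k x * tail nu x)%:E)%E.
Proof.
move=> l0; rewrite (layer_cake (g := erlang_pdf lam k)).
- by apply: eq_integral => x; rewrite inE/= in_itv/= andbT => x0; rewrite -(tailE hnu x0) -EFinM.
- by apply: continuous_measurable => //; exact: continuous_erlang_pdf.
- by move=> x x0; rewrite erlang_pdf_ge0// ltW.
move=> y y0; rewrite -integral_erlang_pdf_itv ?ltW//.
rewrite -(@integral_itv_bndoo _ 0 y _ false true)// ?(@integral_itv_bndoo _ 0 y _ true false)//.
all: apply/measurable_EFinP; apply: continuous_measurable => //; exact: continuous_erlang_pdf.
Qed.

Lemma integrable_erlang_pdf_tail lam k : 0 < lam ->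
  mu.-integrable D (EFin \o (fun x => erlang_pdf lam k.+1 x * tail nu x)).
Proof.
move=> l0.
have mf : measurable_fun D (fun x => erlang_pdf lam k.+1 x * tail nu x).
  apply: measurable_funM; last exact: measurable_tail.
  by apply: continuous_measurable => //; exact: continuous_erlang_pdf.
apply/integrableP; split; first exact/measurable_EFinP.
have := @integral_fin_num_abs _ _ _ mu D _ _ mf.
move=> ->//; rewrite -erlang_cdf_tail//.
by apply: (integrable_fin_num _ (integrable_erlang_cdf k l0)).
Qed.

Lemma Rintegral_erlang_cdf_tail lam k : 0 < lam ->
  \int[nu]_(y in D) erlang_cdf lam k y = \int[mu]_(x in D) (erlang_pdf lam k x * tail nu x).
Proof. by move=> l0; rewrite /Rintegral erlang_cdf_tail. Qed.
End tail_fubini.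

(** * Erlang mixtures of log-convex functions *)

Section log_convex_mixture.
Context {R : realType}.
Local Notation D := (`]0%R, +oo[%classic : set R).
Local Notation mu := (@lebesgue_measure R).
Implicit Types (a b c x y s lam : R) (g : R -> R) (k n : nat).

Lemma convex_function_3point (l : R -> R) a b c :
  convex_function D (l : R -> R^o) -> 0 < a -> a < b -> b < c ->
  l b * (c - a) <= l a * (c - b) + l c * (b - a).
Proof.
move=> cl a0 ab bc; have ac : 0 < c - a by lra.
pose t := (c - b) / (c - a).
have t0 : 0 <= t by rewrite divr_ge0; lra.
have t1 : t <= 1 by rewrite ler_pdivrMr//; lra.
have aD : a \in D by rewrite inE/= in_itv/= a0.
have cD : c \in D by rewrite inE/= in_itv/= andbT; lra.
have : l (t * a + (1 - t) * c) <= t * l a + (1 - t) * l c := cl (Itv01 t0 t1) a c aD cD.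
have -> : t * a + (1 - t) * c = b by rewrite /t; field; rewrite gt_eqF.
rewrite -(ler_pM2r ac) => h; apply: (le_trans h).
have ct : t * (c - a) = c - b by rewrite /t mulfVK// gt_eqF.
have -> : (t * l a + (1 - t) * l c) * (c - a) =
  l a * (t * (c - a)) + l c * ((c - a) - t * (c - a)) by ring.
rewrite ct; lra.
Qed.

(** ln g is below its chord between x1 and x2 and above it elsewhere; the
    product (x - x1) (x - x2) carries the sign. *)
Lemma log_convex_interpolation g x1 x2 al be : log_convex g ->
  0 < x1 -> x1 < x2 ->
  ln (g x1) = al - be * x1 -> ln (g x2) = al - be * x2 ->
  forall x, 0 < x -> 0 <= (x - x1) * (x - x2) * (g x - expR (al - be * x)).
Proof.
move=> [g0 cg] x10 x12 e1 e2 x x0.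
have x20 : 0 < x2 by lra.
have [->|xx1] := eqVneq x x1; first by rewrite subrr !mul0r.
have [->|xx2] := eqVneq x x2; first by rewrite subrr mulr0 mul0r.
have gE : g x = expR (ln (g x)) by rewrite lnK// posrE g0.
case: (ltgtP x x1) xx1 => // xx1 _.
- rewrite mulr_ge0//; first by rewrite mulr_le0//; lra.
  rewrite subr_ge0 gE ler_expR.
  have := convex_function_3point cg x0 xx1 x12; rewrite e1 e2.
  have d : 0 < x2 - x1 by lra.
  by move=> h; rewrite -(ler_pM2r d); lra.
case: (ltgtP x x2) xx2 => // xx2 _.
- rewrite mulr_le0//; first by rewrite mulr_ge0_le0//; lra.
  rewrite subr_le0 gE ler_expR.
  have := convex_function_3point cg x10 xx1 xx2; rewrite e1 e2.
  have d : 0 < x2 - x1 by lra.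
  by move=> h; rewrite -(ler_pM2r d); lra.
rewrite mulr_ge0//; first by rewrite mulr_ge0//; lra.
rewrite subr_ge0 gE ler_expR.
have := convex_function_3point cg x10 x12 xx2; rewrite e1 e2.
have d : 0 < x2 - x1 by lra.
by move=> h; rewrite -(ler_pM2r d); lra.
Qed.

Lemma erlang_pdfS lam k x :
  erlang_pdf lam k.+1 x = erlang_pdf lam k x * (lam * x / k.+1%:R).
Proof.
rewrite /erlang_pdf factS natrM exprS.
have k0 : k`!%:R != 0 :> R by rewrite pnatr_eq0 -lt0n fact_gt0.
have k1 : k.+1%:R != 0 :> R by rewrite pnatr_eq0.
move: (k.+1%:R : R) (k`!%:R : R) k0 k1 => u v v0 u0.
by field; rewrite u0 v0.
Qed.

(** An exponential factor only changes the rate, so the Erlang averages of an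
    exponential form a geometric sequence. *)
Lemma erlang_pdf_tilt lam be k x : 0 < lam -> 0 <= be ->
  erlang_pdf lam k x * expR (- (be * x)) =
  (lam / (lam + be)) ^+ k.+1 * erlang_pdf (lam + be) k x.
Proof.
move=> l0 b0; have lb : lam + be != 0 by rewrite gt_eqF//; lra.
rewrite /erlang_pdf.
have -> : expR (- ((lam + be) * x)) = expR (- (lam * x)) * expR (- (be * x)).
  by rewrite -expRD; congr expR; ring.
rewrite !exprMn exprVn !exprS.
have lbk : (lam + be) ^+ k != 0 by rewrite expf_neq0.
move: (lam ^+ k) (x ^+ k) ((lam + be) ^+ k) lbk => u v w w0.
by field; rewrite lb w0 pnatr_eq0 -lt0n fact_gt0.
Qed.

Lemma integral_erlang_pdf_open lam k : 0 < lam ->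
  (\int[mu]_(x in D) (erlang_pdf lam k x)%:E = 1%:E)%E.
Proof.
move=> l0; rewrite integral_itv_obnd_cbnd ?integral_erlang_pdf//.
by apply/measurable_EFinP; apply: continuous_measurable => //; exact: continuous_erlang_pdf.
Qed.

(** Log-convexity of the sequence t is the nonnegativity of this quadratic
    form for every s > 0. Under the integral sign the form is the density of
    order k times a quadratic polynomial with two positive roots x1 < x2.
    Replace g by the exponential that agrees with g at x1 and x2: by
    [log_convex_interpolation] this decreases the integral, and for an
    exponential t is geometric, so that the form is a perfect square. *)
Lemma erlang_mixture_log_convex g (t : nat -> R) lam k s : log_convex g ->
  (forall x y, 0 < x -> x <= y -> g y <= g x) -> 0 < lam -> 0 < s ->
  (forall n, (k <= n)%N -> mu.-integrable D (EFin \o (fun x => erlang_pdf lam n x * g x))) ->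
  (forall n, t n = \int[mu]_(x in D) (erlang_pdf lam n x * g x)) ->
  0 <= t k - 2 * s * t k.+1 + s ^+ 2 * t k.+2.
Proof.
move=> lg ng l0 s0 Ig tE0.
pose n1 : R := k.+1%:R.
have n10 : 0 < n1 by rewrite ltr0n.
have E2 : k.+2%:R = n1 + 1 :> R by rewrite /n1 -natr1.
pose rt := Num.sqrt (n1 + 1).
have rt2 : rt ^+ 2 = n1 + 1 by rewrite sqr_sqrtr//; lra.
have rt0 : 0 < rt by rewrite sqrtr_gt0; lra.
have rtn : rt < n1 + 1.
  rewrite -[ltRHS]rt2 expr2 ltr_pMl// -(@ltr_pXn2r _ 2%N) ?nnegrE ?ltW// expr1n rt2.
  by rewrite ltrDr.
(* The roots of 1 - 2 (s lam x) / (k + 1) + (s lam x)^2 / ((k + 1) (k + 2)). *)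
pose x1 := (n1 + 1 - rt) / (s * lam).
pose x2 := (n1 + 1 + rt) / (s * lam).
have sl : 0 < s * lam by rewrite mulr_gt0.
have x10 : 0 < x1 by rewrite divr_gt0//; lra.
have x12 : x1 < x2 by rewrite ltr_pM2r ?invr_gt0//; lra.
pose be := (ln (g x1) - ln (g x2)) / (x2 - x1).
have x21 : 0 < x2 - x1 by rewrite subr_gt0.
case: (lg) => gpos _.
have x20 : 0 < x2 by lra.
(* As g is nonincreasing, the interpolating exponential decays. *)
have be0 : 0 <= be.
  rewrite divr_ge0 ?(ltW x21)// subr_ge0 ler_ln ?posrE ?gpos//.
  by rewrite ng// ltW.
pose al := ln (g x1) + be * x1.
have e1 : ln (g x1) = al - be * x1 by rewrite /al; lra.
have e2 : ln (g x2) = al - be * x2.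
  have : be * (x2 - x1) = ln (g x1) - ln (g x2) by rewrite /be mulfVK// gt_eqF.
  by rewrite /al; lra.
have key := log_convex_interpolation lg x10 x12 e1 e2.
pose E x := expR (al - be * x).
pose r := lam / (lam + be).
have lb0 : 0 < lam + be by lra.
have EI m x : erlang_pdf lam m x * E x = expR al * r ^+ m.+1 * erlang_pdf (lam + be) m x.
  rewrite /E expRD mulrCA -mulrA -erlang_pdf_tilt//; ring.
have IE m : mu.-integrable D (EFin \o (fun x => erlang_pdf lam m x * E x)).
  have : mu.-integrable D (EFin \o (fun x => expR al * r ^+ m.+1 * erlang_pdf (lam + be) m x)).
    apply: integrable_mulc => //.
    apply: integrableS (integrable_erlang_pdf m lb0) => //.
    by apply: subset_itv => //; rewrite bnd_simp.
  by apply: eq_integrable => // x _; rewrite /= EI.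
have tE m : \int[mu]_(x in D) (erlang_pdf lam m x * E x) = expR al * r ^+ m.+1.
  under eq_Rintegral do rewrite EI.
  rewrite RintegralZl//; last first.
    apply: integrableS (integrable_erlang_pdf m lb0) => //.
    by apply: subset_itv => //; rewrite bnd_simp.
  by rewrite /Rintegral integral_erlang_pdf_open//= mulr1.
pose Q h x := erlang_pdf lam k x * h x - 2 * s * (erlang_pdf lam k.+1 x * h x)
  + s ^+ 2 * (erlang_pdf lam k.+2 x * h x).
have IQ h : (forall n, (k <= n)%N -> mu.-integrable D (EFin \o (fun x => erlang_pdf lam n x * h x))) ->
  mu.-integrable D (EFin \o Q h) /\
  \int[mu]_(x in D) Q h x = \int[mu]_(x in D) (erlang_pdf lam k x * h x)
     - 2 * s * \int[mu]_(x in D) (erlang_pdf lam k.+1 x * h x)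
     + s ^+ 2 * \int[mu]_(x in D) (erlang_pdf lam k.+2 x * h x).
  move=> Ih.
  have I0 := Ih k (leqnn k); have I1 := Ih k.+1 (leqnSn k).
  have I2 := Ih k.+2 (leq_trans (leqnSn k) (leqnSn k.+1)).
  have mD : measurable (D : set (measurableTypeR R)) by exact: measurable_itv.
  have I1' := integrable_mulc mD (2 * s) I1.
  have I2' := integrable_mulc mD (s ^+ 2) I2.
  have I01 := integrable_sub mD I0 I1'.
  split; first exact: (integrable_add mD I01 I2').
  by rewrite /Q RintegralD// RintegralB// !RintegralZl.
have [IQg EQg] := IQ g Ig.
have [IQE EQE] := IQ E (fun n _ => IE n).
rewrite !tE0 -EQg; apply: (@le_trans _ _ (\int[mu]_(x in D) Q E x)).
  rewrite EQE !tE !exprS.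
  have -> : expR al * (r * r ^+ k) - 2 * s * (expR al * (r * (r * r ^+ k))) +
     s * (s * s ^+ 0) * (expR al * (r * (r * (r * r ^+ k)))) = expR al * (r * r ^+ k) * (1 - s * r) ^+ 2 by ring.
  have r0 : 0 <= r by rewrite divr_ge0 ?ltW.
  by rewrite mulr_ge0 ?sqr_ge0// mulr_ge0 ?expR_ge0// mulr_ge0 ?exprn_ge0.
apply: le_Rintegral => // x; rewrite /= in_itv/= andbT => x0.
rewrite -subr_ge0.
have -> : Q g x - Q E x = erlang_pdf lam k x * ((s * lam) ^+ 2 / (n1 * (n1 + 1))) *
   ((x - x1) * (x - x2) * (g x - E x)).
  have hx : (x - x1) * (x - x2) = x ^+ 2 - 2 * (n1 + 1) / (s * lam) * x + n1 * (n1 + 1) / (s * lam) ^+ 2.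
    rewrite /x1 /x2.
    have -> : (x - (n1 + 1 - rt) / (s * lam)) * (x - (n1 + 1 + rt) / (s * lam)) =
      x ^+ 2 - 2 * (n1 + 1) / (s * lam) * x + ((n1 + 1) ^+ 2 - rt ^+ 2) / (s * lam) ^+ 2.
      by field; rewrite !gt_eqF.
    by rewrite rt2; field; rewrite !gt_eqF.
  rewrite hx /Q !erlang_pdfS E2 -/n1.
  move: (erlang_pdf lam k x) (g x) (E x) => u v w.
  by field; rewrite !gt_eqF//; lra.
rewrite mulr_ge0 ?key// mulr_ge0 ?erlang_pdf_ge0 ?(ltW l0) ?(ltW x0)//.
by rewrite divr_ge0 ?sqr_ge0// mulr_ge0 ?(ltW n10)// addr_ge0 ?(ltW n10).
Qed.
End log_convex_mixture.

(** * Power series of Laplace transforms *)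

Lemma Rintegral_sum_ord d (T : measurableType d) (R : realType)
    (nu : {measure set T -> \bar R}) (A : set T) (mA : measurable A) n (f : nat -> T -> R) :
  (forall k, (k < n)%N -> nu.-integrable A (EFin \o f k)) ->
  nu.-integrable A (EFin \o (fun t => \sum_(k < n) f k t)) /\
  \int[nu]_(t in A) (\sum_(k < n) f k t) = \sum_(k < n) \int[nu]_(t in A) f k t.
Proof.
elim: n => [|n IH] If.
  split.
    apply: (eq_integrable mA (cst 0%E)); last exact: integrable0.
    by move=> t _ /=; rewrite big_ord0.
  under eq_Rintegral do rewrite big_ord0.
  by rewrite Rintegral_cst// mul0r big_ord0.
have [I1 E1] := IH (fun k kn => If k (ltnW kn)).
have I2 := If n (ltnSn n).
split.
  apply: eq_integrable (integrable_add mA I1 I2) => // t _.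
  by rewrite /= big_ord_recr.
under eq_Rintegral do rewrite big_ord_recr/=.
by rewrite RintegralD// E1 big_ord_recr.
Qed.

Section generating_functions.
Context {R : realType}.
Implicit Types (a b lam th x y z : R) (k n N : nat).

(** Summation by parts. *)
Lemma abel_sum (a : nat -> R) z n :
  (1 - z) * \sum_(k < n.+1) (\sum_(j < k.+1) a j) * z ^+ k =
  \sum_(k < n.+1) a k * z ^+ k - z ^+ n.+1 * \sum_(j < n.+1) a j.
Proof.
elim: n => [|n IH]; first by rewrite !big_ord1 !expr0 expr1; ring.
rewrite big_ord_recr/= mulrDr IH [in RHS]big_ord_recr/= [in X in _ = _ - X]big_ord_recr/=.
rewrite [in LHS](big_ord_recr n.+1)/= !exprS; ring.
Qed.

Lemma geometric_sum z n : (1 - z) * \sum_(k < n) z ^+ k = 1 - z ^+ n.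
Proof.
elim: n => [|n IH]; first by rewrite big_ord0 mulr0 expr0 subrr.
by rewrite big_ord_recr/= mulrDr IH exprS; ring.
Qed.

Lemma monomial_exp_bound n a b y : a < b -> 0 <= y ->
  y ^+ n * expR (- (b * y)) <= n`!%:R * (b - a)^-1 ^+ n * expR (- (a * y)).
Proof.
move=> ab y0; have r0 : 0 < b - a by rewrite subr_gt0.
have f0 : 0 < n`!%:R :> R by rewrite ltr0n fact_gt0.
have := exprn_fact_le n r0 y0; rewrite ler_pdivrMr// => h.
have := ler_wpM2r (expR_ge0 (- (b * y))) h => /le_trans; apply.
have <- : expR ((b - a) * y) * expR (- (b * y)) = expR (- (a * y)).
  by rewrite -expRD; congr expR; ring.
by rewrite le_eqVlt; apply/orP; left; apply/eqP; ring.
Qed.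

(** The Erlang densities are the coefficients in z of
    lam e^(- lam (1 - z) y), and the remainder is governed by the Erlang
    distribution function of rate lam z. *)
Lemma erlang_pdf_sum lam z y N :
  lam * expR (- (lam * (1 - z) * y)) - \sum_(k < N) erlang_pdf lam k y * z ^+ k =
  lam * (expR (- (lam * (1 - z) * y)) * (1 - expR (- (lam * z * y)) * \sum_(k < N) (lam * z * y) ^+ k / k`!%:R)).
Proof.
have EE : expR (- (lam * (1 - z) * y)) * expR (- (lam * z * y)) = expR (- (lam * y)).
  by rewrite -expRD; congr expR; ring.
set S := \sum_(k < N) (lam * z * y) ^+ k / k`!%:R.
have -> : \sum_(k < N) erlang_pdf lam k y * z ^+ k = lam * (expR (- (lam * y)) * S).
  rewrite /S !mulr_sumr; apply: eq_bigr => k _.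
  have -> : (lam * z * y) ^+ k = (lam * y) ^+ k * z ^+ k by rewrite -exprMn; congr (_ ^+ _); ring.
  rewrite /erlang_pdf; move: ((lam * y) ^+ k) (z ^+ k) => v w; ring.
by rewrite -EE; ring.
Qed.

(** Dividing by 1 - z sums the coefficients, which turns densities into
    distribution functions. *)
Lemma erlang_cdf_sum lam z y N :
  (1 - z) * \sum_(k < N.+1) erlang_cdf lam k y * z ^+ k =
  1 - expR (- (lam * y)) * \sum_(k < N.+1) (lam * z * y) ^+ k / k`!%:R
    - z ^+ N.+1 * erlang_cdf lam N y.
Proof.
pose a k := expR (- (lam * y)) * ((lam * y) ^+ k / k`!%:R).
have cE k : erlang_cdf lam k y = 1 - \sum_(j < k.+1) a j.
  by rewrite /erlang_cdf mulr_sumr.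
under eq_bigr do rewrite cE mulrBl mul1r.
rewrite sumrB mulrBr geometric_sum abel_sum cE.
have -> : expR (- (lam * y)) * \sum_(k < N.+1) (lam * z * y) ^+ k / k`!%:R =
   \sum_(k < N.+1) a k * z ^+ k.
  rewrite mulr_sumr; apply: eq_bigr => k _.
  have -> : (lam * z * y) ^+ k = (lam * y) ^+ k * z ^+ k by rewrite -exprMn; congr (_ ^+ _); ring.
  rewrite /a; move: ((lam * y) ^+ k) (z ^+ k) => v w; ring.
ring.
Qed.

End generating_functions.

Section scale_coefficients.
Context {R : realType}.
Local Notation mu := (@lebesgue_measure R).
Local Notation D0 := (`[0%R, +oo[%classic : set R).
Implicit Types (a b lam th x y z : R) (k n N : nat) (f W : R -> R).

Definition laplace_transform f th : R := \int[mu]_(y in D0) (expR (- (th * y)) * f y).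

Definition erlang_mean lam f k : R := \int[mu]_(y in D0) (erlang_pdf lam k y * f y).

(** The order 0 is treated apart so that the partial sums are the
    averages. *)
Definition erlang_increment lam f k : R :=
  if k is j.+1 then erlang_mean lam f j.+1 - erlang_mean lam f j else erlang_mean lam f 0.

Lemma sum_erlang_increment lam f k :
  \sum_(j < k.+1) erlang_increment lam f j = erlang_mean lam f k.
Proof.
elim: k => [|k IH]; first by rewrite big_ord1.
by rewrite big_ord_recr/= IH addrC subrK.
Qed.

(** At lam (1 - z) the Laplace transform is a power series in z whose
    coefficients are averages of f. The remainder is at most
    (lam z y)^(N+1) under the integral, and the power of y is absorbed by the
    gap between lam (1 - z) and th. *)
Lemma laplace_transform_expansion th lam f N : 0 <= th -> th < lam -> exp_integrable th f ->
  exists (C e : R), [/\ 0 <= C, 0 < e, e < 1 & forall z, 0 < z -> z < e ->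
    `|lam * laplace_transform f (lam * (1 - z)) - \sum_(k < N.+1) erlang_mean lam f k * z ^+ k|
      <= C * z ^+ N.+1].
Proof.
move=> th0 thl If; have l0 : 0 < lam by exact: le_lt_trans thl.
(* The transform is expanded where lam (1 - z) stays above b > th. *)
pose e := (1 - th / lam) / 2.
have thl1 : th / lam < 1 by rewrite ltr_pdivrMr// mul1r.
have thl0 : 0 <= th / lam by rewrite divr_ge0// ltW.
have e0 : 0 < e by rewrite divr_gt0//; lra.
have e1 : e < 1 by rewrite /e; lra.
pose b := lam * (1 - e).
have thb : th < b.
  have E : th / lam * lam = th by rewrite mulfVK// gt_eqF.
  rewrite -{1}E mulrC /b ltr_pM2l// /e; lra.
pose K := lam * lam ^+ N.+1 * (N.+1`!%:R * (b - th)^-1 ^+ N.+1).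
have b0 : 0 <= b by exact: le_trans (ltW thb).
have K0 : 0 <= K.
  by rewrite !mulr_ge0 ?exprn_ge0 ?invr_ge0 ?subr_ge0 ?(ltW l0) ?(ltW thb).
pose M := \int[mu]_(y in D0) (expR (- (th * y)) * `|f y|).
have M0 : 0 <= M.
  by apply: Rintegral_ge0 => y _; rewrite mulr_ge0 ?expR_ge0.
have mD0 : measurable (D0 : set (measurableTypeR R)) by exact: measurable_itv.
have INf : mu.-integrable D0 (EFin \o (fun y => expR (- (th * y)) * `|f y|)).
  apply: eq_integrable (integrable_norm If) => // y _ /=.
  by rewrite normrM (gtr0_norm (expR_gt0 _)).
exists (K * M), e; split => //; first by rewrite mulr_ge0.
move=> z z0 ze.
have thz : th <= lam * (1 - z).
  by apply: (le_trans (ltW thb)); rewrite /b ler_pM2l//; lra.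
have I1 := exp_integrable_mono thz If.
have Ik k : mu.-integrable D0 (EFin \o (fun y => (erlang_pdf lam k y * f y) * z ^+ k)).
  have := integrable_mulc mD0 (z ^+ k) (integrable_erlang_pdf_mul k th0 thl If).
  by apply: eq_integrable => // y _ /=; rewrite mulrC.
have [Is Es] := Rintegral_sum_ord mD0 (n := N.+1) (fun k _ => Ik k).
have I1' := integrable_mulc mD0 lam I1.
pose g y := lam * (expR (- (lam * (1 - z) * y)) * f y) -
   \sum_(k < N.+1) erlang_pdf lam k y * f y * z ^+ k.
have Ig : mu.-integrable D0 (EFin \o g) by exact: (integrable_sub mD0 I1' Is).
have -> : lam * laplace_transform f (lam * (1 - z)) - \sum_(k < N.+1) erlang_mean lam f k * z ^+ k =
   \int[mu]_(y in D0) g y.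
  rewrite /g RintegralB// RintegralZl// Es; congr (_ - _).
  apply: eq_bigr => k _; rewrite /erlang_mean RintegralZr//.
  exact: (integrable_erlang_pdf_mul k th0 thl If).
apply: (le_trans (le_normr_Rintegral _ Ig)) => //.
have -> : K * M * z ^+ N.+1 = K * z ^+ N.+1 * M by ring.
rewrite /M -RintegralZl//.
apply: le_Rintegral => //; first exact: integrable_norm.
  exact: integrable_mulc.
move=> y; rewrite /= in_itv/= andbT => y0.
have -> : g y = (lam * expR (- (lam * (1 - z) * y)) - \sum_(k < N.+1) erlang_pdf lam k y * z ^+ k) * f y.
  rewrite /g mulrBl mulr_suml; congr (_ - _); first by ring.
  by apply: eq_bigr => k _; ring.
rewrite erlang_pdf_sum -/(erlang_cdf (lam * z) N y) normrM [leRHS]mulrA ler_wpM2r//.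
have lz0 : 0 <= lam * z by rewrite mulr_ge0 ?ltW.
have c0 := erlang_cdf_ge0 N lz0 y0.
rewrite ger0_norm; last by rewrite !mulr_ge0 ?expR_ge0 ?(ltW l0).
have h1 := erlang_cdf_le N lz0 y0.
have h2 := monomial_exp_bound N.+1 thb y0.
have h3 : expR (- (lam * (1 - z) * y)) <= expR (- (b * y)).
  by rewrite ler_expR lerN2 ler_wpM2r// /b ler_pM2l//; lra.
have h4 : expR (- (lam * (1 - z) * y)) * erlang_cdf (lam * z) N y <= expR (- (b * y)) * (lam * z * y) ^+ N.+1.
  by apply: ler_pM => //; exact: expR_ge0.
apply: (le_trans (ler_wpM2l (ltW l0) h4)).
rewrite /K !exprMn.
have -> : lam * (expR (- (b * y)) * (lam ^+ N.+1 * z ^+ N.+1 * y ^+ N.+1)) =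
  (lam * lam ^+ N.+1 * z ^+ N.+1) * (y ^+ N.+1 * expR (- (b * y))) by ring.
have p0 : 0 <= lam * lam ^+ N.+1 * z ^+ N.+1 by rewrite !mulr_ge0 ?exprn_ge0 ?ltW.
apply: (le_trans (ler_wpM2l p0 h2)).
by rewrite le_eqVlt; apply/orP; left; apply/eqP; ring.
Qed.

(** Multiplication by 1 - z replaces the coefficients by their increments. *)
Lemma laplace_transform_expansion_increment th lam f N : 0 <= th -> th < lam -> exp_integrable th f ->
  exists (C e : R), [/\ 0 <= C, 0 < e, e < 1 & forall z, 0 < z -> z < e ->
    `|lam * laplace_transform f (lam * (1 - z)) * (1 - z) - \sum_(k < N.+1) erlang_increment lam f k * z ^+ k|
      <= C * z ^+ N.+1].
Proof.
move=> th0 thl If.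
have [C [e [C0 e0 e1 H]]] := laplace_transform_expansion N th0 thl If.
exists (C + `|erlang_mean lam f N|), e; split => //; first by rewrite addr_ge0.
move=> z z0 ze; have := abel_sum (erlang_increment lam f) z N.
under eq_bigr do rewrite sum_erlang_increment.
rewrite sum_erlang_increment => /eqP; rewrite eq_sym subr_eq => /eqP ->.
set S := \sum_(k < N.+1) _; rewrite [in X in `|X|](_ : _ - _ =
  (1 - z) * (lam * laplace_transform f (lam * (1 - z)) - S) - z ^+ N.+1 * erlang_mean lam f N); last ring.
apply: (le_trans (ler_normB _ _)); rewrite !normrM [leRHS]mulrDl.
have zn : 0 <= z ^+ N.+1 by rewrite exprn_ge0// ltW.
rewrite (ger0_norm zn) [`|_| * z ^+ N.+1]mulrC lerD2r.
rewrite ger0_norm; last lra.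
apply: le_trans (H z z0 ze).
by rewrite ler_piMl//; lra.
Qed.
End scale_coefficients.

Section exponent_coefficients.
Context {R : realType} (nu : {measure set R -> \bar R}) (hnu : levy_measure nu).
Variables (gamma sigma q : R).
Hypothesis q0 : 0 <= q.
Local Notation D := (`]0%R, +oo[%classic : set R).
Local Notation mu := (@lebesgue_measure R).
Local Notation psi := (laplace_exponent gamma sigma nu).
Implicit Types (a b lam th x y z : R) (k n N : nat) (f W : R -> R).

(** The negative of the coefficient of z^(k+1) in
    (psi (lam (1 - z)) - q) / (1 - z). *)
Definition renewal_weight lam k : R :=
  (k == 0)%:R * (2^-1 * sigma ^+ 2 * lam ^+ 2) + q + \int[nu]_(y in D) erlang_cdf lam k.+1 y.

(** The coefficients in z of (psi (lam (1 - z)) - q) / (1 - z). *)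
Definition exponent_coef lam k : R :=
  if k is j.+1 then - renewal_weight lam j else psi lam - q.

Let kern lam k y : R := if k is j.+1 then - erlang_cdf lam j.+1 y else levy_kernel lam y.

Let integrable_kern lam k : 0 < lam -> nu.-integrable D (EFin \o kern lam k).
Proof.
move=> l0; case: k => [|k]; first by apply: integrable_levy_kernel => //; exact: ltW.
by apply: integrable_opp => //; exact: integrable_erlang_cdf.
Qed.

Let drift lam k : R := (k == 0)%:R * (gamma * lam + 2^-1 * sigma ^+ 2 * lam ^+ 2)
   - (k == 1)%:R * (2^-1 * sigma ^+ 2 * lam ^+ 2) - q.

Let exponent_coefE lam k : 0 < lam ->
  exponent_coef lam k = drift lam k + \int[nu]_(y in D) kern lam k y.
Proof.
move=> l0; case: k => [|k]; rewrite /drift/=; first by rewrite laplace_exponentE; ring.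
have -> : \int[nu]_(y in D) (- erlang_cdf lam k.+1 y) = - \int[nu]_(y in D) erlang_cdf lam k.+1 y.
  rewrite -[RHS]mulN1r -RintegralZl//; last exact: integrable_erlang_cdf.
  by apply: eq_Rintegral => y _; rewrite mulN1r.
by rewrite eqSS /renewal_weight; ring.
Qed.

Let drift_sum lam z N : (1 - z) * \sum_(k < N.+2) drift lam k * z ^+ k =
  gamma * (lam * (1 - z)) + 2^-1 * sigma ^+ 2 * (lam * (1 - z)) ^+ 2 - q + q * z ^+ N.+2.
Proof.
have -> : \sum_(k < N.+2) drift lam k * z ^+ k =
  (gamma * lam + 2^-1 * sigma ^+ 2 * lam ^+ 2) - 2^-1 * sigma ^+ 2 * lam ^+ 2 * z
  - q * \sum_(k < N.+2) z ^+ k.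
  rewrite !big_ord_recl/= /drift/= !expr0 !expr1 !mul1r !mul0r.
  rewrite (_ : \sum_(i < N) _ = - q * \sum_(i < N) z ^+ bump 0 (bump 0 i)); last first.
    rewrite mulr_sumr; apply: eq_bigr => i _.
    by rewrite subr0 sub0r.
  ring.
have := geometric_sum z N.+2; set G := \sum_(k < N.+2) _ => GE.
have -> : forall A, (1 - z) * (A - q * G) = (1 - z) * A - q * ((1 - z) * G) by move=> A; ring.
rewrite GE; ring.
Qed.

(** After division by 1 - z the jumps contribute Erlang distribution
    functions to every order and - q contributes to every order; the drift and
    the compensator appear at order 0 only, the Gaussian part at orders 0
    and 1. *)
Lemma laplace_exponent_expansion lam N : 0 < lam ->
  exists C : R, 0 <= C /\ forall z, 0 < z -> z < 2^-1 ->
    `|psi (lam * (1 - z)) - q - (1 - z) * \sum_(k < N.+2) exponent_coef lam k * z ^+ k|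
      <= C * z ^+ N.+2.
Proof.
move=> l0.
pose K := lam ^+ N.+2 * (N.+2`!%:R * (lam / 2)^-1 ^+ N.+2) + lam ^+ N.+2 + (1 + lam ^+ N.+2).
have h2 : 0 < lam / 2 by rewrite divr_gt0.
have ln0 : 0 <= lam ^+ N.+2 by apply: exprn_ge0; exact: ltW.
have A0 : 0 <= lam ^+ N.+2 * (N.+2`!%:R * (lam / 2)^-1 ^+ N.+2).
  apply: mulr_ge0 => //; apply: mulr_ge0 => //.
  by apply: exprn_ge0; rewrite invr_ge0 ltW.
have K0 : 0 <= K by rewrite /K addr_ge0 ?addr_ge0.
pose M := \int[nu]_(y in D) min1sq y.
have M0 : 0 <= M by apply: Rintegral_ge0 => y _; exact: min1sq_ge0.
have mD : measurable (D : set R) by exact: measurable_itv.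
exists (K * M + q); split; first by rewrite addr_ge0// mulr_ge0.
move=> z z0 z2.
have lz : 0 < lam * (1 - z) by rewrite mulr_gt0//; lra.
have Ik k : nu.-integrable D (EFin \o (fun y => kern lam k y * z ^+ k)).
  have := integrable_mulc mD (z ^+ k) (integrable_kern k l0).
  by apply: eq_integrable => // y _ /=; rewrite mulrC.
have [Is Es] := Rintegral_sum_ord mD (n := N.+2) (fun k _ => Ik k).
have I1 := integrable_levy_kernel hnu (ltW lz).
pose g y := levy_kernel (lam * (1 - z)) y - (1 - z) * \sum_(k < N.+2) kern lam k y * z ^+ k.
have Is' := integrable_mulc mD (1 - z) Is.
have Ig : nu.-integrable D (EFin \o g) by exact: (integrable_sub mD I1 Is').
have -> : psi (lam * (1 - z)) - q - (1 - z) * \sum_(k < N.+2) exponent_coef lam k * z ^+ k =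
  \int[nu]_(y in D) g y - q * z ^+ N.+2.
  rewrite /g RintegralB// RintegralZl// Es.
  have -> : \sum_(k < N.+2) exponent_coef lam k * z ^+ k = \sum_(k < N.+2) drift lam k * z ^+ k +
     \sum_(k < N.+2) \int[nu]_(y in D) (kern lam k y * z ^+ k).
    rewrite -big_split/=; apply: eq_bigr => k _.
    by rewrite exponent_coefE// mulrDl RintegralZr//; exact: integrable_kern.
  by rewrite (mulrDr (1 - z)) drift_sum laplace_exponentE; ring.
apply: (le_trans (ler_normB _ _)); rewrite [leRHS]mulrDl; apply: lerD; last first.
  by rewrite ger0_norm// mulr_ge0// exprn_ge0// ltW.
apply: (le_trans (le_normr_Rintegral _ Ig)) => //.
have -> : K * M * z ^+ N.+2 = K * z ^+ N.+2 * M by ring.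
rewrite /M -RintegralZl//; last exact: integrable_min1sq.
apply: le_Rintegral => //; first exact: integrable_norm.
  by apply: integrable_mulc => //; exact: integrable_min1sq.
move=> y; rewrite /= in_itv/= andbT => y0.
have -> : g y = expR (- (lam * (1 - z) * y)) * erlang_cdf (lam * z) N.+1 y - z ^+ N.+2 * erlang_cdf lam N.+1 y.
  have kE : \sum_(k < N.+2) kern lam k y * z ^+ k = lam * y * \1_`]0, 1]%classic y -
     \sum_(k < N.+2) erlang_cdf lam k y * z ^+ k.
    rewrite big_ord_recl [in RHS]big_ord_recl/= !expr0 !mulr1.
    rewrite (_ : \sum_(i < N.+1) _ = - \sum_(i < N.+1) erlang_cdf lam (bump 0 i) y * z ^+ bump 0 i); last first.
      by rewrite -sumrN; apply: eq_bigr => i _; rewrite /bump/= mulNr.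
    rewrite /levy_kernel /erlang_cdf big_ord1 expr0 fact0 divr1 mulr1; ring.
  rewrite /g kE (mulrBr (1 - z)) erlang_cdf_sum /levy_kernel.
  have EE : expR (- (lam * (1 - z) * y)) * expR (- (lam * z * y)) = expR (- (lam * y)).
    by rewrite -expRD; congr expR; ring.
  rewrite [X in _ = _ * X - _]/erlang_cdf -EE; ring.
have lz0 : 0 <= lam * z by rewrite mulr_ge0 ?ltW.
have c0 := erlang_cdf_ge0 N.+1 lz0 (ltW y0).
have c1 := erlang_cdf_le N.+1 lz0 (ltW y0).
have zn : 0 <= z ^+ N.+2 by rewrite exprn_ge0// ltW.
apply: (le_trans (ler_normB _ _)).
rewrite [X in X + _]normrM [X in _ + X]normrM (ger0_norm (expR_ge0 _)) (ger0_norm c0) (ger0_norm zn).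
have h1 := erlang_cdf_levy_bound N l0 y0.
have e1 : expR (- (lam * (1 - z) * y)) <= 1 by rewrite expRN_le1// mulr_ge0// ltW.
suff h : expR (- (lam * (1 - z) * y)) * erlang_cdf (lam * z) N.+1 y <=
   z ^+ N.+2 * ((lam ^+ N.+2 * (N.+2`!%:R * (lam / 2)^-1 ^+ N.+2) + lam ^+ N.+2) * min1sq y).
  have := ler_wpM2l zn h1 => h3.
  apply: (le_trans (lerD h h3)); rewrite /K le_eqVlt; apply/orP; left; apply/eqP; ring.
have h4 : expR (- (lam * (1 - z) * y)) * erlang_cdf (lam * z) N.+1 y <=
   expR (- (lam * (1 - z) * y)) * (lam * z * y) ^+ N.+2 by rewrite ler_wpM2l ?expR_ge0.
apply: (le_trans h4).
have -> : (lam * z * y) ^+ N.+2 = z ^+ N.+2 * (lam ^+ N.+2 * y ^+ N.+2).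
  by rewrite !exprMn; ring.
rewrite mulrCA ler_wpM2l//.
have y20 : 0 <= y ^+ N.+2 by rewrite exprn_ge0// ltW.
have [y1|y1] := leP y 1.
  rewrite (min1sq_small (ltW y0) y1).
  apply: (@le_trans _ _ (lam ^+ N.+2 * y ^+ 2)).
    rewrite mulrCA; apply: ler_wpM2l => //.
    apply: (@le_trans _ _ (y ^+ N.+2)); first by rewrite ler_piMl.
    by rewrite ler_wiXn2l// ltW.
  by rewrite ler_wpM2r ?sqr_ge0// lerDr.
rewrite (min1sq_large (ltW y1)) mulr1 mulrCA.
have h5 := monomial_exp_bound N.+2 h2 (ltW y0).
have h6 : expR (- (lam * (1 - z) * y)) <= expR (- (lam / 2 * y)).
  by rewrite ler_expR lerN2 ler_wpM2r ?(ltW y0)// ler_pM2l//; lra.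
apply: (@le_trans _ _ (lam ^+ N.+2 * (N.+2`!%:R * (lam / 2)^-1 ^+ N.+2))); last by rewrite lerDl.
rewrite ler_wpM2l//.
have h7 : y ^+ N.+2 * expR (- (lam / 2 * y)) <= N.+2`!%:R * (lam / 2)^-1 ^+ N.+2.
  have := @monomial_exp_bound R N.+2 0 (lam / 2) y h2 (ltW y0).
  by rewrite subr0 mul0r oppr0 expR0 mulr1.
by apply: le_trans h7; rewrite mulrC ler_wpM2l.
Qed.
End exponent_coefficients.

(** * The renewal equation behind a scale function *)

Section scale_renewal.
Context {R : realType} (nu : {measure set R -> \bar R}) (hnu : levy_measure nu).
Variables (gamma sigma q th : R) (W : R -> R).
Hypothesis q0 : 0 <= q.
Local Notation D := (`]0%R, +oo[%classic : set R).
Local Notation mu := (@lebesgue_measure R).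
Local Notation psi := (laplace_exponent gamma sigma nu).
Hypotheses (th0 : 0 < th) (IW : exp_integrable th W).
Hypothesis LW : forall s, th <= s -> (psi s - q) * laplace_transform W s = 1.
Implicit Types (lam x y z s : R) (k n N i : nat).

Lemma norm_sum_le (a : nat -> R) n z : 0 < z -> z <= 1 ->
  `|\sum_(k < n) a k * z ^+ k| <= \sum_(k < n) `|a k|.
Proof.
move=> z0 z1; apply: le_trans (ler_norm_sum _ _ _) _.
apply: ler_sum => k _; rewrite normrM ler_piMr// normrX gtr0_norm// exprn_ile1//.
exact: ltW.
Qed.

(** The product of psi - q and the transform of W is 1. Both factors are
    replaced by their expansions modulo z^(i+2) and the coefficients are
    compared. *)
Lemma coefficient_identity lam i : th < lam ->
  \sum_(j < i.+1) exponent_coef nu gamma sigma q lam j * erlang_increment lam W (i - j)%N =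
  lam * (i == 0)%:R.
Proof.
move=> thl; have l0 : 0 < lam by exact: lt_trans thl.
have [C1 [C10 H1]] := laplace_exponent_expansion hnu gamma sigma q0 i l0.
have [C2 [e2 [C20 e20 e21 H2]]] := laplace_transform_expansion_increment i.+1 (ltW th0) thl IW.
pose S := exponent_coef nu gamma sigma q lam; pose u := erlang_increment lam W.
pose P1 : {poly R} := \poly_(k < i.+2) S k.
pose P2 : {poly R} := \poly_(k < i.+2) u k.
pose M1 := \sum_(k < i.+2) `|S k|; pose M2 := \sum_(k < i.+2) `|u k|.
have M10 : 0 <= M1 by apply: sumr_ge0.
have M20 : 0 <= M2 by apply: sumr_ge0.
pose e := Num.min (Num.min e2 2^-1) (1 - th / lam).
have thl1 : th / lam < 1 by rewrite ltr_pdivrMr// mul1r.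
have e0 : 0 < e by rewrite !lt_min e20 invr_gt0 ltr0n subr_gt0 thl1.
pose C := 2 * (C1 * (M2 + C2) + M1 * C2).
have bound z : 0 < z -> z < e -> `|(P1 * P2 - lam%:P).[z]| <= C * z ^+ i.+2.
  move=> z0; rewrite !lt_min => /andP[/andP[ze2 ze] zth].
  have z1 : z < 1 by lra.
  have h1 := H1 z z0 ze; have h2 := H2 z z0 ze2.
  have hlam : th <= lam * (1 - z).
    have -> : th = lam * (th / lam) by field; rewrite gt_eqF.
    by rewrite ler_pM2l//; lra.
  rewrite hornerD hornerM hornerN hornerC !horner_poly.
  set p1 := \sum_(k < i.+2) S k * z ^+ k; set p2 := \sum_(k < i.+2) u k * z ^+ k.
  have b1 : `|p1| <= M1 by exact: norm_sum_le (ltW z1).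
  have b2 : `|p2| <= M2 by exact: norm_sum_le (ltW z1).
  set A := psi (lam * (1 - z)) - q in h1.
  set B := lam * laplace_transform W (lam * (1 - z)) * (1 - z) in h2.
  have AB : A * B = lam * (1 - z).
    have := LW hlam; rewrite -/A /B.
    move: A (laplace_transform _ _) {h1 h2 B} => a l al.
    by transitivity ((a * l) * (lam * (1 - z))); [ring|rewrite al mul1r].
  have zn0 : 0 <= z ^+ i.+2 by rewrite exprn_ge0// ltW.
  have zn1 : z ^+ i.+2 <= 1 by rewrite exprn_ile1// ltW.
  have B1 : `|B| <= M2 + C2.
    have -> : B = p2 + (B - p2) by ring.
    apply: (le_trans (ler_normD _ _)); apply: lerD => //.
    by apply: (le_trans h2); rewrite ler_piMr.
  have E : (1 - z) * (p1 * p2 - lam) = - ((A - (1 - z) * p1) * B) - (1 - z) * p1 * (B - p2).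
    have -> : (1 - z) * (p1 * p2 - lam) = (1 - z) * p1 * p2 - A * B by rewrite AB; ring.
    ring.
  have z10 : 0 < 1 - z by lra.
  have : (1 - z) * `|p1 * p2 - lam| <= (C1 * (M2 + C2) + M1 * C2) * z ^+ i.+2.
    rewrite -{1}(gtr0_norm z10) -normrM E.
    apply: (le_trans (ler_normB _ _)); rewrite normrN [leRHS]mulrDl; apply: lerD.
      rewrite normrM mulrAC; exact: ler_pM.
    rewrite normrM -[leRHS]mulrA; apply: ler_pM => //.
    by rewrite normrM (gtr0_norm z10) (le_trans _ b1)// ler_piMl//; lra.
  set X := `|p1 * p2 - lam| => hX; rewrite /C -mulrA.
  have : X <= 2 * ((1 - z) * X).
    have : 0 <= X * (1 - 2 * z) by rewrite mulr_ge0 ?normr_ge0//; lra.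
    lra.
  move/le_trans; apply; by rewrite ler_pM2l.
have := coef_eq0_of_bound e0 bound (ltnW (ltnSn i.+1)).
rewrite coefD coefN coefC coefM => /eqP; rewrite subr_eq0 => /eqP.
have -> : (if i == 0%N then lam else 0) = lam * (i == 0%N)%:R.
  by case: eqP => _; rewrite ?mulr1 ?mulr0.
move=> <-; apply: eq_bigr => j _; rewrite !coef_poly.
have ji : (j < i.+2)%N by rewrite (ltn_trans (ltn_ord j)).
have iji : (i - j < i.+2)%N by rewrite ltnS (leq_trans (leq_subr _ _)).
by rewrite ji iji.
Qed.

Hypothesis psi_gt : forall s, th <= s -> q < psi s.

Lemma erlang_increment_renewal lam n : th < lam ->
  (psi lam - q) * erlang_increment lam W n.+1 =
  \sum_(j < n.+1) renewal_weight nu sigma q lam (n - j)%N * erlang_increment lam W j.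
Proof.
move=> thl; have := coefficient_identity n.+1 thl.
rewrite mulr0 big_ord_recl/= => /eqP; rewrite addr_eq0 => /eqP ->.
rewrite -sumrN (reindex_inj rev_ord_inj)/=; apply: eq_bigr => j _.
rewrite subSS /bump/= add1n subSS.
have jn : (j <= n)%N by rewrite -ltnS.
by rewrite subKn// mulNr opprK.
Qed.

Hypothesis htail : log_convex (tail nu).

(** A log-convex tail is positive by definition, so nu charges (1, oo), on
    which the distribution function is bounded below. *)
Lemma levy_erlang_cdf_gt0 lam k : 0 < lam -> 0 < \int[nu]_(y in D) erlang_cdf lam k.+1 y.
Proof.
move=> l0.
have mD1 : measurable (`]1, +oo[%classic : set R) by exact: measurable_itv.
have I0 := integrable_erlang_cdf hnu k l0.
pose c := erlang_cdf lam k.+1 1.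
have c0 : 0 < c by rewrite erlang_cdf_gt0.
have tail1 : 0 < tail nu 1 by case: htail => /(_ 1 ltr01).
apply: (@lt_le_trans _ _ (c * tail nu 1)); first by rewrite mulr_gt0.
have mc : measurable_fun D (EFin \o erlang_cdf lam k.+1) by exact: measurable_int I0.
have sub : `]1, +oo[%classic `<=` D.
  by move=> y; rewrite /= !in_itv/= !andbT => y1; exact: lt_trans y1.
have step1 : (c%:E * nu `]1%R, +oo[%classic <= \int[nu]_(y in `]1%R, +oo[) (erlang_cdf lam k.+1 y)%:E)%E.
  rewrite -integral_cst//; apply: ge0_le_integral => //.
  - by move=> y _; rewrite lee_fin ltW.
  - exact: measurable_funS mc.
  move=> y; rewrite /= in_itv/= andbT => y1; rewrite lee_fin.
  by apply: erlang_cdf_nd => //; exact: ltW.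
have step2 : (\int[nu]_(y in `]1%R, +oo[) (erlang_cdf lam k.+1 y)%:E <=
    \int[nu]_(y in D) (erlang_cdf lam k.+1 y)%:E)%E.
  apply: ge0_subset_integral => //.
  by move=> y; rewrite /= in_itv/= andbT => y0; rewrite lee_fin erlang_cdf_ge0// ltW.
have := le_trans step1 step2; rewrite -(tailE hnu ltr01) -EFinM.
have fin := integrable_fin_num (measurable_itv _) I0.
by rewrite -(fineK fin) lee_fin.
Qed.

Lemma renewal_weight_gt0 lam k : 0 < lam -> 0 < renewal_weight nu sigma q lam k.
Proof.
move=> l0; rewrite /renewal_weight ltr_wpDl ?levy_erlang_cdf_gt0// addr_ge0//.
rewrite mulr_ge0// mulr_ge0 ?sqr_ge0// mulr_ge0 ?sqr_ge0// invr_ge0//.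
Qed.

(** In the quadratic form of [erlang_mixture_log_convex] the constant q
    contributes q (1 - s)^2, and the Gaussian term, present at k = 0 only, is
    nonnegative. *)
Lemma renewal_weight_log_convex lam k : 0 < lam ->
  renewal_weight nu sigma q lam k.+1 ^+ 2 <=
  renewal_weight nu sigma q lam k * renewal_weight nu sigma q lam k.+2.
Proof.
move=> l0.
pose t n := \int[nu]_(y in D) erlang_cdf lam n y.
have f0 := renewal_weight_gt0 k l0.
have f1 := renewal_weight_gt0 k.+1 l0.
have f2 := renewal_weight_gt0 k.+2 l0.
set F0 := renewal_weight _ _ _ _ k in f0 *.
set F1 := renewal_weight _ _ _ _ k.+1 in f1 *.
set F2 := renewal_weight _ _ _ _ k.+2 in f2 *.
(* For this s the quadratic form is f_k - f_(k+1)^2 / f_(k+2). *)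
pose s := F1 / F2.
have s0 : 0 < s by rewrite divr_gt0.
have sF : s * F2 = F1 by rewrite /s mulfVK// gt_eqF.
clearbody s.
have ht : 0 <= t k.+1 - 2 * s * t k.+2 + s ^+ 2 * t k.+3.
  apply: (erlang_mixture_log_convex (lam := lam) (k := k.+1) htail) => //.
  - by move=> x y; exact: tail_nonincreasing.
  - by case=> // n _; exact: integrable_erlang_pdf_tail.
  - by move=> n; rewrite /t Rintegral_erlang_cdf_tail.
have hF : 0 <= F0 - 2 * s * F1 + s ^+ 2 * F2.
  rewrite /F0 /F1 /F2 /renewal_weight -/(t k.+1) -/(t k.+2) -/(t k.+3) /= !mul0r !add0r.
  set g := (k == 0)%:R * _.
  have g0 : 0 <= g.
    by rewrite mulr_ge0// mulr_ge0 ?sqr_ge0// mulr_ge0 ?sqr_ge0// invr_ge0.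
  have qs : 0 <= q * (1 - s) ^+ 2 by rewrite mulr_ge0 ?sqr_ge0.
  suff -> : g + q + t k.+1 - 2 * s * (q + t k.+2) + s ^+ 2 * (q + t k.+3) =
    g + q * (1 - s) ^+ 2 + (t k.+1 - 2 * s * t k.+2 + s ^+ 2 * t k.+3).
    by rewrite addr_ge0// addr_ge0.
  by move: (t k.+1) (t k.+2) (t k.+3) => t1 t2 t3; clearbody g; ring.
have : 0 <= (F0 - 2 * s * F1 + s ^+ 2 * F2) * F2 by rewrite mulr_ge0// ltW.
rewrite (_ : _ * F2 = F0 * F2 - F1 ^+ 2) ?subr_ge0//.
by rewrite -sF; ring.
Qed.

Theorem erlang_increment_convex lam : th < lam -> forall n,
  0 < erlang_increment lam W n /\
  erlang_increment lam W n.+1 + erlang_increment lam W n.+1 <=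
    erlang_increment lam W n + erlang_increment lam W n.+2.
Proof.
move=> thl; have l0 : 0 < lam by exact: lt_trans thl.
have c0 : 0 < psi lam - q by rewrite subr_gt0 psi_gt// ltW.
have u0 : 0 < erlang_increment lam W 0.
  have := coefficient_identity 0 thl; rewrite big_ord1 subn0 mulr1 /exponent_coef => h.
  by rewrite -(pmulr_rgt0 _ c0) h.
have up := renewal_gt0 c0 (fun k => renewal_weight_gt0 k l0) u0
  (fun n => erlang_increment_renewal n thl).
have uc := renewal_log_convex c0 (fun k => renewal_weight_gt0 k l0)
  (fun k => renewal_weight_log_convex k l0) u0
  (fun n => erlang_increment_renewal n thl).
by move=> n; split; [exact: up|exact: log_convex_convex (up n) (up n.+2) (uc n)].
Qed.
End scale_renewal.

(** * Convexity of the increments of the scale function *)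

Section convex_sequences.
Context {R : realFieldType}.
Implicit Types (f u : nat -> R) (a b c j n : nat).

Lemma seq_nondecreasing f : (forall j, f j <= f j.+1) -> forall j a, f j <= f (j + a)%N.
Proof.
move=> H j; elim=> [|a IH]; first by rewrite addn0.
by rewrite addnS (le_trans IH).
Qed.

(** The increments of f are nondecreasing. *)
Lemma convex_seq_3point f j a b :
  (forall j, f j.+1 + f j.+1 <= f j + f j.+2) ->
  (a + b)%:R * f (j + a)%N <= b%:R * f j + a%:R * f (j + a + b)%N.
Proof.
move=> H; pose e i := f i.+1 - f i.
have He i k : e i <= e (i + k)%N by apply: seq_nondecreasing => i'; rewrite /e; have := H i'; lra.
have h1 m : f (j + m)%N - f j <= m%:R * e (j + m)%N.
  elim: m => [|m IH]; first by rewrite addn0 subrr mul0r.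
  have h := He (j + m)%N 1%N; rewrite addn1 in h.
  rewrite addnS -natr1 mulrDl mul1r.
  have := ler_wpM2l (ler0n _ m) h; rewrite {2}/e in h; move: IH h; rewrite /e; lra.
have h2 m : m%:R * e (j + a)%N <= f (j + a + m)%N - f (j + a)%N.
  elim: m => [|m IH]; first by rewrite addn0 subrr mul0r.
  have h := He (j + a)%N m.
  have eE : e (j + a + m)%N = f (j + a + m).+1 - f (j + a + m)%N by [].
  rewrite eE in h; rewrite addnS -natr1 mulrDl mul1r; lra.
have := ler_wpM2l (ler0n _ b) (h1 a); have := ler_wpM2l (ler0n _ a) (h2 b).
rewrite natrD; lra.
Qed.

Lemma convex_seq_window (V u : nat -> R) c : (forall j, V j.+1 = V j + u j) ->
  (forall j, u j.+1 + u j.+1 <= u j + u j.+2) ->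
  forall j, (V (j.+1 + c)%N - V j.+1) + (V (j.+1 + c)%N - V j.+1) <=
    (V (j + c)%N - V j) + (V (j.+2 + c)%N - V j.+2).
Proof.
move=> HV Hu; elim: c => [|c IH] j; first by rewrite !addn0; lra.
have := IH j; rewrite !addnS !HV; have := Hu (j + c)%N.
by rewrite !addSn; lra.
Qed.
End convex_sequences.

Section limit_passage.
Context {R : realType} (W : R -> R) (th : R).
Hypotheses (th0 : 0 < th) (IW : exp_integrable th W).
Hypothesis contW : forall x, 0 <= x -> forall e, 0 < e ->
  exists2 dl, 0 < dl & forall y, 0 <= y -> `|y - x| < dl -> `|W y - W x| <= e.
Hypothesis uW : forall lam, th < lam -> forall n,
  0 < erlang_increment lam W n /\
  erlang_increment lam W n.+1 + erlang_increment lam W n.+1 <=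
    erlang_increment lam W n + erlang_increment lam W n.+2.
Implicit Types (x y z a b c : R).

Definition grid x (n : nat) : nat := Num.truncn (n%:R * x).

Lemma cvg_grid x : 0 <= x -> (grid x n)%:R / n%:R @[n --> \oo] --> x.
Proof.
move=> x0; apply/cvgrPdist_le => e e0; near=> n.
have n0 : (0 < n)%N by near: n; exact: nbhs_infty_gt.
have n0R : 0 < n%:R :> R by rewrite ltr0n.
have nx : 0 <= n%:R * x by rewrite mulr_ge0// ltW.
have /andP[h1 h2] := truncn_itv nx.
have hn : e^-1 <= n%:R by near: n; exact: nbhs_infty_ger.
have h3 : (grid x n)%:R / n%:R <= x by rewrite ler_pdivrMr// mulrC.
rewrite ger0_norm ?subr_ge0// lerBlDr -lerBlDl ler_pdivlMr//.
have h4 : 1 <= n%:R * e.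
  by rewrite -ler_pdivrMr// mul1r.
move: h2; rewrite -natr1 -/(grid x n) => h2; lra.
Unshelve. all: by end_near. Qed.

Let V lam k := erlang_mean lam W k.

Lemma cvg_erlang_mean x (k : nat -> nat) : 0 <= x -> (k n)%:R / n%:R @[n --> \oo] --> x ->
  V n%:R (k n) @[n --> \oo] --> W x.
Proof. by move=> x0 kx; exact: (erlang_approx th0 x0 IW (contW x0) kx). Qed.

Lemma cvg_gridD (k l : nat -> nat) x y : (k n)%:R / n%:R @[n --> \oo] --> x ->
  (l n)%:R / n%:R @[n --> \oo] --> y -> (k n + l n)%N%:R / n%:R @[n --> \oo] --> x + y.
Proof.
move=> kx ly; under eq_fun do rewrite natrD mulrDl.
exact: cvgD.
Qed.

Lemma erlang_meanS lam j : V lam j.+1 = V lam j + erlang_increment lam W j.+1.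
Proof. by rewrite /= addrC subrK. Qed.

(** W is the limit of the averages, which increase with the order. *)
Theorem scale_nondecreasing x c : 0 <= x -> 0 <= c -> W x <= W (x + c).
Proof.
move=> x0 c0; have gx := cvg_grid x0; have gc := cvg_grid c0.
have h1 := cvg_erlang_mean x0 gx.
have h2 := cvg_erlang_mean (addr_ge0 x0 c0) (cvg_gridD gx gc).
apply: (ler_cvg_to h1 h2); near=> n.
apply: seq_nondecreasing => j; rewrite erlang_meanS lerDl ltW//.
suff hn : th < n%:R by case: (uW hn j.+1).
by near: n; exact: nbhs_infty_gtr.
Unshelve. all: by end_near. Qed.

Lemma scale_ge0 x : 0 <= x -> 0 <= W x.
Proof.
move=> x0; apply: (@le_trans _ _ (W 0)); last first.
  by rewrite -[x]add0r; exact: scale_nondecreasing.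
have k0 : (fun n : nat => (0%N)%:R / n%:R : R) @ \oo --> (0 : R).
  by under eq_fun do rewrite mul0r; exact: cvg_cst.
have h := cvg_erlang_mean (lexx 0) k0.
apply: (ler_cvg_to (cvg_cst (0 : R)) h); near=> n.
have hn : th < n%:R by near: n; exact: nbhs_infty_gtr.
by apply/ltW; case: (uW hn 0%N).
Unshelve. all: by end_near. Qed.

(** The averages satisfy the inequality exactly at integer orders; let the
    orders, divided by n, tend to x, a, b and c. *)
Theorem scale_increment_convex x a b c : 0 <= x -> 0 <= a -> 0 <= b -> 0 <= c ->
  (a + b) * (W (x + a + c) - W (x + a)) <=
  b * (W (x + c) - W x) + a * (W (x + a + b + c) - W (x + a + b)).
Proof.
move=> x0 a0 b0 c0.
have gx := cvg_grid x0; have ga := cvg_grid a0; have gb := cvg_grid b0; have gc := cvg_grid c0.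
have gxa := cvg_gridD gx ga; have gxab := cvg_gridD gxa gb.
have xa0 := addr_ge0 x0 a0; have xab0 := addr_ge0 xa0 b0.
have lim y (l : nat -> nat) : 0 <= y -> (l n)%:R / n%:R @[n --> \oo] --> y ->
   V n%:R (l n + grid c n)%N - V n%:R (l n) @[n --> \oo] --> W (y + c) - W y.
  move=> y0 gy; apply: cvgB; last exact: cvg_erlang_mean.
  exact: cvg_erlang_mean (addr_ge0 y0 c0) (cvg_gridD gy gc).
have L := cvgM (cvgD ga gb) (lim _ _ xa0 gxa).
have Rr := cvgD (cvgM gb (lim _ _ x0 gx)) (cvgM ga (lim _ _ xab0 gxab)).
apply: (ler_cvg_to (L _ _) (Rr _ _ _)); near=> n.
have hn : th < n%:R by near: n; exact: nbhs_infty_gtr.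
have n0 : 0 < n%:R^-1 :> R by rewrite invr_gt0; exact: lt_trans hn.
have := @convex_seq_3point R (fun j => V n%:R (j + grid c n)%N - V n%:R j) (grid x n) (grid a n) (grid b n).
move=> /(_ (convex_seq_window (grid c n) (erlang_meanS n%:R) (fun j => proj2 (uW hn j.+1)))) h.
have := ler_wpM2r (ltW n0) h; rewrite natrD.
rewrite !fctE/=; lra.
Unshelve. all: by end_near. Qed.
End limit_passage.

(** * Differentiability from convex increments *)

Section derivative_tools.
Context {R : realType}.
Implicit Types (f : R -> R) (x d C L h : R).

Lemma is_derive_of_quadratic f x d C L : 0 < L ->
  (forall h, `|h| <= L -> `|f (x + h) - f x - h * d| <= C * h ^+ 2) -> is_derive x 1 f d.
Proof.
move=> L0 H.
have cv : h^-1 *: (f (h *: 1 + x) - f x) @[h --> 0^'] --> d.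
  apply/cvgrPdist_le => e e0; near=> h.
  have h0 : h != 0 by near: h; exact: nbhs_dnbhs_neq.
  have hL : `|h| <= L.
    near: h; apply: dnbhs0_le => //.
  have C1 : 0 < `|C| + 1 by rewrite ltr_wpDl.
  have he : `|h| <= e / (`|C| + 1) by near: h; apply: dnbhs0_le; rewrite divr_gt0.
  rewrite /GRing.scale/= mulr1 [h + x]addrC.
  have Hh := H h hL.
  have -> : d - h^-1 * (f (x + h) - f x) = - (h^-1 * (f (x + h) - f x - h * d)) by field.
  rewrite normrN normrM normfV ler_pdivrMl ?normr_gt0//.
  apply: (le_trans Hh).
  rewrite ler_pdivlMr// in he.
  apply: (@le_trans _ _ (`|C| * (`|h| * `|h|))).
    by rewrite -expr2 real_normK ?num_real// ler_wpM2r ?sqr_ge0// ler_norm.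
  have := normr_ge0 h; have := normr_ge0 C; nra.
by apply: DeriveDef; [apply/cvg_ex; exists d|exact: cvg_lim].
Unshelve. all: by end_near. Qed.

Lemma is_derive_cvg f x d : is_derive x 1 f d ->
  h^-1 * (f (x + h) - f x) @[h --> 0^'] --> d.
Proof.
move=> [df <-]; move: df; rewrite /derivable => /cvg_ex[l hl].
have E : (fun h : R => h^-1 *: (f (h *: 1 + x) - f x)) = (fun h : R => h^-1 * (f (x + h) - f x)).
  by apply/funext => h; rewrite /GRing.scale/= mulr1 [h + x]addrC.
have dl : 'D_1 f x = l by exact: cvg_lim.
by rewrite dl -E.
Qed.

Lemma is_derive_ge0_right f x d : is_derive x 1 f d ->
  (forall h, 0 <= h -> f x <= f (x + h)) -> 0 <= d.
Proof.
move=> /is_derive_cvg cv H.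
have cr : h^-1 * (f (x + h) - f x) @[h --> 0^'+] --> d.
  exact: cvg_dnbhs_at_right.
rewrite -(cvg_lim _ cr)//; apply: limr_ge; first by apply/cvg_ex; exists d.
near=> h; rewrite mulr_ge0 ?invr_ge0 ?subr_ge0//.
by apply: H.
Unshelve. all: by end_near. Qed.

(** Adding up about h / k steps of length k compares E h with (h / k) E k, up
    to C h^2 and to a remainder controlled by monotonicity. Letting k tend
    to 0 shows that the slope is the infimum of E h / h + C h. *)
Lemma almost_additive_slope (E : R -> R) L C : 0 < L -> 0 <= C ->
  (forall a b, 0 <= a -> 0 <= b -> a + b <= L -> `|E (a + b) - E a - E b| <= C * a * b) ->
  (forall a b, 0 <= a -> a <= b -> b <= L -> E a <= E b) -> E 0 = 0 ->
  (forall e, 0 < e -> exists2 dl, 0 < dl & forall h, 0 <= h -> h < dl -> E h <= e) ->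
  exists w, forall h, 0 < h -> h <= L -> `|E h - h * w| <= C * h ^+ 2.
Proof.
move=> L0 C0 Eadd Emono E0 Econt.
have Epos a : 0 <= a -> a <= L -> 0 <= E a by move=> a0 aL; rewrite -E0; exact: Emono.
have mult n k : 0 < k -> n%:R * k <= L -> `|E (n%:R * k) - n%:R * E k| <= C * (n%:R * k) ^+ 2.
  move=> k0; elim: n => [|n IH] nk.
    by rewrite !mul0r E0 subrr normr0 expr0n/= mulr0.
  have nk' : n%:R * k <= L by apply: le_trans nk; rewrite ler_pM2r// ler_nat.
  have nk0 : 0 <= n%:R * k by rewrite mulr_ge0// ltW.
  move: nk; rewrite -natr1 mulrDl mul1r => nk.
  have h1 := Eadd _ _ nk0 (ltW k0) nk.
  have -> : E (n%:R * k + k) - (n%:R + 1) * E k =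
     (E (n%:R * k + k) - E (n%:R * k) - E k) + (E (n%:R * k) - n%:R * E k) by ring.
  apply: (le_trans (ler_normD _ _)); apply: (le_trans (lerD h1 (IH nk'))).
  have : 0 <= C * (n%:R * k * k + k ^+ 2).
    by rewrite mulr_ge0// addr_ge0 ?sqr_ge0// mulr_ge0// ltW.
  lra.
have comp h k : 0 < k -> k <= h -> h <= L -> `|E h - h / k * E k| <= C * h ^+ 2 + 2 * E k.
  move=> k0 kh hL; have h0 : 0 < h by exact: lt_le_trans kh.
  pose n := Num.truncn (h / k).
  have hk0 : 0 <= h / k by rewrite divr_ge0// ltW.
  have /andP[n1 n2] := truncn_itv hk0.
  have nkh : n%:R * k <= h by rewrite -ler_pdivlMr.
  pose r := h - n%:R * k.
  have r0 : 0 <= r by rewrite subr_ge0.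
  have rk : r <= k.
    move: n2; rewrite -natr1 ltr_pdivrMr// => n2; rewrite /r /n; lra.
  have nk0 : 0 <= n%:R * k by rewrite mulr_ge0// ltW.
  have hE : h = n%:R * k + r by rewrite /r; lra.
  have nkrL : n%:R * k + r <= L by rewrite -hE.
  have h1 := Eadd _ _ nk0 r0 nkrL; rewrite -hE in h1.
  have h2 := mult n k k0 (le_trans nkh hL).
  have h3 : 0 <= E r by apply: Epos => //; exact: le_trans (le_trans rk kh) hL.
  have h4 : E r <= E k by apply: Emono => //; exact: le_trans hL.
  have h5 : `|(n%:R - h / k) * E k| <= E k.
    rewrite normrM (ger0_norm (le_trans h3 h4)) ler_piMl ?(le_trans h3 h4)//.
    rewrite distrC ger0_norm ?subr_ge0//.
    by move: n2; rewrite -natr1 -/n; lra.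
  have -> : E h - h / k * E k = (E h - E (n%:R * k) - E r) + (E (n%:R * k) - n%:R * E k)
     + E r + (n%:R - h / k) * E k by ring.
  apply: (le_trans (ler_normD _ _)).
  have h6 : `|E h - E (n%:R * k) - E r + (E (n%:R * k) - n%:R * E k) + E r| <= C * h ^+ 2 + E k.
    apply: (le_trans (ler_normD _ _)); apply: lerD; last by rewrite ger0_norm.
    apply: (le_trans (ler_normD _ _)); apply: (le_trans (lerD h1 h2)).
    have -> : C * (n%:R * k) * r + C * (n%:R * k) ^+ 2 = C * (n%:R * k * (n%:R * k + r)) by ring.
    rewrite -hE expr2; apply: ler_wpM2l => //; apply: ler_wpM2r => //; exact: ltW.
  lra.
pose S := [set E h / h + C * h | h in [set h | 0 < h /\ h <= L]].
have S0 : S !=set0 by exists (E L / L + C * L); exists L.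
have Slb : lbound S 0.
  move=> _ [h [h0 hL] <-]; rewrite addr_ge0 ?mulr_ge0 ?invr_ge0 ?Epos ?(ltW h0)//.
have hinf : has_inf S by split => //; exists 0.
exists (inf S) => h h0 hL.
have lo : h * inf S <= E h + C * h ^+ 2.
  have : inf S <= E h / h + C * h.
    by apply: ge_inf; [case: hinf|exists h].
  rewrite -(ler_pM2l h0) => /le_trans; apply.
  rewrite le_eqVlt; apply/orP; left; apply/eqP.
  by field; rewrite gt_eqF.
have up e : 0 < e -> E h <= h * inf S + C * h ^+ 2 + e.
  move=> e0.
  pose e1 := e / 2 / h.
  have e10 : 0 < e1 by rewrite !divr_gt0.
  have [_ [h1 [h10 h1L] <-] hs] := inf_adherent e10 hinf.
  pose e2 := e / 4 / (h / h1 + 1).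
  have hh1 : 0 < h / h1 by rewrite divr_gt0.
  have e20 : 0 < e2 by rewrite !divr_gt0// addr_gt0.
  have [dl dl0 Hd] := Econt _ e20.
  pose k := Num.min (Num.min h h1) (dl / 2).
  have k0 : 0 < k by rewrite !lt_min h0 h10 divr_gt0.
  have kh : k <= h by rewrite !ge_min lexx.
  have kh1 : k <= h1 by rewrite !ge_min lexx orbT.
  have kd : k < dl.
    by rewrite (@le_lt_trans _ _ (dl / 2)) ?ge_min ?lexx ?orbT// ltr_pdivrMr// ltr_pMr// ltr1n.
  have Ek := Hd k (ltW k0) kd.
  have c1 := comp h k k0 kh hL; have c2 := comp h1 k k0 kh1 h1L.
  have {}c1 : E h <= h / k * E k + C * h ^+ 2 + 2 * E k.
    by have := ler_norm (E h - h / k * E k); lra.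
  have {}c2 : h1 / k * E k <= E h1 + C * h1 ^+ 2 + 2 * E k.
    have := ler_norm (- (E h1 - h1 / k * E k)); rewrite normrN; lra.
  have c3 : h / k * E k <= h * (E h1 / h1 + C * h1) + h / h1 * (2 * E k).
    have := ler_wpM2l (ltW hh1) c2.
    have -> : h / h1 * (h1 / k * E k) = h / k * E k by field; rewrite !gt_eqF.
    have -> : h / h1 * (E h1 + C * h1 ^+ 2 + 2 * E k) = h * (E h1 / h1 + C * h1) + h / h1 * (2 * E k).
      by field; rewrite gt_eqF.
    by [].
  have c4 : h * (E h1 / h1 + C * h1) <= h * inf S + e / 2.
    have := ler_wpM2l (ltW h0) (ltW hs).
    suff -> : h * (inf S + e1) = h * inf S + e / 2 by [].
    by rewrite /e1; field; rewrite gt_eqF.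
  have c5 : (h / h1 + 1) * (2 * E k) <= e / 2.
    have p : 0 < h / h1 + 1 by rewrite addr_gt0.
    have := ler_wpM2l (ltW p) Ek.
    have -> : (h / h1 + 1) * e2 = e / 4 by rewrite /e2; field; rewrite !gt_eqF// addr_gt0.
    lra.
  lra.
rewrite ler_norml; apply/andP; split; first by lra.
rewrite lerBlDr addrC; apply/ler_addgt0Pr => e e0; exact: up.
Qed.
End derivative_tools.

Section increment_convex.
Context {R : realType} (W : R -> R).
Hypothesis contW : forall x, 0 <= x -> forall e, 0 < e ->
  exists2 dl, 0 < dl & forall y, 0 <= y -> `|y - x| < dl -> `|W y - W x| <= e.
Hypothesis Wmono : forall x c, 0 <= x -> 0 <= c -> W x <= W (x + c).
Hypothesis Wconv : forall x a b c, 0 <= x -> 0 <= a -> 0 <= b -> 0 <= c ->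
  (a + b) * (W (x + a + c) - W (x + a)) <=
  b * (W (x + c) - W x) + a * (W (x + a + b + c) - W (x + a + b)).
Implicit Types (x y a b c h L X : R) (n m : nat).

Definition second_difference (f : R -> R) x b c : R := f (x + b + c) - f (x + b) - f (x + c) + f x.
Local Notation dd := (second_difference W).

Let ddC x b c : dd x b c = dd x c b.
Proof. by rewrite /second_difference (addrAC x b c); ring. Qed.

Lemma second_difference_nondecreasing x a b c : 0 <= x -> 0 <= a -> 0 <= b -> 0 <= c ->
  dd x b c <= dd (x + a) b c.
Proof.
move=> x0; rewrite le_eqVlt => /predU1P[<-|a0]; first by rewrite addr0.
rewrite le_eqVlt => /predU1P[<- c0|b0 c0].
  by rewrite /second_difference !addr0; lra.
have h1 := Wconv x0 (ltW a0) (ltW b0) c0.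
have h2 := Wconv x0 (ltW b0) (ltW a0) c0.
have ab : 0 < a + b by rewrite addr_gt0.
rewrite (addrAC x b a) [b + a]addrC in h2.
rewrite -subr_ge0 -(pmulr_rge0 _ ab) /second_difference; lra.
Qed.

Lemma second_difference_mulnl x a b n : 0 <= x -> 0 <= a -> 0 <= b ->
  n%:R * dd x a b <= dd x (n%:R * a) b.
Proof.
move=> x0 a0 b0; elim: n => [|n IH].
  by rewrite !mul0r /second_difference addr0; lra.
have na : 0 <= n%:R * a by rewrite mulr_ge0.
have := second_difference_nondecreasing x0 na a0 b0.
have -> : dd x (n.+1%:R * a) b = dd x (n%:R * a) b + dd (x + n%:R * a) a b.
  by rewrite /second_difference -natr1 mulrDl mul1r !addrA; ring.
rewrite -natr1 mulrDl mul1r; lra.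
Qed.

Lemma second_difference_mulnr x a b n : 0 <= x -> 0 <= a -> 0 <= b ->
  dd x (n%:R * a) b <= n%:R * dd (x + n%:R * a) a b.
Proof.
move=> x0 a0 b0; elim: n => [|n IH].
  by rewrite !mul0r /second_difference addr0; lra.
have na : 0 <= n%:R * a by rewrite mulr_ge0.
have xna : 0 <= x + n%:R * a by rewrite addr_ge0.
have h := second_difference_nondecreasing xna a0 a0 b0.
have -> : dd x (n.+1%:R * a) b = dd x (n%:R * a) b + dd (x + n%:R * a) a b.
  by rewrite /second_difference -natr1 mulrDl mul1r !addrA; ring.
have := ler_wpM2l (ler0n _ n) h.
have -> : x + n.+1%:R * a = x + n%:R * a + a by rewrite -natr1; ring.
rewrite -natr1 (mulrDl _ 1) mul1r; lra.
Qed.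

Let mono x y : 0 <= x -> x <= y -> W x <= W y.
Proof. by move=> x0 xy; rewrite -(subrKC x y); apply: Wmono => //; rewrite subr_ge0. Qed.

(** Second differences are nondecreasing in x. Hence about L / a times L / b
    copies of the one at x are bounded above by translates to the right of x,
    and below by translates to its left, which telescope to a second
    difference with steps comparable to L; that one is bounded because W is
    monotone. *)
Lemma second_difference_bound L X : 0 < L -> exists2 C, 0 <= C &
  forall x a b, 2 * L <= x -> x <= X -> 0 <= a -> a <= L -> 0 <= b -> b <= L ->
  `|dd x a b| <= C * a * b.
Proof.
move=> L0; pose M := Num.max 0 (W (X + 2 * L) - W 0).
have M0 : 0 <= M by rewrite le_max lexx.
exists (4 * M / L ^+ 2) => [|x a b].
  by rewrite mulr_ge0 ?mulr_ge0 ?invr_ge0 ?sqr_ge0.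
move=> xL xX; rewrite le_eqVlt => /predU1P[<- _ _ _|a0 aL].
  by rewrite mulr0 mul0r /second_difference addr0 normr_le0; apply/eqP; ring.
rewrite le_eqVlt => /predU1P[<- _|b0 bL].
  by rewrite mulr0 /second_difference !addr0 normr_le0; apply/eqP; ring.
have steps c : 0 < c -> c <= L -> exists n : nat, n%:R * c <= L /\ L <= 2 * (n%:R * c).
  move=> c0 cL; exists (Num.truncn (L / c)).
  have Lc : 0 <= L / c by rewrite divr_ge0 ?(ltW L0)// ltW.
  have /andP[n1 n2] := truncn_itv Lc.
  have n0 : (1 <= Num.truncn (L / c))%N by rewrite truncn_ge_nat// ler_pdivlMr// mul1r.
  split; first by rewrite -ler_pdivlMr.
  move: n2; rewrite ltr_pdivrMr// -natr1 mulrDl mul1r => n2.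
  have : c <= (Num.truncn (L / c))%:R * c by rewrite ler_peMl ?(ltW c0)// ler1n.
  lra.
have [n [n1 n2]] := steps a a0 aL.
have [m [m1 m2]] := steps b b0 bL.
set A := n%:R * a in n1 n2; set B := m%:R * b in m1 m2.
have x0 : 0 <= x by lra.
have A0 : 0 <= A by rewrite mulr_ge0// ltW.
have B0 : 0 <= B by rewrite mulr_ge0// ltW.
have bnd y : 0 <= y -> y + A + B <= X + 2 * L -> `|dd y A B| <= M.
  move=> y0 yX; have yA0 : 0 <= y + A by rewrite addr_ge0.
  have h1 : W 0 <= W y by apply: mono.
  have h2 : W y <= W (y + A) by apply: Wmono.
  have h3 : W y <= W (y + B) by apply: Wmono.
  have h4 : W (y + A) <= W (y + A + B) by apply: Wmono.
  have h5 : W (y + A + B) <= W (X + 2 * L) by apply: mono => //; rewrite addr_ge0.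
  have h6 : W (y + B) <= W (y + A + B) by rewrite addrAC; apply: Wmono => //; rewrite addr_ge0.
  have h7 : W (X + 2 * L) - W 0 <= M by rewrite le_max lexx orbT.
  rewrite ler_norml /second_difference; apply/andP; split; lra.
have up : n%:R * (m%:R * dd x a b) <= M.
  have h1 := second_difference_mulnl m x0 (ltW b0) (ltW a0).
  have h2 := second_difference_mulnl n x0 (ltW a0) B0.
  rewrite ddC in h1; rewrite -/B [dd x B a]ddC in h1.
  have := ler_wpM2l (ler0n _ n) h1; rewrite -/A in h2.
  have yX : x + A + B <= X + 2 * L by lra.
  have := bnd x x0 yX; rewrite ler_norml => /andP[_]; lra.
have y0 : 0 <= x - A - B by lra.
have lo : - M <= n%:R * (m%:R * dd x a b).
  have h2 := second_difference_mulnr n y0 (ltW a0) B0; rewrite -/A in h2.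
  have yA : 0 <= x - A - B + A by lra.
  have h1 := second_difference_mulnr m yA (ltW b0) (ltW a0); rewrite -/B in h1.
  rewrite (_ : x - A - B + A + B = x) in h1; last ring.
  rewrite ddC [dd x b a]ddC in h1.
  have := ler_wpM2l (ler0n _ n) h1.
  have yX : x - A - B + A + B <= X + 2 * L by lra.
  have := bnd _ y0 yX; rewrite ler_norml => /andP[+ _]; lra.
have AB : L ^+ 2 <= 4 * (A * B).
  have := ler_pM (ltW L0) (ltW L0) n2 m2; rewrite expr2; lra.
have key : (A * B) * `|dd x a b| <= M * (a * b).
  have -> : (A * B) * `|dd x a b| = `|n%:R * (m%:R * dd x a b)| * (a * b).
    rewrite !normrM !normr_nat /A /B; ring.
  by rewrite ler_wpM2r ?mulr_ge0 ?(ltW a0) ?(ltW b0)// ler_norml lo up.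
have L2 : 0 < L ^+ 2 by rewrite exprn_gt0.
rewrite -(ler_pM2l L2).
have -> : L ^+ 2 * (4 * M / L ^+ 2 * a * b) = 4 * (M * (a * b)) by field; rewrite gt_eqF.
have := ler_wpM2r (normr_ge0 (dd x a b)) AB; lra.
Qed.

(** The increments of W starting from x are additive up to second differences,
    which are of order a b. *)
Lemma increment_convex_derivable x : 0 < x -> exists w, is_derive x 1 W w.
Proof.
move=> x0; pose L := x / 4.
have L0 : 0 < L by rewrite divr_gt0.
have [C C0 H] := second_difference_bound x L0.
have xL : 2 * L <= x by rewrite /L; lra.
have [w Hw] : exists w, forall h, 0 < h -> h <= L -> `|(W (x + h) - W x) - h * w| <= C * h ^+ 2.
  apply: (@almost_additive_slope R (fun h => W (x + h) - W x) L C) => //.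
  - move=> a b a0 b0 abL.
    have := H x a b xL (lexx x) a0 _ b0 _.
    have aL : a <= L by lra.
    have bL : b <= L by lra.
    move=> /(_ aL bL); congr (_ <= _); congr `| _ |.
    by rewrite /second_difference !addrA; ring.
  - move=> a b a0 ab bL; rewrite lerD2r.
    by apply: mono; [rewrite addr_ge0// ltW|rewrite lerD2l].
  - by rewrite addr0 subrr.
  - move=> e e0; have [dl dl0 Hd] := contW (ltW x0) e0.
    exists dl => // h h0 hd; apply: le_trans (ler_norm _) _; apply: Hd; first by rewrite addr_ge0// ltW.
    by rewrite addrC addKr ger0_norm.
exists w; apply: (is_derive_of_quadratic (C := 2 * C) (L := L / 2)); first by rewrite divr_gt0.
move=> h hL; have [h0|h0|->] := ltgtP h 0; last first.
- by rewrite addr0 mul0r !subr0 subrr normr0 expr0n/= mulr0.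
- have hL' : h <= L by rewrite gtr0_norm// in hL; lra.
  apply: le_trans (Hw h h0 hL') _.
  by rewrite ler_wpM2r ?sqr_ge0//; lra.
pose k := - h; have k0 : 0 < k by rewrite oppr_gt0.
have kL : k <= L / 2 by rewrite ltr0_norm// in hL.
have kL' : k <= L by lra.
have h1 := Hw k k0 kL'.
have xk : 0 < x - k by rewrite /L in kL; lra.
have xk2 : 2 * L <= x - k by rewrite /L in kL *; lra.
have xkx : x - k <= x by lra.
have h2 := H (x - k) k k xk2 xkx (ltW k0) kL' (ltW k0) kL'.
have -> : W (x + h) - W x - h * w = second_difference W (x - k) k k - (W (x + k) - W x - k * w).
  by rewrite /second_difference subrK /k opprK; ring.
apply: (le_trans (ler_normB _ _)).
have -> : h ^+ 2 = k ^+ 2 by rewrite /k sqrrN.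
rewrite -mulrA -expr2 in h2; lra.
Qed.

(** The convexity of w is the derivative at c = 0 of the convexity of the
    increments over c. *)
Lemma derive_increment_convex : exists w : R -> R,
  [/\ forall x, 0 < x -> is_derive x 1 W (w x),
      forall x, 0 < x -> 0 <= w x &
      forall x a b, 0 < x -> 0 < a -> 0 < b ->
        (a + b) * w (x + a) <= b * w x + a * w (x + a + b)].
Proof.
pose w x := derive1 W x.
have dW x : 0 < x -> is_derive x 1 W (w x).
  move=> x0; have [d Hd] := increment_convex_derivable x0.
  by rewrite /w (is_derive_derive1 Hd).
exists w; split => // x.
  by move=> x0; apply: (is_derive_ge0_right (dW x x0)) => h h0; apply: Wmono => //; exact: ltW.
move=> a b x0 a0 b0.
have dshift y : 0 < y -> is_derive (0 : R) 1 (fun c => W (y + c)) (w y).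
  move=> y0; have h1 : is_derive (0 : R) 1 (fun c => y + c) (0 + 1).
    exact: (is_derive_add (is_derive_const y 0) (is_derive_id (0 : R) 1)).
  rewrite add0r in h1.
  have h2 : is_derive ((fun c => y + c) 0) 1 W (w y) by rewrite addr0; exact: dW.
  by apply: (is_derive_eq1 (is_derive1_comp h2 h1)); rewrite mulr1.
have xa0 : 0 < x + a by rewrite addr_gt0.
have xab0 : 0 < x + a + b by rewrite addr_gt0.
pose g c := (b * W (x + c) + a * W (x + a + b + c)) - (a + b) * W (x + a + c).
have dg : is_derive (0 : R) 1 g ((b * w x + a * w (x + a + b)) - (a + b) * w (x + a)).
  have sc k y : 0 < y -> is_derive (0 : R) 1 (fun c => k * W (y + c)) (k * w y).
    move=> y0; apply: (is_derive_eq1 (is_derive_mul (is_derive_const k 0) (dshift y y0))).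
    by rewrite mul0r add0r.
  exact: (is_derive_sub (is_derive_add (sc b x x0) (sc a _ xab0)) (sc (a + b) _ xa0)).
rewrite -subr_ge0; apply: (is_derive_ge0_right dg) => h h0.
rewrite add0r /g !addr0.
have := Wconv (ltW x0) (ltW a0) (ltW b0) h0; lra.
Qed.
End increment_convex.

(** * The second scale function *)

Section half_line_shift.
Context {R : realType}.
Local Notation mu := (@lebesgue_measure R).
Local Notation D0 := (`[0%R, +oo[%classic : set R).

Lemma ge0_integral_shift (G : R -> R) (x : R) :
  {within `[x, +oo[%classic, continuous G} -> (forall y, x <= y -> 0 <= G y) ->
  (\int[mu]_(y in `[x, +oo[) (G y)%:E = \int[mu]_(y in D0) (G (y + x))%:E)%E.
Proof.
move=> cG G0; pose F (y : R) : R := y + x.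
have dF (y : R) : is_derive y 1 F (1 : R).
  by apply: (is_derive_eq1 (is_derive_add (is_derive_id y 1) (is_derive_const x y))); rewrite addr0.
have F' : derive1 F = cst 1.
  by apply/funext => y; exact: (is_derive_derive1 (dF y)).
have F0 : F 0 = x by rewrite /F add0r.
have := @increasing_ge0_integration_by_substitutiony R F G 0.
rewrite F0 F' => ->//.
- by apply: eq_integral => y _; rewrite /F !fctE mulr1.
- by move=> y z _ _ yz; rewrite /F ltrD2r.
- by move=> y _; exact: cst_continuous.
- exact: is_cvg_cst.
- exact: is_cvg_cst.
- split; first by move=> y _; exact: (is_derive_derivable (dF y)).
  by rewrite -[X in _ --> X]/(F 0); apply: cvg_at_right_filter; exact: (is_derive_continuous (dF 0)).
- apply/cvgryPge => A; near=> y; rewrite /F -lerBlDr; near: y; apply: nbhs_pinfty_ge; exact: num_real.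
- by move=> y; rewrite in_itv/= andbT => xy; apply: G0; exact: ltW.
Unshelve. all: by end_near. Qed.
End half_line_shift.

Section second_scale_function.
Context {R : realType} (psi W : R -> R) (q p th : R).
Local Notation mu := (@lebesgue_measure R).
Local Notation D0 := (`[0%R, +oo[%classic : set R).
Implicit Types (x y a b : R).
Hypotheses (th0 : 0 < th) (p0 : 0 < p) (psi_th : psi th - q = p).
Hypothesis IW : exp_integrable th W.
Hypothesis LW : p * laplace_transform W th = 1.
Hypothesis cW : {within `[0, +oo[%classic, continuous W}.
Hypothesis W0 : forall x, 0 <= x -> 0 <= W x.
Variable w : R -> R.
Hypothesis dW : forall x, 0 < x -> is_derive x 1 W (w x).

Local Notation Z := (fun x => Zfun psi q W x th).
(** The function x |-> Z_q'(x, th), in a form that also covers x = 0. *)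
Definition scale_density x : R := th * Zfun psi q W x th - p * W x.
Local Notation m := scale_density.

Let G y := expR (- (th * y)) * W y.
Let I x := \int[mu]_(y in `[0, x]) G y.

Let ZE x : Zfun psi q W x th = expR (th * x) * (1 - p * I x).
Proof. by rewrite /Zfun psi_th. Qed.

Let IG x : mu.-integrable `[0, x] (EFin \o G).
Proof.
apply: integrableS IW => //.
by apply: subset_itv => //; rewrite bnd_simp.
Qed.

Let dI x : 0 < x -> is_derive x 1 I (G x).
Proof.
move=> x0.
have cG : {for x, continuous G}.
  apply: (@continuousM _ _ (fun y => expR (- (th * y))) W).
    exact: continuous_expRN_mulc.
  exact: (is_derive_continuous (dW x0)).
have x1 : x < x + 1 by lra.
have [d1 d2] := @continuous_FTC1_closed R G 0 x (x + 1) x1 (IG _) x0 cG.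
rewrite derive1E in d2; exact: (DeriveDef d1 d2).
Qed.

Lemma is_derive_Zfun x : 0 < x -> is_derive x 1 Z (m x).
Proof.
move=> x0.
have h1 := is_derive_exp_comp (is_derive_mulc th x).
have h2 := is_derive_sub (is_derive_const 1 x) (is_derive_mul (is_derive_const p x) (dI x0)).
have := is_derive_mul h1 h2.
have -> : (fun y => expR (th * y) * (1 - p * I y)) = Z by apply/funext => y; rewrite ZE.
move/is_derive_eq1; apply.
rewrite /scale_density ZE /G.
set E := expR (- (th * x)); set F := expR (th * x).
have FE : F * E = 1 by rewrite /F /E -expRD subrr expR0.
transitivity (F * th * (1 - p * I x) - p * ((F * E) * W x)); first by ring.
rewrite FE; ring.
Qed.

Lemma is_derive_scale_density x : 0 < x -> is_derive x 1 m (th * m x - p * w x).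
Proof.
move=> x0.
have h1 := is_derive_mul (is_derive_const th x) (is_derive_Zfun x0).
have h2 := is_derive_mul (is_derive_const p x) (dW x0).
apply: (is_derive_eq1 (is_derive_sub h1 h2)); ring.
Qed.

Lemma Zfun0 : Zfun psi q W 0 th = 1.
Proof. by rewrite ZE mulr0 expR0 /I set_itv1 Rintegral_set1 mulr0 subr0 mulr1. Qed.

Lemma scale_density0 : m 0 = th - p * W 0.
Proof. by rewrite /scale_density Zfun0 mulr1. Qed.

Lemma scale_cvg0 : W y @[y --> 0^'+] --> W 0.
Proof.
have [_ h] := (continuous_within_itvcyP 0 W).1 cW; exact: h.
Qed.

Lemma scale_density_cvg0 : m y @[y --> 0^'+] --> m 0.
Proof.
apply: cvgB; last by apply: cvgM; [exact: cvg_cst|exact: scale_cvg0].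
apply: cvgM; first exact: cvg_cst.
rewrite [X in _ --> X]ZE.
rewrite (_ : (fun y => Zfun psi q W y th) = (fun y => expR (th * y) * (1 - p * I y))); last first.
  by apply/funext => y; rewrite ZE.
apply: cvgM.
  apply: cvg_at_right_filter; exact: continuous_expR_mulc.
apply: cvgB; first exact: cvg_cst.
apply: cvgM; first exact: cvg_cst.
have := @parameterized_integral_continuous R 0 1 G ler01 (IG 1).
by move/(continuous_within_itvP _ ltr01) => [_ h _].
Qed.

Lemma scale_density_continuous B : 0 < B -> {within `[0, B], continuous m}.
Proof.
move=> B0; apply/(continuous_within_itvP _ B0); split.
- move=> x; rewrite in_itv/= => /andP[x0 _].
  exact: (is_derive_continuous (is_derive_scale_density x0)).
- exact: scale_density_cvg0.
- apply: cvg_at_left_filter; exact: (is_derive_continuous (is_derive_scale_density B0)).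
Qed.

Let cG : {within `[0, +oo[%classic, continuous G}.
Proof.
apply/continuous_within_itvcyP; have [h1 h2] := (continuous_within_itvcyP 0 W).1 cW.
split.
  move=> x x0; apply: (@continuousM _ _ (fun y => expR (- (th * y))) W); last exact: h1.
  exact: continuous_expRN_mulc.
apply: cvgM; last exact: h2.
by apply: cvg_at_right_filter; exact: continuous_expRN_mulc.
Qed.

(** As p times the transform of W at th is 1, the factor 1 - p I x is the
    integral over (x, oo), to be shifted back to (0, oo). *)
Lemma Zfun_integral x : 0 <= x ->
  exp_integrable th (fun y => W (y + x)) /\
  Zfun psi q W x th = p * \int[mu]_(y in D0) (expR (- (th * y)) * W (y + x)).
Proof.
move=> x0.
have G0 y : x <= y -> 0 <= G y by move=> xy; rewrite /G mulr_ge0 ?expR_ge0// W0// (le_trans x0).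
have cGx : {within `[x, +oo[%classic, continuous G}.
  apply: continuous_subspaceW cG.
  by apply: subset_itv => //; rewrite bnd_simp.
have sh := ge0_integral_shift cGx G0.
have IGx : mu.-integrable `[x, +oo[ (EFin \o G).
  by apply: integrableS IW => //; apply: subset_itv => //; rewrite bnd_simp.
have fin : (\int[mu]_(y in `[x, +oo[) (G y)%:E)%E \is a fin_num by exact: (integrable_fin_num _ IGx).
have GE y : G (y + x) = expR (- (th * x)) * (expR (- (th * y)) * W (y + x)).
  rewrite /G mulrA -expRD; congr (expR _ * _); ring.
have sx y : is_derive y 1 (fun y : R => y + x) (1 : R).
  by apply: (is_derive_eq1 (is_derive_add (is_derive_id y 1) (is_derive_const x y))); rewrite addr0.
have dWx y : 0 < y + x -> is_derive y 1 (fun y => W (y + x)) (w (y + x) * 1).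
  by move=> h; exact: (@is_derive1_comp R W (fun y => y + x) y _ _ (dW h) (sx y)).
have mW : measurable_fun D0 (fun y => W (y + x)).
  apply: subspace_continuous_measurable_fun => //.
  apply/continuous_within_itvcyP; split.
    move=> y; rewrite ?in_itv/= ?andbT => y0.
    have yx : 0 < y + x by rewrite ltr_wpDr.
    exact: (is_derive_continuous (dWx _ yx)).
  rewrite add0r; move: x0; rewrite le_eqVlt => /predU1P[<-|x1].
    by under eq_fun do rewrite addr0; exact: scale_cvg0.
  have yx : 0 < 0 + x by rewrite add0r.
  have h : W (y + x) @[y --> 0] --> W (0 + x) := is_derive_continuous (dWx 0 yx).
  by rewrite add0r in h; exact: cvg_at_right_filter h.
have mWe : measurable_fun D0 (fun y => expR (- (th * y)) * W (y + x)).
  apply: measurable_funM => //; apply: continuous_measurable => //.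
  exact: continuous_expRN_mulc.
have EI : (\int[mu]_(y in D0) (G (y + x))%:E =
  (expR (- (th * x)))%:E * \int[mu]_(y in D0) (expR (- (th * y)) * W (y + x))%:E)%E.
  rewrite -ge0_integralZl_EFin//.
  - by apply: eq_integral => y _; rewrite GE EFinM.
  - by move=> y; rewrite /= in_itv/= andbT => y0; rewrite lee_fin mulr_ge0 ?expR_ge0// W0// addr_ge0.
  - exact/measurable_EFinP.
have Ish : exp_integrable th (fun y => W (y + x)).
  apply/integrableP; split; first exact/measurable_EFinP.
  have := @integral_fin_num_abs _ _ _ mu D0 _ _ mWe; move=> ->//.
  move: fin; rewrite sh EI; case: (\int[mu]_(y in D0) (expR (- (th * y)) * W (y + x))%:E)%E => //=.
  - by rewrite gt0_muley// lte_fin expR_gt0.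
  - by rewrite gt0_muleNy// lte_fin expR_gt0.
split => //; rewrite ZE.
have hI : laplace_transform W th - I x = \int[mu]_(y in `]x, +oo[) G y.
  by rewrite /I -(@Rintegral_itvB _ G (BLeft 0) (BInfty _ false) x).
have E1 : \int[mu]_(y in `]x, +oo[) G y = expR (- (th * x)) * \int[mu]_(y in D0) (expR (- (th * y)) * W (y + x)).
  rewrite Rintegral_itv_obnd_cbnd; last first.
    by apply: integrableS IGx => //; apply: subset_itv => //; rewrite bnd_simp.
  by rewrite /Rintegral sh EI fineM// integrable_fin_num.
have E2 : 1 - p * I x = p * (laplace_transform W th - I x) by rewrite mulrBr LW.
rewrite E2 hI E1 mulrCA; congr (_ * _).
by rewrite mulrA -expRD subrr expR0 mul1r.
Qed.

Lemma Rintegral_expRN : \int[mu]_(y in D0) expR (- (th * y)) = th^-1.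
Proof.
have := Rintegral_erlang_pdf 0 th0.
have -> : \int[mu]_(x in D0) erlang_pdf th 0 x = th * \int[mu]_(y in D0) expR (- (th * y)).
  rewrite -RintegralZl//; last first.
    have := exp_integrable_const 1 th0; apply: eq_integrable => // y _ /=.
    by rewrite mulr1.
  by apply: eq_Rintegral => y _; rewrite /erlang_pdf expr0 fact0 divr1 mulr1.
by move=> h; apply: (mulfI (lt0r_neq0 th0)); rewrite h mulfV// gt_eqF.
Qed.

(** A positive average of increments of W: convexity and monotonicity
    of increments pass to the density. *)
Lemma scale_density_integral x : 0 <= x ->
  exp_integrable th (fun y => W (y + x) - W x) /\ m x = p * th * \int[mu]_(y in D0) (expR (- (th * y)) * (W (y + x) - W x)).
Proof.
move=> x0; have [I1 E1] := Zfun_integral x0.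
have I2 := exp_integrable_const (W x) th0.
split; first exact: exp_integrableD I1 (exp_integrableN I2).
have -> : \int[mu]_(y in D0) (expR (- (th * y)) * (W (y + x) - W x)) =
   \int[mu]_(y in D0) (expR (- (th * y)) * W (y + x) - expR (- (th * y)) * W x).
  by apply: eq_Rintegral => y _; rewrite mulrBr.
rewrite RintegralB// RintegralZr ?Rintegral_expRN; last 2 first.
- by [].
- have := exp_integrable_const 1 th0; apply: eq_integrable => // y _ /=.
  by rewrite mulr1.
by rewrite /scale_density E1; field; rewrite gt_eqF.
Qed.

Hypothesis Wconv : forall x a b c, 0 <= x -> 0 <= a -> 0 <= b -> 0 <= c ->
  (a + b) * (W (x + a + c) - W (x + a)) <=
  b * (W (x + c) - W x) + a * (W (x + a + b + c) - W (x + a + b)).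

Lemma scale_density_convex x a b : 0 <= x -> 0 <= a -> 0 <= b ->
  (a + b) * m (x + a) <= b * m x + a * m (x + a + b).
Proof.
move=> x0 a0 b0.
have xa0 := addr_ge0 x0 a0; have xab0 := addr_ge0 xa0 b0.
have [I1 ->] := scale_density_integral xa0.
have [I2 ->] := scale_density_integral x0.
have [I3 ->] := scale_density_integral xab0.
rewrite !(mulrCA _ (p * th)) -mulrDr ler_pM2l ?mulr_gt0//.
have mD0 : measurable (D0 : set (measurableTypeR R)) by exact: measurable_itv.
rewrite -!RintegralZl// -RintegralD//; try exact: integrable_mulc.
apply: le_Rintegral => //; first exact: integrable_mulc.
  by apply: integrable_add => //; exact: integrable_mulc.
move=> y; rewrite /= in_itv/= andbT => y0.
have := ler_wpM2l (expR_ge0 (- (th * y))) (Wconv x0 a0 b0 y0).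
rewrite ![y + _]addrC; lra.
Qed.

Lemma scale_density_le x y : 0 <= x -> 0 <= y ->
  (forall z, 0 <= z -> W (z + x) - W x <= W (z + y) - W y) -> m x <= m y.
Proof.
move=> x0 y0 H.
have [I1 ->] := scale_density_integral x0.
have [I2 ->] := scale_density_integral y0.
rewrite ler_pM2l ?mulr_gt0//; apply: le_Rintegral => // z.
rewrite /= in_itv/= andbT => z0.
by rewrite ler_wpM2l ?expR_ge0// H.
Qed.
End second_scale_function.

(** * Comparison of minimizers *)

Section positive_mean_value.
Context {R : realType}.
Implicit Types (f df : R -> R) (a b x : R).

Lemma MVT_derive f df a b : a < b -> (forall x, a < x -> x < b -> is_derive x 1 f (df x)) ->
  {within `[a, b], continuous f} -> exists c, [/\ a < c, c < b & f b - f a = df c * (b - a)].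
Proof.
move=> ab H cf; have [|c] := @MVT R f df a b ab _ cf.
  by move=> x; rewrite in_itv/= => /andP[]; exact: H.
by rewrite in_itv/= => /andP[ac cb] ->; exists c.
Qed.

Lemma MVT_pos f df a b : 0 < a -> a < b -> (forall x, 0 < x -> is_derive x 1 f (df x)) ->
  exists c, [/\ a < c, c < b & f b - f a = df c * (b - a)].
Proof.
move=> a0 ab H; apply: MVT_derive => // [x ax _|].
  by apply: H; exact: lt_trans ax.
apply: derivable_within_continuous => x; rewrite in_itv/= => /andP[ax _].
exact: (is_derive_derivable (H x (lt_le_trans a0 ax))).
Qed.

Lemma is_derive_constant_on f x d k a b : is_derive x 1 f d -> a < x -> x < b ->
  (forall y, a < y -> y < b -> f y = k) -> d = 0.
Proof.
move=> df ax xb H.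
have E : \forall y \near x, f y = cst k y.
  near=> y; apply: H; near: y; [exact: lt_nbhsr|exact: lt_nbhsl].
case: df => _ <-; rewrite (near_eq_derive _ E); exact: derive_cst.
Unshelve. all: by end_near. Qed.
End positive_mean_value.

Section convex_derivative.
Context {R : realType} (w : R -> R).
Hypothesis w0 : forall x, 0 < x -> 0 <= w x.
Hypothesis wconv : forall x a b, 0 < x -> 0 <= a -> 0 <= b ->
  (a + b) * w (x + a) <= b * w x + a * w (x + a + b).
Implicit Types (x y z s t : R).

Lemma convex_between x y z : 0 < x -> x <= y -> y <= z ->
  (z - x) * w y <= (z - y) * w x + (y - x) * w z.
Proof.
move=> x0 xy yz; have := @wconv x (y - x) (z - y) x0.
rewrite !subr_ge0 xy yz => /(_ isT isT).
have -> : x + (y - x) = y by ring.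
have -> : y + (z - y) = z by ring.
by have -> : y - x + (z - y) = z - x by ring.
Qed.

Lemma convex_rise x y z : 0 < x -> x < y -> y < z -> w x < w y -> w y < w z.
Proof.
move=> x0 xy yz xwy; have h := convex_between x0 (ltW xy) (ltW yz).
have h1 : 0 < (z - y) * (w y - w x) by rewrite mulr_gt0 ?subr_gt0.
have d : 0 < y - x by rewrite subr_gt0.
rewrite -subr_gt0 -(pmulr_rgt0 _ d); lra.
Qed.

(** A convex function is monotone near 0; as w >= 0, the only way not to have a
    limit is to increase to infinity. *)
Lemma convex_right_limit :
  (exists k : R, w y @[y --> 0^'+] --> k) \/ (forall M : R, \forall y \near (0 : R)^'+, M <= w y).
Proof.
have [[s [t [s0 st wts]]]|H] := pselect (exists s t, [/\ 0 < s, s < t & w t < w s]); last first.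
  left; eexists; apply: (@nondecreasing_at_right_cvgr R w 0 (BRight 1)).
  - by rewrite bnd_simp.
  - move=> x y; rewrite !in_itv/= => /andP[x0 x1] /andP[y0 y1]; rewrite le_eqVlt => /predU1P[->//|xy].
    by rewrite leNgt; apply/negP => h; apply: H; exists x, y.
  - by exists 0 => _ [x + <-]; rewrite /= in_itv/= => /andP[x0 _]; exact: w0.
have dec x y : 0 < x -> x <= y -> y <= s -> w y <= w x.
  rewrite le_eqVlt => x0 /predU1P[->//|xy] ys; rewrite leNgt; apply/negP => xwy.
  have yt : y < t by exact: le_lt_trans st.
  move: ys; rewrite le_eqVlt => /predU1P[ys|ys].
    by have := convex_rise x0 xy yt xwy; rewrite ys; apply/negP; rewrite -leNgt ltW.
  have h1 := convex_rise x0 xy ys xwy.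
  by have := convex_rise (lt_trans x0 xy) ys st h1; apply/negP; rewrite -leNgt ltW.
have [bd|nbd] := pselect (has_ubound (w @` `]0, s]%classic)).
  left; eexists; apply: (@nonincreasing_at_right_cvgr R w 0 (BRight s)) => //.
  move=> x y; rewrite !in_itv/= => /andP[x0 x1] /andP[y0 y1] xy; exact: dec.
right => M.
have [x [x0 xs Mx]] : exists x, [/\ 0 < x, x <= s & M < w x].
  apply: contrapT => h; apply: nbd; exists M => _ [x + <-]; rewrite /= in_itv/= => /andP[x0 xs].
  by rewrite leNgt; apply/negP => Mx; apply: h; exists x.
near=> y; apply: (le_trans (ltW Mx)); apply: dec => //.
near: y; exact: nbhs_right_le.
Unshelve. all: by end_near. Qed.
End convex_derivative.

Section minimizer_comparison.
Context {R : realType} (W m w : R -> R) (p th : R).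
Hypothesis p0 : 0 < p.
Hypothesis dW : forall x : R, 0 < x -> is_derive x 1 W (w x).
Hypothesis dm : forall x : R, 0 < x -> is_derive x 1 m (th * m x - p * w x).
Hypothesis wconv : forall x a b, 0 < x -> 0 <= a -> 0 <= b ->
  (a + b) * w (x + a) <= b * w x + a * w (x + a + b).
Hypothesis cm : forall B, 0 < B -> {within `[0, B], continuous m}.
Hypothesis mconv : forall x a b, 0 <= x -> 0 <= a -> 0 <= b ->
  (a + b) * m (x + a) <= b * m x + a * m (x + a + b).
Hypothesis m_le : forall x y, 0 <= x -> 0 <= y ->
  (forall z, 0 <= z -> W (z + x) - W x <= W (z + y) - W y) -> m x <= m y.
Implicit Types (x y z a b B M s t : R).

Lemma m_between x y z : 0 <= x -> x <= y -> y <= z ->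
  (z - x) * m y <= (z - y) * m x + (y - x) * m z.
Proof.
move=> x0 xy yz; have := @mconv x (y - x) (z - y) x0.
rewrite !subr_ge0 xy yz => /(_ isT isT).
have -> : x + (y - x) = y by ring.
have -> : y + (z - y) = z by ring.
by have -> : y - x + (z - y) = z - x by ring.
Qed.

(** By convexity w increases strictly beyond B, hence so do the increments of
    W, and m is nondecreasing. If m took the same value twice it would be
    constant in between, and th m - p w = 0 would make w constant there. *)
Lemma increasing_of_rise B : 0 <= B -> (forall s, B < s -> exists y, [/\ 0 < y, y < s & w y < w s]) ->
  forall x y, B < x -> x < y -> m x < m y.
Proof.
move=> B0 H.
have winc s t : B < s -> s < t -> w s < w t.
  move=> Bs st; have [y [y0 ys wys]] := H s Bs; exact: (convex_rise wconv y0 ys st wys).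
have mnd x y : B < x -> x < y -> m x <= m y.
  move=> Bx xy; have x0 : 0 < x by exact: le_lt_trans Bx.
  have y0 : 0 < y by exact: lt_trans xy.
  apply: m_le => // [||z z0]; try exact: ltW.
  have dG a : 0 < a -> is_derive a 1 (fun a => W (z + a) - W a) (w (z + a) * 1 - w a).
    move=> a0; have za : 0 < z + a by rewrite ltr_wpDl.
    have sa : is_derive a 1 (fun y : R => z + y) (1 : R).
      by apply: (is_derive_eq1 (is_derive_add (is_derive_const z a) (is_derive_id a 1))); rewrite add0r.
    apply: is_derive_sub (dW a0).
    exact: (@is_derive1_comp R W (fun y => z + y) a _ _ (dW za) sa).
  have [c [xc cy E]] := MVT_pos x0 xy dG.
  rewrite -subr_ge0 E mulr_ge0 ?subr_ge0 ?mulr1 ?(ltW xy)//.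
  have [->|zn0] := eqVneq z 0; first by rewrite add0r.
  apply/ltW/winc; first exact: lt_trans xc.
  by rewrite ltrDr lt_neqAle eq_sym zn0.
move=> x y Bx xy; rewrite lt_neqAle mnd// andbT; apply/eqP => mxy.
have x0 : 0 < x by exact: le_lt_trans Bx.
have cst z : x < z -> z < y -> m z = m x.
  move=> xz zy; apply/le_anti; rewrite (mnd x z)// andbT mxy mnd//.
  exact: lt_trans xz.
have wz z : x < z -> z < y -> p * w z = th * m x.
  move=> xz zy; have := is_derive_constant_on (dm (lt_trans x0 xz)) xz zy cst.
  by move/eqP; rewrite subr_eq0 => /eqP <-; rewrite cst.
pose u := x + (y - x) / 3; pose v := x + (y - x) / 2.
have [xu uv vy] : [/\ x < u, u < v & v < y] by rewrite /u /v; split; lra.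
have := winc u v (lt_trans Bx xu) uv.
by rewrite -(ltr_pM2l p0) wz// ?wz ?ltxx// ?(lt_trans uv)// (lt_trans xu).
Qed.

Lemma minimizer_below B : 0 <= B -> (forall s, B < s -> exists y, [/\ 0 < y, y < s & w y < w s]) ->
  (exists b, 0 <= b /\ forall x, 0 <= x -> m b <= m x) /\
  (forall b, 0 <= b -> (forall x, 0 <= x -> m b <= m x) -> b <= B).
Proof.
move=> B0 H; have inc := increasing_of_rise B0 H.
split; last first.
  move=> b b0 Hb; rewrite leNgt; apply/negP => Bb.
  have := inc ((B + b) / 2) b; rewrite !midf_lt// => /(_ isT isT).
  by apply/negP; rewrite -leNgt Hb// divr_ge0// addr_ge0.
have B1 : 0 < B + 1 by rewrite ltr_wpDl.
have [c] := EVT_min (ltW B1) (cm B1).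
rewrite in_itv/= => /andP[c0 cB] Hc; exists c; split => // x x0.
have [xB|Bx] := leP x (B + 1); first by apply: Hc; rewrite in_itv/= x0.
apply: (@le_trans _ _ (m (B + 1))); last by apply/ltW/inc => //; rewrite ltrDl.
by apply: Hc; rewrite in_itv/= lexx ltW.
Qed.

(** Between the two minima m is constant, so th m - p w = 0 and w equals a
    constant k there; by convexity w >= k everywhere. Then n = m - m 0 satisfies
    n' <= th n, so that n e^(- th x) does not increase after b, where n = 0. As
    n >= 0, m is constant, and so is w. *)
Lemma constant_of_two_minima b : 0 < b -> (forall x, 0 <= x -> m 0 <= m x) -> m b = m 0 ->
  forall x y, 0 < x -> 0 < y -> w x = w y.
Proof.
move=> b0 Hm mb.
have cst z : 0 < z -> z < b -> m z = m 0.
  move=> z0 zb; apply/le_anti; rewrite Hm ?(ltW z0)// andbT.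
  have := m_between (lexx 0) (ltW z0) (ltW zb); rewrite mb !subr0.
  have -> : (b - z) * m 0 + z * m 0 = b * m 0 by ring.
  by rewrite ler_pM2l.
pose k := th * m 0 / p.
have kE a : th * m 0 - p * a = 0 -> a = k.
  move=> h; apply: (mulfI (lt0r_neq0 p0)).
  by rewrite /k mulrCA mulfV ?lt0r_neq0// mulr1; lra.
have wk z : 0 < z -> z < b -> w z = k.
  move=> z0 zb; have h := is_derive_constant_on (dm z0) z0 zb cst.
  by rewrite cst// in h; exact: kE.
have wge z : 0 < z -> k <= w z.
  move=> z0; have [zb|bz] := ltP z b; first by rewrite wk.
  have [u0 uv vb] : [/\ 0 < b / 3, b / 3 < b / 2 & b / 2 < b] by split; lra.
  have vz : b / 2 < z by exact: lt_le_trans bz.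
  have := convex_between wconv u0 (ltW uv) (ltW vz).
  rewrite (wk _ u0 (lt_trans uv vb)) (wk _ (lt_trans u0 uv) vb).
  have d : 0 < b / 2 - b / 3 by lra.
  move=> h; rewrite -subr_ge0 -(pmulr_rge0 _ d); lra.
have mz z : 0 < z -> m z = m 0.
  move=> z0; have [zb|bz] := ltP z b; first exact: cst.
  move: bz; rewrite le_eqVlt => /predU1P[<-//|bz].
  pose g x := (m x - m 0) * expR (- (th * x)).
  have dg x : 0 < x -> is_derive x 1 g (p * (k - w x) * expR (- (th * x))).
    move=> x0; have h1 := is_derive_sub (dm x0) (is_derive_const (m 0) x).
    have h2 := is_derive_exp_comp (is_derive_opp (is_derive_mulc th x)).
    apply: (is_derive_eq1 (is_derive_mul h1 h2)).
    have -> : k = th * m 0 / p by [].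
    field; exact: lt0r_neq0.
  have [c [bc cz E]] := MVT_pos b0 bz dg.
  have gz : g z <= 0.
    have gb : g b = 0 by rewrite /g mb subrr mul0r.
    move: E; rewrite gb subr0 => ->.
    rewrite mulr_le0_ge0 ?subr_ge0 ?(ltW bz)// mulr_le0_ge0 ?expR_ge0// pmulr_rle0// subr_le0.
    by apply: wge; exact: lt_trans bc.
  apply/le_anti; rewrite Hm ?(ltW z0)// andbT.
  by move: gz; rewrite /g pmulr_lle0 ?expR_gt0// subr_le0.
suff H z : 0 < z -> w z = k by move=> x y x0 y0; rewrite !H.
move=> z0; have z1 : z < z + 1 by rewrite ltrDl.
have h := is_derive_constant_on (dm z0) z0 z1 (fun y hy _ => mz y hy).
by rewrite mz// in h; exact: kE.
Qed.

Lemma descent_of_negative dl : 0 < dl -> (forall x, 0 < x -> x < dl -> th * m x - p * w x < 0) ->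
  exists2 x, 0 < x & m x < m 0.
Proof.
move=> dl0 H; pose x := dl / 2.
have x0 : 0 < x by rewrite divr_gt0.
exists x => //.
have [c [c0 cx E]] := MVT_derive x0 (fun y hy _ => dm hy) (cm x0).
rewrite -subr_lt0 E subr0 pmulr_llt0//; apply: H => //.
by apply: (lt_trans cx); rewrite ltr_pdivrMr// ltr_pMr// ltr1n.
Qed.

(** By convexity the mean slope of m over (0, h) is at most the one over
    (0, x1). *)
Lemma negative_slope_of_descent x1 : 0 < x1 -> m x1 < m 0 -> exists2 s, 0 < s &
  forall h, 0 < h -> exists c, [/\ 0 < c, c < h & th * m c - p * w c <= - s].
Proof.
move=> x10 mx1; exists ((m 0 - m x1) / x1); first by rewrite divr_gt0// subr_gt0.
move=> h h0; pose k := Num.min h x1.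
have k0 : 0 < k by rewrite lt_min h0.
have kx : k <= x1 by rewrite ge_min lexx orbT.
have [c [c0 ck E]] := MVT_derive k0 (fun y hy _ => dm hy) (cm k0).
exists c; split => //; first by rewrite (lt_le_trans ck)// ge_min lexx.
have := m_between (lexx 0) (ltW k0) kx; rewrite !subr0 in E * => h1.
rewrite -(ler_pM2r k0) -E -mulNr opprB mulrAC ler_pdivlMr//; lra.
Qed.

Hypothesis cm0 : m y @[y --> 0^'+] --> m 0.

(** The right derivative of m at 0 is th m(0) - p k. *)
Lemma descent_iff k : w y @[y --> 0^'+] --> k ->
  (exists2 x, 0 < x & m x < m 0) <-> th * m 0 < p * k.
Proof.
move=> wk.
have lim : th * m y - p * w y @[y --> 0^'+] --> th * m 0 - p * k.
  by apply: cvgB; (apply: cvgM; first exact: cvg_cst).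
split=> [[x1 x10 mx1]|neg].
  have [s s0 Hs] := negative_slope_of_descent x10 mx1.
  rewrite ltNge; apply/negP => pos.
  have : \forall y \near 0^'+, - s < th * m y - p * w y.
    by apply: (cvgr_gt _ lim); lra.
  rewrite near_withinE => /nbhs_ballP[e /= e0 He].
  have [c [c0 ce Hc]] := Hs e e0.
  have := He c; rewrite /ball/= sub0r normrN gtr0_norm// => /(_ ce c0).
  by rewrite ltNge Hc.
have : \forall y \near 0^'+, th * m y - p * w y < 0.
  by apply: (cvgr_lt _ lim); rewrite subr_lt0.
rewrite near_withinE => /nbhs_ballP[e /= e0 He].
apply: (descent_of_negative e0) => x x0 xe.
by apply: He => //; rewrite /ball/= sub0r normrN gtr0_norm.
Qed.

(** The right derivative of m at 0 is - oo. *)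
Lemma descent_of_unbounded : (forall M : R, \forall y \near (0 : R)^'+, M <= w y) ->
  exists2 x, 0 < x & m x < m 0.
Proof.
move=> unb.
have h1 : \forall y \near 0^'+, th * m y < th * m 0 + 1.
  apply: (cvgr_lt (th * m 0)); last by rewrite ltrDl.
  by apply: cvgM => //; exact: cvg_cst.
have : \forall y \near 0^'+, th * m y - p * w y < 0.
  near=> y; rewrite subr_lt0.
  apply: (@lt_le_trans _ _ (th * m 0 + 1)); first by near: y.
  have : (th * m 0 + 1) / p <= w y by near: y; exact: unb.
  by rewrite ler_pdivrMr// [w y * p]mulrC.
rewrite near_withinE => /nbhs_ballP[e /= e0 He].
apply: (descent_of_negative e0) => x x0 xe.
by apply: He => //; rewrite /ball/= sub0r normrN gtr0_norm.
Unshelve. all: by end_near. Qed.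
End minimizer_comparison.

Section last_minimizer_theory.
Context {R : realType}.
Implicit Types (f g : R -> \bar R) (b s : R).

Lemma last_minimizer_some f : minimizers f !=set0 ->
  last_minimizer f = ereal_sup (EFin @` minimizers f).
Proof. by move=> ne; rewrite /last_minimizer; destruct (pselect _). Qed.

Lemma last_minimizer_none f : ~ (minimizers f !=set0) -> last_minimizer f = +oo%E.
Proof. by move=> ne; rewrite /last_minimizer; destruct (pselect _). Qed.

Lemma last_minimizer_ge0 f : (0 <= last_minimizer f)%E.
Proof.
have [ne|ne] := pselect (minimizers f !=set0); last by rewrite last_minimizer_none// leey.
rewrite last_minimizer_some//; case: (ne) => b Mb.
apply: (@le_trans _ _ b%:E); first by case: Mb.
by apply: ereal_sup_ubound; exists b.
Qed.

Lemma last_minimizer_gt0 f : (0 < last_minimizer f)%E <->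
  (minimizers f !=set0 -> exists2 b, 0 < b & minimizers f b).
Proof.
have [ne|ne] := pselect (minimizers f !=set0); last first.
  by rewrite last_minimizer_none//; split => // _ /ne.
rewrite last_minimizer_some//.
split=> [/ereal_sup_gt[_ [b Mb <-]] b0 _|/(_ ne)[b b0 Mb]]; first by exists b.
apply: (@lt_le_trans _ _ b%:E); first by rewrite lte_fin.
by apply: ereal_sup_ubound; exists b.
Qed.

(** It suffices to compare with an upper bound B of the minimizers of f, and
    when there is none the right-hand side is +oo. *)
Lemma last_minimizer_le f g :
  (forall B, 0 <= B -> minimizers f !=set0 ->
     (forall s, B < s -> exists b, [/\ minimizers f b, b < s & ~ minimizers f s]) ->
     minimizers g !=set0 /\ (forall b, minimizers g b -> b <= B)) ->
  (last_minimizer g <= last_minimizer f)%E.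
Proof.
move=> H; have [ne|ne] := pselect (minimizers f !=set0); last first.
  by rewrite (last_minimizer_none ne) leey.
rewrite (last_minimizer_some ne).
have [ub|nub] := pselect (has_ubound (minimizers f)); last by rewrite hasNub_ereal_sup// leey.
have hs : has_sup (minimizers f) by [].
pose B := sup (minimizers f).
have B0 : 0 <= B by case: (ne) => b Mb; apply: le_trans (ub_le_sup ub Mb); case: Mb.
have [ng gB] : minimizers g !=set0 /\ (forall b, minimizers g b -> b <= B).
  apply: H => // s Bs; case: (ne) => b Mb; exists b; split => //.
    exact: le_lt_trans (ub_le_sup ub Mb) Bs.
  by move=> Ms; have := ub_le_sup ub Ms; rewrite leNgt Bs.
rewrite ereal_sup_EFin// last_minimizer_some//.
by apply: ge_ereal_sup => _ [b Mb <-]; rewrite lee_fin; exact: gB.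
Qed.
End last_minimizer_theory.

Section scale_minimizers.
Context {R : realType} (W w : R -> R).
Hypothesis dW : forall x : R, 0 < x -> is_derive x 1 W (w x).
Hypothesis w0 : forall x, 0 < x -> 0 <= w x.
Hypothesis wconv : forall x a b, 0 < x -> 0 <= a -> 0 <= b ->
  (a + b) * w (x + a) <= b * w x + a * w (x + a + b).

(** A value smaller than w s is attained at b; for b = 0 this value is a limit
    at 0+, hence w takes values smaller than w s near 0. *)
Lemma scale_deriv_rise b s : minimizers (scale_deriv W) b -> b < s ->
  ~ minimizers (scale_deriv W) s -> exists y, [/\ 0 < y, y < s & w y < w s].
Proof.
move=> [b0 Hb] bs nMs; have s0 : 0 < s by exact: le_lt_trans bs.
have dpos x : 0 < x -> scale_deriv W x = (w x)%:E.
  by move=> x0; rewrite /scale_deriv x0 (is_derive_derive1 (dW x0)).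
have [x [x0 fx]] : exists x, 0 <= x /\ (scale_deriv W x < scale_deriv W s)%E.
  apply: contrapT => h; apply: nMs; split; first exact: ltW.
  by move=> x x0; rewrite leNgt; apply/negP => fx; apply: h; exists x.
have {x x0 fx} := le_lt_trans (Hb x x0) fx; rewrite (dpos s)//.
move: b0; rewrite le_eqVlt => /predU1P[b0|b0]; last first.
  by rewrite dpos// lte_fin => h; exists b.
rewrite -b0 {1}/scale_deriv ltxx.
have E (l : \bar R) : (w y)%:E @[y --> 0^'+] --> l -> lim ((derive1 W y)%:E @[y --> 0^'+]) = l.
  move=> h; apply: cvg_lim => //; apply: cvg_trans h; apply: near_eq_cvg.
  near=> y; have y0 : 0 < y by [].
  by rewrite (is_derive_derive1 (dW y0)).
have [[k wk]|unb] := convex_right_limit w0 wconv.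
  have wke : (w y)%:E @[y --> 0^'+] --> k%:E by apply/fine_cvgP; split => //; near=> y.
  rewrite (E _ wke) lte_fin => ks.
  have h : \forall y \near 0^'+, w y < w s by exact: (cvgr_lt _ wk).
  have : \forall y \near 0^'+, [/\ 0 < y, y < s & w y < w s].
    by near=> y; split => //; near: y => //; exact: nbhs_right_lt.
  by move/filter_ex => [y ?]; exists y.
have wy : (w y)%:E @[y --> 0^'+] --> +oo%E.
  by apply/cvgeyPge => A; near=> y; rewrite lee_fin; near: y; exact: unb.
by rewrite (E _ wy).
Unshelve. all: by end_near. Qed.
End scale_minimizers.

Section poisson_barrier.
Context {R : realType} (psi W : R -> R) (q p : R).
Local Notation th := (right_inverse psi (p + q)).
Hypotheses (th0 : 0 < th) (p0 : 0 < p) (psi_th : psi th - q = p).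
Hypothesis IW : exp_integrable th W.
Hypothesis LW : p * laplace_transform W th = 1.
Hypothesis cW : {within `[0, +oo[%classic, continuous W}.
Hypothesis W0 : forall x, 0 <= x -> 0 <= W x.
Hypothesis Wconv : forall x a b c, 0 <= x -> 0 <= a -> 0 <= b -> 0 <= c ->
  (a + b) * (W (x + a + c) - W (x + a)) <=
  b * (W (x + c) - W x) + a * (W (x + a + b + c) - W (x + a + b)).
Variable w : R -> R.
Hypothesis dW : forall x : R, 0 < x -> is_derive x 1 W (w x).
Hypothesis w0 : forall x, 0 < x -> 0 <= w x.
Hypothesis wconv : forall x a b, 0 < x -> 0 <= a -> 0 <= b ->
  (a + b) * w (x + a) <= b * w x + a * w (x + a + b).
Local Notation m := (scale_density psi W q p th).
Implicit Types (x y b : R).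

Let dm x (x0 : 0 < x) : is_derive x 1 m (th * m x - p * w x) :=
  is_derive_scale_density psi_th IW dW x0.
Let cm B (B0 : 0 < B) : {within `[0, B], continuous m} :=
  scale_density_continuous psi_th IW cW dW B0.
Let mconv := scale_density_convex th0 p0 psi_th IW LW cW W0 dW Wconv.
Let m_le := scale_density_le th0 p0 psi_th IW LW cW W0 dW.

Lemma Z_derivE x : 0 <= x -> Z_deriv psi q p W x = m x.
Proof.
rewrite /Z_deriv le_eqVlt => /predU1P[<-|x0].
  rewrite ltxx (scale_density0 W psi_th).
  by rewrite (cvg_lim _ (scale_cvg0 cW)).
by rewrite x0 (is_derive_derive1 (is_derive_Zfun psi_th IW dW x0)).
Qed.

Lemma minimizers_poisson b : minimizers (fun x => (Z_deriv psi q p W x)%:E) b <->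
  0 <= b /\ forall x, 0 <= x -> m b <= m x.
Proof.
split=> -[b0 H]; (split; first exact: b0) => x x0; move: (H x x0).
  by rewrite (Z_derivE b0) (Z_derivE x0) lee_fin.
by rewrite (Z_derivE b0) (Z_derivE x0) lee_fin.
Qed.

Lemma b_poisson_le_b_infty : (b_poisson psi q p W <= b_infty W)%E.
Proof.
apply: last_minimizer_le => B B0 _ HB.
have rise s : B < s -> exists y, [/\ 0 < y, y < s & w y < w s].
  move=> /HB[b [Mb bs nMs]]; exact: (scale_deriv_rise dW w0 wconv Mb bs nMs).
have [[b hb] H] := minimizer_below p0 dW dm wconv cm m_le B0 rise.
split; first by exists b; apply/minimizers_poisson.
by move=> a /minimizers_poisson[a0 Ha]; exact: H.
Qed.

(** A positive minimizer b in the absence of descent would satisfy m b = m 0,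
    which [constant_of_two_minima] excludes. *)
Lemma b_poisson_gt0 : nonconstant_scale_deriv W ->
  (0 < b_poisson psi q p W)%E <-> exists2 x, 0 < x & m x < m 0.
Proof.
move=> [a1 [a2 [a10 a20 wne]]]; apply: (iff_trans (last_minimizer_gt0 _)).
have wne' : w a1 <> w a2.
  by rewrite -(is_derive_derive1 (dW a10)) -(is_derive_derive1 (dW a20)).
split=> [H|[x x0 mx] [b Mb]]; last first.
  exists b => //; have [b0 Hb] := (minimizers_poisson b).1 Mb.
  rewrite lt_neqAle b0 andbT; apply/eqP => b00; subst b.
  by have := Hb x (ltW x0); rewrite leNgt mx.
apply: contrapT => nex.
have H0 x : 0 <= x -> m 0 <= m x.
  rewrite le_eqVlt => /predU1P[<-//|x0]; rewrite leNgt; apply/negP => mx; apply: nex.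
  by exists x.
have [|b b0 Mb] := H; first by exists 0; apply/minimizers_poisson.
have [_ Hb] := (minimizers_poisson b).1 Mb.
apply: wne'; apply: (constant_of_two_minima p0 dm wconv mconv b0 H0) => //.
by apply/le_anti; rewrite Hb// H0// ltW.
Qed.
End poisson_barrier.

(** * The scale function near the origin *)

Section half_line_continuity.
Context {R : realType} (f : R -> R).

Lemma continuous_half_line_eps : {within `[0, +oo[%classic, continuous f} ->
  forall x, 0 <= x -> forall e, 0 < e ->
  exists2 dl, 0 < dl & forall y, 0 <= y -> `|y - x| < dl -> `|f y - f x| <= e.
Proof.
move=> /subspace_continuousP cf x x0 e e0.
have xD : (`[0, +oo[%classic : set R) x by rewrite /= in_itv/= x0.
have := cf x xD => /cvgrPdist_le/(_ e e0).
rewrite near_withinE => /nbhs_ballP[dl /= dl0 H]; exists dl => // y y0 yx.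
rewrite distrC; apply: H; first by rewrite /ball/= distrC.
by rewrite /= in_itv/= y0.
Qed.

Lemma cvg_at_right_eps (l : R) : f y @[y --> 0^'+] --> l -> forall e, 0 < e ->
  exists2 dl, 0 < dl & forall y, 0 < y -> y < dl -> `|f y - l| <= e.
Proof.
move=> /cvgrPdist_le fl e /fl; rewrite near_withinE => /nbhs_ballP[dl /= dl0 H].
exists dl => // y y0 yd; rewrite distrC; apply: H => //.
by rewrite /ball/= sub0r normrN gtr0_norm.
Qed.
End half_line_continuity.

Lemma cvg_invn {R : realType} : (fun n : nat => n%:R^-1 : R) @ \oo --> (0 : R).
Proof. by rewrite -(cvg_shiftS (fun n : nat => n%:R^-1 : R)); exact: cvg_harmonic. Qed.

Section origin_limits.
Context {R : realType} (psi W w : R -> R) (q th : R).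
Local Notation mu := (@lebesgue_measure R).
Local Notation D0 := (`[0%R, +oo[%classic : set R).
Hypotheses (th0 : 0 < th) (IW : exp_integrable th W).
Hypothesis cW : {within `[0, +oo[%classic, continuous W}.
Hypothesis LW : forall s, th <= s -> (psi s - q) * laplace_transform W s = 1.
Hypothesis psi_gt : forall s, th <= s -> q < psi s.
Hypothesis Wmono : forall x c, 0 <= x -> 0 <= c -> W x <= W (x + c).
Hypothesis dW : forall x : R, 0 < x -> is_derive x 1 W (w x).
Implicit Types (x y M : R).

Let contW := continuous_half_line_eps cW.

Let cvg_zero (k : nat) : (fun n : nat => k%:R / n%:R : R) @ \oo --> (0 : R).
Proof.
rewrite -[X in _ --> X](mulr0 k%:R); apply: cvgM; first exact: cvg_cst.
exact: cvg_invn.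
Qed.

Let LE s : th <= s -> laplace_transform W s = (psi s - q)^-1.
Proof.
move=> ts; have h : psi s - q != 0 by rewrite gt_eqF// subr_gt0 psi_gt.
by apply: (mulfI h); rewrite LW// mulfV.
Qed.

(** The Erlang average of W of order 0 and rate n. *)
Lemma cvg_scale_origin : n%:R / (psi n%:R - q) @[n --> \oo] --> W 0.
Proof.
have h := erlang_approx th0 (lexx 0) IW (contW (lexx 0)) (cvg_zero 0).
apply: cvg_trans h; apply: near_eq_cvg; near=> n.
have hn : th <= n%:R by near: n; exact: nbhs_infty_ger.
rewrite -LE// /laplace_transform -RintegralZl//; last exact: (exp_integrable_mono hn IW).
apply: eq_Rintegral => y _.
by rewrite /erlang_pdf expr0 fact0 divr1 mulr1 mulrA.
Unshelve. all: by end_near. Qed.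

(** The average of (W y - W 0) / y under the Erlang law of order 1 and
    rate n. *)
Definition origin_slope (n : nat) : R := n%:R ^+ 2 / (psi n%:R - q) - W 0 * n%:R.

Let IWn n : th <= n%:R -> exp_integrable n%:R (fun y => W y - W 0).
Proof.
move=> hn; apply: exp_integrableD; first exact: exp_integrable_mono IW.
by apply: exp_integrableN; apply: exp_integrable_const; exact: lt_le_trans hn.
Qed.

Lemma origin_slopeE n : th <= n%:R -> origin_slope n =
  \int[mu]_(y in D0) (n%:R ^+ 2 * (expR (- (n%:R * y)) * (W y - W 0))).
Proof.
move=> hn; have n0 : 0 < n%:R :> R by exact: lt_le_trans hn.
rewrite RintegralZl//; last exact: IWn.
have -> : \int[mu]_(y in D0) (expR (- (n%:R * y)) * (W y - W 0)) =
   \int[mu]_(y in D0) (expR (- (n%:R * y)) * W y - W 0 * expR (- (n%:R * y))).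
  by apply: eq_Rintegral => y _; rewrite mulrBr [W 0 * _]mulrC.
have I1 : mu.-integrable D0 (EFin \o (fun y => expR (- (n%:R * y)))).
  have := exp_integrable_const 1 n0; apply: eq_integrable => // y _ /=.
  by rewrite mulr1.
rewrite RintegralB//; last 2 first.
- exact: (exp_integrable_mono hn IW).
- by apply: integrable_mulc => //; exact: measurable_itv.
rewrite RintegralZl// Rintegral_expRN// -/(laplace_transform W n%:R) LE//.
by rewrite /origin_slope; field; rewrite gt_eqF// gt_eqF// subr_gt0 psi_gt.
Qed.

Let pdfE (n : nat) y a : n%:R ^+ 2 * (expR (- (n%:R * y)) * (y * a)) = erlang_pdf n%:R 1 y * a.
Proof. by rewrite /erlang_pdf expr1 (_ : 1`!%:R = 1)// divr1; ring. Qed.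

(** [erlang_approx] for the difference quotient of W at 0, extended by k
    at 0. *)
Lemma cvg_origin_slope (k : R) : w y @[y --> 0^'+] --> k -> origin_slope n @[n --> \oo] --> k.
Proof.
move=> wk; pose f y := if y == 0 then k else (W y - W 0) / y.
have f0 : f 0 = k by rewrite /f eqxx.
have fE y : 0 < y -> f y = (W y - W 0) / y by move=> y0; rewrite /f gt_eqF.
have mvt y : 0 < y -> exists c, [/\ 0 < c, c < y & f y = w c].
  move=> y0; have [|c [c0 cy E]] := @MVT_derive R W w 0 y y0 (fun z z0 _ => dW z0).
    apply: continuous_subspaceW cW.
    by apply: subset_itv => //; rewrite bnd_simp.
  by exists c; split => //; rewrite fE// E subr0 mulfK// gt_eqF.
have near0 e : 0 < e -> exists2 dl, 0 < dl & forall y, 0 <= y -> `|y - 0| < dl -> `|f y - f 0| <= e.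
  move=> e0; have [dl dl0 H] := cvg_at_right_eps wk e0; exists dl => // y y0.
  rewrite subr0 ger0_norm// => yd.
  move: y0; rewrite le_eqVlt => /predU1P[<-|y0]; first by rewrite subrr normr0 ltW.
  have [c [c0 cy ->]] := mvt y y0; rewrite f0; apply: H => //; exact: lt_trans yd.
have cf : {within `[0, +oo[%classic, continuous f}.
  apply/continuous_within_itvcyP; split.
    move=> y; rewrite ?in_itv/= ?andbT => y0.
    have : {for y, continuous (fun y => (W y - W 0) / y)}.
      apply: cvgM; first by apply: cvgB; [exact: (is_derive_continuous (dW y0))|exact: cvg_cst].
      by apply: cvgV; [rewrite gt_eqF|].
    move=> h; rewrite /continuous_at (fE _ y0); apply: cvg_trans h.
    apply: near_eq_cvg; near=> z; have z0 : 0 < z by near: z; exact: lt_nbhsr.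
    by rewrite fE.
  apply/cvgrPdist_le => e /near0[dl dl0 H]; near=> y.
  rewrite distrC; apply: H => //.
  rewrite subr0 gtr0_norm//; near: y; exact: nbhs_right_lt.
have [dl dl0 H1] := near0 1 ltr01.
have If : exp_integrable th f.
  have h1 := integrable_norm IW; have h2 := integrable_norm (exp_integrable_const (`|W 0| / dl + `|k| + 1) th0).
  have mD0 : measurable (D0 : set (measurableTypeR R)) by exact: measurable_itv.
  have := integrable_add mD0 (integrable_mulc mD0 dl^-1 h1) h2.
  apply: (@le_integrable _ _ _ mu D0) => //.
    apply/measurable_EFinP; apply: measurable_funM.
      by apply: continuous_measurable => //; exact: continuous_expRN_mulc.
    exact: subspace_continuous_measurable_fun.
  move=> y; rewrite /= in_itv/= andbT => y0; rewrite lee_fin.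
  rewrite [leRHS]ger0_norm; last first.
    by rewrite addr_ge0// mulr_ge0// invr_ge0 ltW.
  rewrite !normrM (ger0_norm (expR_ge0 _)) mulrCA -mulrDr ler_wpM2l ?expR_ge0//.
  rewrite [X in _ + X]ger0_norm; last by rewrite !addr_ge0// divr_ge0// ltW.
  have [yd|dy] := ltP y dl.
    have yd' : `|y - 0| < dl by rewrite subr0 ger0_norm.
    have h := H1 y y0 yd'; rewrite f0 in h.
    have := ler_normD (f y - k) k; rewrite subrK => h3.
    have h4 : 0 <= dl^-1 * `|W y| by rewrite mulr_ge0// invr_ge0 ltW.
    have h5 : 0 <= `|W 0| / dl by rewrite divr_ge0// ltW.
    lra.
  have yy : 0 < y by exact: lt_le_trans dy.
  rewrite fE// normrM normfV (gtr0_norm yy).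
  apply: (@le_trans _ _ ((`|W y| + `|W 0|) * dl^-1)).
    by apply: ler_pM => //; rewrite ?invr_ge0 ?(ltW yy)// ?ler_normB// lef_pV2.
  have := normr_ge0 k; lra.
have hf : forall e, 0 < e -> exists2 dl, 0 < dl & forall y, 0 <= y -> `|y - 0| < dl -> `|f y - f 0| <= e by exact: near0.
have h := erlang_approx th0 (lexx 0) If hf (cvg_zero 1).
rewrite f0 in h; apply: cvg_trans h; apply: near_eq_cvg; near=> n.
have hn : th <= n%:R by near: n; exact: nbhs_infty_ger.
rewrite origin_slopeE//; apply: eq_Rintegral => y; rewrite inE/= in_itv/= andbT => y0.
rewrite -pdfE; congr (_ * (_ * _)).
move: y0; rewrite le_eqVlt => /predU1P[<-|y0]; first by rewrite subrr mul0r.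
by rewrite fE// mulrCA mulfV ?mulr1// gt_eqF.
Unshelve. all: by end_near. Qed.

(** Near 0 the increment W y - W 0 is at least M y, and W is nondecreasing, so
    it dominates M min(y, e), to which [erlang_approx] applies. *)
Lemma origin_slope_unbounded : (forall M : R, \forall y \near (0 : R)^'+, M <= w y) ->
  forall M, \forall n \near \oo, M <= origin_slope n.
Proof.
move=> unb M0; pose M := Num.max 0 M0 + 1.
have MM : M0 < M by rewrite ltr_pwDr// le_max lexx orbT.
have Mp : 0 <= M by rewrite addr_ge0// le_max lexx.
have := unb M; rewrite near_withinE => /nbhs_ballP[dl /= dl0 H].
have {}H y : 0 < y -> y < dl -> M <= w y.
  by move=> y0 yd; apply: H => //; rewrite /ball/= sub0r normrN gtr0_norm.
pose e := dl / 2; have e0 : 0 < e by rewrite divr_gt0.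
have ed : e < dl by rewrite /e; lra.
have rise y : 0 <= y -> y <= e -> M * y <= W y - W 0.
  rewrite le_eqVlt => /predU1P[<-|y0] ye; first by rewrite mulr0 subrr.
  have [|c [c0 cy E]] := @MVT_derive R W w 0 y y0 (fun z z0 _ => dW z0).
    apply: continuous_subspaceW cW.
    by apply: subset_itv => //; rewrite bnd_simp.
  rewrite E subr0 ler_pM2r//; apply: H => //.
  exact: (lt_le_trans cy (le_trans ye (ltW ed))).
(* So that y f y = M min(y, e). *)
pose f y : R := M * (e / Num.max y e).
have mx y : 0 < Num.max y e by rewrite lt_max e0 orbT.
have cf : continuous f.
  move=> y; apply: cvgM; first exact: cvg_cst.
  apply: cvgM; first exact: cvg_cst.
  apply: cvgV; first by rewrite gt_eqF.
  have cm : {for y, continuous ((id : R -> R) \max cst e)}.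
    by apply: (@continuous_max R R); [exact: cvg_id|exact: cvg_cst].
  exact: cm.
have fs y : y <= e -> f y = M by move=> ye; rewrite /f (max_idPr ye) mulfV ?mulr1// gt_eqF.
have fb y : 0 <= f y <= M.
  have d0 : 0 <= e / Num.max y e by rewrite divr_ge0// ltW.
  rewrite mulr_ge0//= ler_piMr// ler_pdivrMr// mul1r.
  by rewrite le_max lexx orbT.
have If : exp_integrable th f.
  have := exp_integrable_const M th0.
  apply: (@le_integrable _ _ _ mu D0) => //.
    apply/measurable_EFinP; apply: measurable_funM.
      by apply: continuous_measurable => //; exact: continuous_expRN_mulc.
    exact: continuous_measurable.
  move=> y _; rewrite /= lee_fin normrM [leRHS]normrM ler_wpM2l//.
  have /andP[h1 h2] := fb y.
  by rewrite (ger0_norm h1) ger0_norm.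
have hf : forall e, 0 < e -> exists2 dl, 0 < dl & forall y, 0 <= y -> `|y - 0| < dl -> `|f y - f 0| <= e.
  move=> a a0; exists e => // y y0; rewrite subr0 ger0_norm// => ye.
  by rewrite !fs ?(ltW e0) ?(ltW ye)// subrr normr0 ltW.
have h := erlang_approx th0 (lexx 0) If hf (cvg_zero 1).
rewrite (fs _ (ltW e0)) in h.
have hM : \forall n \near \oo, M0 < \int[mu]_(y in D0) (erlang_pdf n%:R 1 y * f y).
  exact: (cvgr_gt _ h).
near=> n; have hn : th < n%:R by near: n; exact: nbhs_infty_gtr.
apply: (@le_trans _ _ (\int[mu]_(y in D0) (erlang_pdf n%:R 1 y * f y))).
  by apply/ltW; near: n.
rewrite origin_slopeE ?(ltW hn)//; apply: le_Rintegral => //.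
- exact: (integrable_erlang_pdf_mul 1 (ltW th0) hn If).
- apply: integrable_mulc; [exact: measurable_itv|exact: (IWn (ltW hn))].
move=> y; rewrite /= in_itv/= andbT => y0.
rewrite -pdfE ler_wpM2l ?sqr_ge0// ler_wpM2l ?expR_ge0//.
have [ye|ey] := leP y e; first by rewrite fs// mulrC rise.
rewrite /f (max_idPl (ltW ey)).
have -> : y * (M * (e / y)) = M * e by field; rewrite gt_eqF// (lt_trans e0).
apply: (le_trans (rise e (ltW e0) (lexx e))).
rewrite lerD2r -(subrKC e y); apply: Wmono; rewrite ?subr_ge0 ltW//.
Unshelve. all: by end_near. Qed.
End origin_limits.

(** * The Laplace exponent at infinity *)

Section exponent_asymptotics.
Context {R : realType} (nu : {measure set R -> \bar R}) (hnu : levy_measure nu).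
Variables (gamma sigma : R).
Local Notation D := (`]0%R, +oo[%classic : set R).
Local Notation psi := (laplace_exponent gamma sigma nu).
Implicit Types (x z th e : R).

Let mD : measurable (D : set (measurableTypeR R)). Proof. exact: measurable_itv. Qed.

Lemma Rintegral_dominated_cvg (f : nat -> R -> R) (g h : R -> R) :
  (forall n, nu.-integrable D (EFin \o f n)) -> nu.-integrable D (EFin \o g) ->
  nu.-integrable D (EFin \o h) ->
  (forall z, 0 < z -> f n z @[n --> \oo] --> g z) ->
  (forall n z, 0 < z -> `|f n z| <= h z) ->
  \int[nu]_(z in D) f n z @[n --> \oo] --> \int[nu]_(z in D) g z.
Proof.
move=> If Ig Ih cf bf.
have := @dominated_cvg _ _ _ nu D mD (fun n => EFin \o f n) (EFin \o g) (EFin \o h)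
  (fun n => measurable_int nu (If n)).
have dpos z : D z -> 0 < z by rewrite /= in_itv/= andbT.
have c1 x : D x -> (EFin \o f n) x @[n --> \oo] --> (EFin \o g) x.
  move=> /dpos x0; apply/fine_cvgP; split; first by near=> n.
  exact: cf.
have b1 (n : nat) x : D x -> (`|(EFin \o f n) x| <= (EFin \o h) x)%E.
  by move=> /dpos x0; rewrite /= lee_fin bf.
move=> /(_ c1 _ Ih b1) H.
have {}H := H (fun _ _ => isT).
have fing : (\int[nu]_(x in D) (EFin \o g) x)%E = (\int[nu]_(z in D) g z)%:E.
  by rewrite /Rintegral fineK//; exact: integrable_fin_num.
rewrite fing in H.
by have [_] := (fine_cvgP _ _).1 H.
Unshelve. all: by end_near. Qed.

(** Dominated convergence: the kernel is at most n z + 1 for fixed z, and at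
    most n^2 min(1, z^2). *)
Lemma cvg_levy_kernel_sqr :
  (\int[nu]_(z in D) levy_kernel n%:R z) / n%:R ^+ 2 @[n --> \oo] --> (0 : R).
Proof.
have E : (fun n : nat => (\int[nu]_(z in D) levy_kernel n%:R z) / n%:R ^+ 2) =
  (fun n : nat => \int[nu]_(z in D) (n%:R ^- 2 * levy_kernel n%:R z)).
  apply/funext => n; rewrite RintegralZl// 1?mulrC//; exact: integrable_levy_kernel.
rewrite E.
have lim z : 0 < z -> n%:R ^- 2 * levy_kernel n%:R z @[n --> \oo] --> (cst 0 : R -> R) z.
  move=> z0; have h : n%:R^-1 * (z + n%:R^-1) @[n --> \oo] --> (0 : R).
    rewrite -[X in _ --> X](mul0r (z + 0)); apply: cvgM; first exact: cvg_invn.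
    by apply: cvgD; [exact: cvg_cst|exact: cvg_invn].
  have h' : - (n%:R^-1 * (z + n%:R^-1)) @[n --> \oo] --> (0 : R).
    by rewrite -[X in _ --> X]oppr0; exact: cvgN.
  apply: (squeeze_cvgr _ h' h); near=> n; rewrite -ler_norml.
  have n0 : 0 < n%:R :> R by rewrite ltr0n; near: n; exact: nbhs_infty_gt.
  rewrite normrM ger0_norm ?invr_ge0 ?sqr_ge0//.
  have -> : n%:R^-1 * (z + n%:R^-1) = n%:R ^- 2 * (n%:R * z + 1) by field; rewrite gt_eqF.
  rewrite ler_wpM2l ?invr_ge0 ?sqr_ge0//.
  have nz : 0 <= n%:R * z by rewrite mulr_ge0 ?ltW.
  have e0 := expR_ge0 (- (n%:R * z)); have e1 := expRN_le1 nz.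
  have [z1|z1] := leP z 1.
    have /andP[h1 h2] := expRN_taylor2 nz.
    by rewrite levy_kernel_small// ger0_norm//; lra.
  by rewrite levy_kernel_large// ler_norml; apply/andP; split; lra.
have bnd (n : nat) z : 0 < z -> `|n%:R ^- 2 * levy_kernel n%:R z| <= min1sq z.
  move=> z0; case: n => [|n].
    by rewrite expr0n/= invr0 mul0r normr0 min1sq_ge0.
  have n1 : 1 <= n.+1%:R :> R by rewrite ler1n.
  have n0 : 0 < n.+1%:R :> R by rewrite ltr0n.
  rewrite normrM ger0_norm ?invr_ge0 ?sqr_ge0//.
  have n2 : 0 < n.+1%:R ^+ 2 :> R by rewrite exprn_gt0.
  rewrite ler_pdivrMl//.
  have nz : 0 <= n.+1%:R * z by rewrite mulr_ge0 ?ltW.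
  have [z1|z1] := leP z 1.
    have /andP[h1 h2] := expRN_taylor2 nz.
    by rewrite levy_kernel_small// ger0_norm// min1sq_small ?(ltW z0)// -exprMn.
  have e0 := expR_ge0 (- (n.+1%:R * z)); have e1 := expRN_le1 nz.
  rewrite levy_kernel_large// (min1sq_large (ltW z1)) mulr1.
  apply: (@le_trans _ _ 1); last by rewrite exprn_ege1.
  by rewrite ler_norml; apply/andP; split; lra.
have I1 (n : nat) : nu.-integrable D (EFin \o (fun z => n%:R ^- 2 * levy_kernel n%:R z)).
  by apply: integrable_mulc => //; exact: integrable_levy_kernel.
have I0 : nu.-integrable D (EFin \o (cst 0 : R -> R)) by exact: integrable0.
have := Rintegral_dominated_cvg I1 I0 (integrable_min1sq hnu) lim bnd.
have -> // : \int[nu]_(z in D) (cst 0 : R -> R) z = 0.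
by rewrite /Rintegral integral0_eq.
Unshelve. all: by end_near. Qed.

Lemma cvg_psi_sqr : psi n%:R / n%:R ^+ 2 @[n --> \oo] --> 2^-1 * sigma ^+ 2.
Proof.
have h : gamma * n%:R^-1 + 2^-1 * sigma ^+ 2 +
   (\int[nu]_(z in D) levy_kernel n%:R z) / n%:R ^+ 2 @[n --> \oo] --> gamma * 0 + 2^-1 * sigma ^+ 2 + 0.
  apply: cvgD; last exact: cvg_levy_kernel_sqr.
  apply: cvgD; last exact: cvg_cst.
  by apply: cvgM; [exact: cvg_cst|exact: cvg_invn].
rewrite mulr0 add0r addr0 in h; apply: cvg_trans h; apply: near_eq_cvg; near=> n.
have n0 : 0 < n%:R :> R by rewrite ltr0n; near: n; exact: nbhs_infty_gt.
by rewrite laplace_exponentE; field; rewrite gt_eqF.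
Unshelve. all: by end_near. Qed.

Section infinite_activity.
Hypothesis sigma0 : sigma = 0.

(** Without Gaussian part, drift and compensator cancel in the difference,
    which is the integral of (1 - e^(- n z)) / n - (1 - e^(- N z)) / N. This is
    nonnegative, and bounded below on z > e. *)
Lemma psi_ratio_gap (n N : nat) e : (0 < n)%N -> (n <= N)%N -> 0 < e ->
  tail nu e * ((1 - expR (- (n%:R * e))) / n%:R - N%:R^-1) <= psi N%:R / N%:R - psi n%:R / n%:R.
Proof.
move=> n0 nN e0; have N0 : (0 < N)%N by exact: leq_trans nN.
have n0R : 0 < n%:R :> R by rewrite ltr0n.
have N0R : 0 < N%:R :> R by rewrite ltr0n.
have IN := integrable_levy_kernel hnu (ltW N0R).
have In := integrable_levy_kernel hnu (ltW n0R).
pose c := (1 - expR (- (n%:R * e))) / n%:R - N%:R^-1.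
have De : (`]e, +oo[%classic : set R) `<=` D.
  by move=> z; rewrite /= !in_itv/= !andbT; exact: lt_trans.
have I1 : nu.-integrable D (EFin \o (\1_`]e, +oo[%classic : R -> R)).
  apply: (levy_integrable hnu (C := (min1sq e)^-1)); first exact: measurable_indic.
  move=> z z0; have m0 : 0 < min1sq e by rewrite lt_min ltr01 exprn_gt0.
  rewrite indicE; have [/set_mem|_] := boolP (z \in _); last first.
    by rewrite normr0 mulr_ge0 ?invr_ge0 ?(ltW m0)// min1sq_ge0.
  rewrite /= in_itv/= andbT => ez; rewrite normr1 mulrC ler_pdivlMr// mul1r.
  rewrite /min1sq le_min !ge_min lexx/=; apply/orP; right.
  by rewrite ler_pXn2r ?nnegrE ?(ltW e0) ?(ltW z0)// ltW.
have IIc : nu.-integrable D (EFin \o (fun z => c * \1_`]e, +oo[%classic z)) by exact: integrable_mulc.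
have cE : tail nu e * c = \int[nu]_(z in D) (c * \1_`]e, +oo[%classic z).
  rewrite RintegralZl//.
  rewrite mulrC /tail /Rintegral; congr (_ * fine _).
  rewrite integral_indic// ?setIidl//.
have -> : psi N%:R / N%:R - psi n%:R / n%:R =
   N%:R^-1 * \int[nu]_(z in D) levy_kernel N%:R z - n%:R^-1 * \int[nu]_(z in D) levy_kernel n%:R z.
  by rewrite !laplace_exponentE sigma0; field; rewrite !gt_eqF.
rewrite -/c cE -!RintegralZl// -RintegralB//; [|exact: integrable_mulc..].
apply: le_Rintegral => //.
  by apply: integrable_sub => //; exact: integrable_mulc.
move=> z; rewrite /= in_itv/= andbT => z0.
have -> : N%:R^-1 * levy_kernel N%:R z - n%:R^-1 * levy_kernel n%:R z =
  (1 - expR (- (n%:R * z))) / n%:R - (1 - expR (- (N%:R * z))) / N%:R.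
  by rewrite /levy_kernel; field; rewrite !gt_eqF.
have EN := expR_ge0 (- (N%:R * z)).
have nN' : n%:R <= N%:R :> R by rewrite ler_nat.
rewrite indicE; have [/set_mem|_] := boolP (z \in _).
  rewrite /= in_itv/= andbT => ez; rewrite mulr1 /c lerB//.
    rewrite ler_pM2r ?invr_gt0// lerD2l lerN2 ler_expR lerN2 ler_pM2l//; exact: ltW.
  by rewrite ler_pdivrMr// mulVf ?gt_eqF//; lra.
have t0 : 0 <= n%:R / N%:R :> R by rewrite divr_ge0// ltW.
have t1 : n%:R / N%:R <= 1 :> R by rewrite ler_pdivrMr// mul1r.
have := @expRN_star R (n%:R / N%:R) (N%:R * z) t0 t1.
have -> : n%:R / N%:R * (N%:R * z) = n%:R * z by field; rewrite gt_eqF.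
set a := expR (- (n%:R * z)); set b := expR (- (N%:R * z)) => h.
rewrite mulr0 subr_ge0 ler_pdivlMr//.
suff -> : (1 - b) / N%:R * n%:R = n%:R / N%:R * (1 - b) by lra.
by ring.
Qed.

Lemma tail_le_ratio_gap (C : R) (n : nat) e : (0 < n)%N -> 0 < e ->
  psi N%:R / N%:R @[N --> \oo] --> C ->
  tail nu e * (1 - expR (- (n%:R * e))) <= n%:R * C - psi n%:R.
Proof.
move=> n0 e0 cC; have n0R : 0 < n%:R :> R by rewrite ltr0n.
have l1 : tail nu e * ((1 - expR (- (n%:R * e))) / n%:R - N%:R^-1) @[N --> \oo] -->
    tail nu e * ((1 - expR (- (n%:R * e))) / n%:R - 0).
  by apply: cvgM; [exact: cvg_cst|apply: cvgB; [exact: cvg_cst|exact: cvg_invn]].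
have l2 : psi N%:R / N%:R - psi n%:R / n%:R @[N --> \oo] --> C - psi n%:R / n%:R.
  by apply: cvgB; [exact: cC|exact: cvg_cst].
have h : tail nu e * ((1 - expR (- (n%:R * e))) / n%:R - 0) <= C - psi n%:R / n%:R.
  apply: (ler_cvg_to l1 l2); near=> N; apply: psi_ratio_gap => //.
  by near: N; exact: nbhs_infty_ge.
have := ler_wpM2l (ltW n0R) h; rewrite subr0.
have -> : n%:R * (tail nu e * ((1 - expR (- (n%:R * e))) / n%:R)) =
   tail nu e * (1 - expR (- (n%:R * e))) by field; rewrite gt_eqF.
suff -> : n%:R * (C - psi n%:R / n%:R) = n%:R * C - psi n%:R by [].
by field; rewrite gt_eqF.
Unshelve. all: by end_near. Qed.

(** Let N, then n, tend to infinity in [psi_ratio_gap]. *)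
Lemma tail_le_of_cvg (C K : R) e : 0 < e -> psi n%:R / n%:R @[n --> \oo] --> C ->
  n%:R * C - psi n%:R @[n --> \oo] --> K -> tail nu e <= K.
Proof.
move=> e0 cC cK.
have l1 : tail nu e * (1 - expR (- (n%:R * e))) @[n --> \oo] --> tail nu e * (1 - 0).
  apply: cvgM; first exact: cvg_cst.
  apply: cvgB; first exact: cvg_cst.
  have h := @cvg_invn R; have h1 : (n%:R^-1 : R) / e @[n --> \oo] --> 0 / e by apply: cvgM; [exact: h|exact: cvg_cst].
  rewrite mul0r in h1; apply: (squeeze_cvgr _ (cvg_cst (0 : R)) h1); near=> n.
  have n0 : 0 < n%:R :> R by rewrite ltr0n; near: n; exact: nbhs_infty_gt.
  have ne : 0 < n%:R * e by rewrite mulr_gt0.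
  rewrite expR_ge0/= -invfM expRN lef_pV2 ?posrE ?expR_gt0//.
  by apply: le_trans (expR_ge1Dx _); rewrite lerDr.
rewrite subr0 mulr1 in l1; apply: (ler_cvg_to l1 cK); near=> n.
apply: tail_le_ratio_gap => //; near: n; exact: nbhs_infty_gt.
Unshelve. all: by end_near. Qed.
End infinite_activity.

(** Continuity of nu along the sets (1 / n, oo). *)
Lemma levy_mass_finite (K : R) : (forall e, 0 < e -> tail nu e <= K) -> (nu D < +oo)%E.
Proof.
move=> H; pose F (n : nat) := (`]n.+1%:R^-1, +oo[%classic : set R).
have DF : D = \bigcup_n F n.
  apply/seteqP; split => [z|z [n _]]; rewrite /F /= !in_itv/= !andbT; last first.
    by apply: le_lt_trans; rewrite invr_ge0.
  move=> z0; have [n _ hn] := near_infty_natSinv_lt (PosNum z0).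
  by exists n => //; rewrite /= in_itv/= andbT; apply: hn => /=.
have cF : nu (F n) @[n --> \oo] --> nu (\bigcup_n F n).
  apply: nondecreasing_cvg_mu.
  - by move=> n; exact: measurable_itv.
  - by rewrite -DF.
  move=> n k nk; apply/subsetPset => z; rewrite /F /= !in_itv/= !andbT.
  by apply: le_lt_trans; rewrite lef_pV2 ?posrE// ler_nat.
rewrite DF; apply: (@le_lt_trans _ _ K%:E); last exact: ltry.
rewrite -(cvg_lim _ cF)//; apply: lime_le; first by apply/cvg_ex; exists (nu (\bigcup_n F n)).
near=> n; rewrite /F -tailE// ?lee_fin ?H// invr_gt0//.
Unshelve. all: by end_near. Qed.

Section finite_activity.
Hypothesis sigma0 : sigma = 0.
Hypothesis nu_fin : (nu D < +oo)%E.
Local Notation c := (gamma + \int[nu]_(x in `]0, 1]) x).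
Local Notation nu0 := (fine (nu D)).

Let bounded_integrable (f : R -> R) (C : R) : measurable_fun D f ->
  (forall z, 0 < z -> `|f z| <= C) -> nu.-integrable D (EFin \o f).
Proof.
move=> mf bf; have I1 : nu.-integrable D (EFin \o (cst 1 : R -> R)).
  apply/integrableP; split; first exact/measurable_EFinP.
  by rewrite (eq_integral (cst 1%:E)) ?integral_cst ?mul1e// => z _; rewrite /= normr1.
apply: (integrable_dominated (C := C) _ mf I1) => //.
by move=> z; rewrite /= in_itv/= andbT mulr1; exact: bf.
Qed.

Definition jump_transform th : R := \int[nu]_(z in D) (1 - expR (- (th * z))).

Let integrable_jump th : 0 <= th -> nu.-integrable D (EFin \o (fun z => 1 - expR (- (th * z)))).
Proof.
move=> th0; apply: (bounded_integrable (C := 1)).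
  apply: measurable_funB => //; apply: continuous_measurable => //.
  exact: continuous_expRN_mulc.
move=> z z0; have h := expR_ge0 (- (th * z)).
have h1 : expR (- (th * z)) <= 1 by rewrite expRN_le1// mulr_ge0// ltW.
by rewrite ler_norml; apply/andP; split; lra.
Qed.

Lemma jump_transform_ge0 th : 0 <= th -> 0 <= jump_transform th.
Proof.
move=> th0; apply: Rintegral_ge0 => z; rewrite /= in_itv/= andbT => z0.
by rewrite subr_ge0 expRN_le1// mulr_ge0// ltW.
Qed.

(** A finite nu allows the compensator to be moved into the drift. *)
Lemma finite_activity_psi th : 0 <= th -> psi th = c * th - jump_transform th.
Proof.
move=> th0; rewrite laplace_exponentE sigma0.
pose g z : R := z * \1_`]0, 1]%classic z.
have mg : measurable_fun D g by apply: measurable_funM => //; exact: measurable_indic.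
have Ig : nu.-integrable D (EFin \o g).
  apply: (bounded_integrable mg (C := 1)) => z z0.
  rewrite /g indicE; have [/set_mem|_] := boolP (z \in _); last by rewrite mulr0 normr0.
  by rewrite /= in_itv/= mulr1 => /andP[_ z1]; rewrite gtr0_norm.
have -> : \int[nu]_(x in `]0, 1]) x = \int[nu]_(z in D) g z.
  have -> : (`]0, 1]%classic : set R) = D `&` `]0, 1]%classic.
    apply/seteqP; split => z /=; rewrite !in_itv/=; last by case.
    by move=> h; split => //; case/andP: h => ->.
  rewrite Rintegral_mkcondr; apply: eq_Rintegral => z _.
  by rewrite /g patchE indicE; case: ifP; rewrite ?mulr1 ?mulr0.
have -> : \int[nu]_(z in D) levy_kernel th z = th * \int[nu]_(z in D) g z - jump_transform th.
  rewrite /jump_transform -RintegralZl// -RintegralB//; last 2 first.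
  - by apply: integrable_mulc.
  - exact: integrable_jump.
  by apply: eq_Rintegral => z _; rewrite /levy_kernel /g; ring.
ring.
Qed.

Lemma cvg_jump_transform : jump_transform n%:R @[n --> \oo] --> nu0.
Proof.
have -> : nu0 = \int[nu]_(z in D) (cst 1 : R -> R) z.
  rewrite /Rintegral (_ : (\int[nu]_(z in D) _)%E = (1%:E * nu D)%E) ?mul1e//.
  by rewrite -[RHS]mul1e -integral_cst.
have I1 (n : nat) := integrable_jump (ler0n R n).
have I2 : nu.-integrable D (EFin \o (cst 1 : R -> R)).
  by apply: (bounded_integrable (C := 1)) => // z _; rewrite normr1.
apply: (Rintegral_dominated_cvg I1 I2 I2).
  move=> z z0; rewrite -[X in _ --> X]subr0; apply: cvgB; first exact: cvg_cst.
  have h1 : (n%:R^-1 : R) / z @[n --> \oo] --> 0 / z by apply: cvgM; [exact: cvg_invn|exact: cvg_cst].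
  rewrite mul0r in h1; apply: (squeeze_cvgr _ (cvg_cst (0 : R)) h1); near=> n.
  have n0 : 0 < n%:R :> R by rewrite ltr0n; near: n; exact: nbhs_infty_gt.
  have ne : 0 < n%:R * z by rewrite mulr_gt0.
  rewrite expR_ge0/= -invfM expRN lef_pV2 ?posrE ?expR_gt0//.
  by apply: le_trans (expR_ge1Dx _); rewrite lerDr.
move=> n z z0; have h := expR_ge0 (- (n%:R * z)).
have h1 : expR (- (n%:R * z)) <= 1 by rewrite expRN_le1// mulr_ge0// ltW.
by rewrite ler_norml; apply/andP; split; rewrite /=; lra.
Unshelve. all: by end_near. Qed.
End finite_activity.
End exponent_asymptotics.

(** * Descent from the origin in the three cases *)

Section descent_criterion.
Context {R : realType} (nu : {measure set R -> \bar R}) (hnu : levy_measure nu).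
Variables (gamma sigma q p th th1 : R) (W w : R -> R).
Local Notation psi := (laplace_exponent gamma sigma nu).
Local Notation D := (`]0%R, +oo[%classic : set R).
Local Notation nu0 := (fine (nu D)).
Local Notation c := (gamma + \int[nu]_(x in `]0, 1]) x).
Hypotheses (sigma_ge0 : 0 <= sigma) (q0 : 0 <= q) (p0 : 0 < p) (th10 : 0 < th1).
Hypothesis IW : exp_integrable th1 W.
Hypothesis cW : {within `[0, +oo[%classic, continuous W}.
Hypothesis LW : forall s, th1 <= s -> (psi s - q) * laplace_transform W s = 1.
Hypothesis psi_gt : forall s, th1 <= s -> q < psi s.
Hypothesis Wmono : forall x a, 0 <= x -> 0 <= a -> W x <= W (x + a).
Hypothesis dW : forall x : R, 0 < x -> is_derive x 1 W (w x).

Local Notation slope := (origin_slope psi W q).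
Local Notation unbounded := (forall M : R, \forall y \near (0 : R)^'+, M <= w y).

Let cvg_W0 : n%:R / (psi n%:R - q) @[n --> \oo] --> W 0 :=
  cvg_scale_origin th10 IW cW LW psi_gt.
Let cvg_slope (k : R) (wk : w y @[y --> 0^'+] --> k) : slope n @[n --> \oo] --> k :=
  cvg_origin_slope th10 IW cW LW psi_gt dW wk.
Let slope_unb := origin_slope_unbounded th10 IW cW LW psi_gt Wmono dW.

Let n_gt0 : \forall n \near \oo, 0 < n%:R :> R.
Proof. by near=> n; rewrite ltr0n; near: n; exact: nbhs_infty_gt. Unshelve. all: by end_near. Qed.

Let psi_n : \forall n \near \oo, 0 < psi n%:R - q.
Proof.
near=> n; rewrite subr_gt0; apply: psi_gt; near: n; exact: nbhs_infty_ger.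
Unshelve. all: by end_near. Qed.

Let not_unbounded (l : R) : slope n @[n --> \oo] --> l -> ~ unbounded.
Proof.
move=> sl unb; have h1 := slope_unb unb (l + 1).
have h2 : \forall n \near \oo, slope n < l + 1 by apply: (cvgr_lt _ sl); rewrite ltrDl.
have : \forall n \near \oo, False.
  near=> n; have : l + 1 <= slope n by near: n.
  by rewrite leNgt => /negP; apply; near: n.
by move/filter_ex => -[].
Unshelve. all: by end_near. Qed.

Section gaussian.
Hypothesis sigma_gt0 : 0 < sigma.

Let den : psi n%:R / n%:R ^+ 2 - q * (n%:R^-1 * n%:R^-1) @[n --> \oo] --> 2^-1 * sigma ^+ 2.
Proof.
rewrite -[X in _ --> X]subr0; apply: cvgB; first exact: cvg_psi_sqr.
rewrite -[X in _ --> X](mulr0 q) -[X in _ * X](mulr0 0).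
by apply: cvgM; [exact: cvg_cst|apply: cvgM; exact: cvg_invn].
Qed.

Let s2 : 2^-1 * sigma ^+ 2 != 0.
Proof. by rewrite mulf_neq0 ?invr_eq0// expf_neq0// gt_eqF. Qed.

Lemma gaussian_origin : W 0 = 0.
Proof.
apply: (cvg_unique _ cvg_W0) => //.
have h : n%:R^-1 / (psi n%:R / n%:R ^+ 2 - q * (n%:R^-1 * n%:R^-1)) @[n --> \oo] --> 0 / (2^-1 * sigma ^+ 2).
  by apply: cvgM; [exact: cvg_invn|exact: cvgV den].
rewrite mul0r in h; apply: cvg_trans h; apply: near_eq_cvg; near=> n.
have n0 : 0 < n%:R :> R by near: n.
have pn : 0 < psi n%:R - q by near: n.
have -> : psi n%:R / n%:R ^+ 2 - q * (n%:R^-1 * n%:R^-1) = (psi n%:R - q) / n%:R ^+ 2.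
  by field; rewrite gt_eqF.
by field; rewrite !gt_eqF.
Unshelve. all: by end_near. Qed.

Lemma gaussian_slope : slope n @[n --> \oo] --> 2 / sigma ^+ 2.
Proof.
have h : (psi n%:R / n%:R ^+ 2 - q * (n%:R^-1 * n%:R^-1))^-1 @[n --> \oo] --> (2^-1 * sigma ^+ 2)^-1.
  exact: cvgV.
have -> : 2 / sigma ^+ 2 = (2^-1 * sigma ^+ 2)^-1 by rewrite [RHS]invfM invrK.
apply: cvg_trans h; apply: near_eq_cvg; near=> n.
have n0 : 0 < n%:R :> R by near: n.
have pn : 0 < psi n%:R - q by near: n.
rewrite /origin_slope gaussian_origin mul0r subr0.
have -> : psi n%:R / n%:R ^+ 2 - q * (n%:R^-1 * n%:R^-1) = (psi n%:R - q) / n%:R ^+ 2.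
  by field; rewrite gt_eqF.
by rewrite [LHS]invfM invrK mulrC.
Unshelve. all: by end_near. Qed.
End gaussian.

Section finite_variation.
Hypotheses (sigma0 : sigma = 0) (nu_fin : (nu D < +oo)%E).
Local Notation J := (jump_transform nu).

Let psiE n : psi n%:R = c * n%:R - J n%:R.
Proof. by rewrite (finite_activity_psi gamma sigma0 nu_fin). Qed.

Lemma drift_gt0 : 0 < c.
Proof.
have h := psi_gt (lexx th1).
rewrite (finite_activity_psi gamma sigma0 nu_fin (ltW th10)) in h.
rewrite -(pmulr_lgt0 _ th10); apply: (le_lt_trans q0); apply: (lt_le_trans h).
by rewrite gerBl; exact: jump_transform_ge0 (ltW th10).
Qed.

Let c0 : c != 0. Proof. by rewrite gt_eqF// drift_gt0. Qed.

Let den : c - (J n%:R + q) * n%:R^-1 @[n --> \oo] --> c.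
Proof.
rewrite -[X in _ --> X]subr0; apply: cvgB; first exact: cvg_cst.
rewrite -[X in _ --> X](mulr0 (nu0 + q)); apply: cvgM; last exact: cvg_invn.
by apply: cvgD; [exact: cvg_jump_transform|exact: cvg_cst].
Qed.

Lemma finite_variation_origin : W 0 = c^-1.
Proof.
apply: (cvg_unique _ cvg_W0) => //.
have h : (c - (J n%:R + q) * n%:R^-1)^-1 @[n --> \oo] --> c^-1 by exact: cvgV.
apply: cvg_trans h; apply: near_eq_cvg; near=> n.
have n0 : 0 < n%:R :> R by near: n.
have pn : 0 < psi n%:R - q by near: n.
rewrite psiE in pn *.
have -> : c - (J n%:R + q) * n%:R^-1 = (c * n%:R - J n%:R - q) / n%:R.
  by field; rewrite gt_eqF.
by rewrite [LHS]invfM invrK mulrC.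
Unshelve. all: by end_near. Qed.

Lemma finite_variation_slope : slope n @[n --> \oo] --> (q + nu0) / c ^+ 2.
Proof.
have h : (J n%:R + q) * (c^-1 / (c - (J n%:R + q) * n%:R^-1)) @[n --> \oo] --> (nu0 + q) * (c^-1 / c).
  apply: cvgM; first by apply: cvgD; [exact: cvg_jump_transform|exact: cvg_cst].
  by apply: cvgM; [exact: cvg_cst|exact: cvgV den].
have -> : (q + nu0) / c ^+ 2 = (nu0 + q) * (c^-1 / c) by rewrite -invfM addrC.
apply: cvg_trans h; apply: near_eq_cvg; near=> n.
have n0 : 0 < n%:R :> R by near: n.
have pn : 0 < psi n%:R - q by near: n.
rewrite /origin_slope finite_variation_origin.
rewrite psiE in pn *.
have -> : c - (J n%:R + q) * n%:R^-1 = (c * n%:R - J n%:R - q) / n%:R.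
  by field; rewrite gt_eqF.
move: pn c0; set k := c; set j := J n%:R => pn k0.
by field; rewrite k0 !gt_eqF.
Unshelve. all: by end_near. Qed.
End finite_variation.

(** Suppose w has a finite limit at 0. If W 0 = 0, the product of the slopes
    by (psi n - q) / n^2 is 1, whereas psi n / n^2 tends to 0. Otherwise
    psi n / n tends to 1 / W 0 at a rate such that n / W 0 - psi n converges,
    and [tail_le_of_cvg] bounds the tail of nu. *)
Lemma infinite_activity_unbounded (k : R) : sigma = 0 -> nu D = +oo%E -> ~ (w y @[y --> 0^'+] --> k).
Proof.
move=> sigma0 nuoo wk; have sk := cvg_slope wk.
have psq : psi n%:R / n%:R ^+ 2 - q * (n%:R^-1 * n%:R^-1) @[n --> \oo] --> (0 : R).
  rewrite -[X in _ --> X]subr0; apply: cvgB.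
    rewrite (_ : 0 = 2^-1 * sigma ^+ 2); first exact: cvg_psi_sqr.
    by rewrite sigma0 expr0n/= mulr0.
  rewrite -[X in _ --> X](mulr0 q) -[X in _ * X](mulr0 0).
  by apply: cvgM; [exact: cvg_cst|apply: cvgM; exact: cvg_invn].
have [W00|W0n] := eqVneq (W 0) 0.
  have h0 : slope n * (psi n%:R / n%:R ^+ 2 - q * (n%:R^-1 * n%:R^-1)) @[n --> \oo] --> (0 : R).
    by rewrite -[X in _ --> X](mulr0 k); exact: cvgM.
  have h1 : slope n * (psi n%:R / n%:R ^+ 2 - q * (n%:R^-1 * n%:R^-1)) @[n --> \oo] --> (1 : R).
    have h2 : (fun=> 1 : R) @ (\oo : set_system nat) --> (1 : R) by exact: cvg_cst.
    apply: cvg_trans h2; apply: near_eq_cvg; near=> n.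
    have n0 : 0 < n%:R :> R by near: n.
    have pn : 0 < psi n%:R - q by near: n.
    rewrite /origin_slope W00 mul0r subr0 /=; field.
    by rewrite !gt_eqF.
  have : (0 : R) = 1 by exact: (cvg_unique _ h0 h1).
  by move/eqP; rewrite eq_sym oner_eq0.
have cV : (n%:R / (psi n%:R - q))^-1 @[n --> \oo] --> (W 0)^-1 by exact: cvgV.
have cC : psi n%:R / n%:R @[n --> \oo] --> (W 0)^-1.
  rewrite -[X in _ --> X]addr0 -[X in _ + X](mulr0 q).
  have h : (n%:R / (psi n%:R - q))^-1 + q * n%:R^-1 @[n --> \oo] --> (W 0)^-1 + q * 0.
    by apply: cvgD; [exact: cV|apply: cvgM; [exact: cvg_cst|exact: cvg_invn]].
  apply: cvg_trans h; apply: near_eq_cvg; near=> n.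
  have n0 : 0 < n%:R :> R by near: n.
  have pn : 0 < psi n%:R - q by near: n.
  by field; rewrite !gt_eqF.
have cK : n%:R * (W 0)^-1 - psi n%:R @[n --> \oo] --> k * ((W 0)^-1 * (W 0)^-1) - q.
  have h : slope n * ((n%:R / (psi n%:R - q))^-1 * (W 0)^-1) - q @[n --> \oo] -->
      k * ((W 0)^-1 * (W 0)^-1) - q.
    apply: cvgB; last exact: cvg_cst.
    by apply: cvgM; [exact: sk|apply: cvgM; [exact: cV|exact: cvg_cst]].
  apply: cvg_trans h; apply: near_eq_cvg; near=> n.
  have n0 : 0 < n%:R :> R by near: n.
  have pn : 0 < psi n%:R - q by near: n.
  by rewrite /origin_slope; field; rewrite W0n !gt_eqF.
have := levy_mass_finite hnu (fun e e0 => tail_le_of_cvg hnu sigma0 e0 cC cK).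
by rewrite nuoo ltxx.
Unshelve. all: by end_near. Qed.

Hypothesis lim_dichotomy : (exists k : R, w y @[y --> 0^'+] --> k) \/ unbounded.
Variable descent : Prop.
Hypothesis descent_bounded : forall k : R, w y @[y --> 0^'+] --> k ->
  (descent <-> th * (th - p * W 0) < p * k).
Hypothesis descent_unbounded : unbounded -> descent.

Let descent_lim (l : R) : slope n @[n --> \oo] --> l -> (descent <-> th * (th - p * W 0) < p * l).
Proof.
move=> sl; case: lim_dichotomy => [[k wk]|unb]; last by have := not_unbounded sl unb.
rewrite (descent_bounded wk) (_ : k = l)//.
exact: (cvg_unique _ (cvg_slope wk) sl).
Qed.

Theorem descent_cases : descent <->
  [\/ 0 < sigma /\ th ^+ 2 / p < 2 / sigma ^+ 2,
      sigma = 0 /\ nu D = +oo%E |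
      [/\ sigma = 0, (nu D < +oo)%E &
          c * th / p * (th - p / c) < (q + nu0) / c]].
Proof.
move: sigma_ge0; rewrite le_eqVlt => /predU1P[/esym sigma0|sigma_gt0].
  have [nuoo|nu_fin] := eqVneq (nu D) +oo%E.
    split=> [_|_]; first by apply: Or32.
    case: lim_dichotomy => [[k wk]|]; last exact: descent_unbounded.
    by have := infinite_activity_unbounded sigma0 nuoo wk.
  have {}nu_fin : (nu D < +oo)%E by rewrite ltey.
  have c_gt0 := drift_gt0 sigma0 nu_fin.
  have E : (th * (th - p * W 0) < p * ((q + nu0) / c ^+ 2)) =
           (c * th / p * (th - p / c) < (q + nu0) / c).
    rewrite (finite_variation_origin sigma0 nu_fin).
    have cp : 0 < c / p by rewrite divr_gt0.
    rewrite -(ltr_pM2l cp); congr (_ < _); field; rewrite !gt_eqF//.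
  rewrite (descent_lim (finite_variation_slope sigma0 nu_fin)) E.
  split=> [h|]; first by apply: Or33.
  by case=> [[]|[_ nuoo]|[_ _]//]; [rewrite sigma0 ltxx|move: nu_fin; rewrite nuoo ltxx].
rewrite (descent_lim (gaussian_slope sigma_gt0)) (gaussian_origin sigma_gt0) mulr0 subr0.
rewrite -expr2 -ltr_pdivrMl// mulrC.
split=> [h|]; first by apply: Or31.
by case=> [[_]//|[s0 _]|[s0 _ _]]; move: sigma_gt0; rewrite s0 ltxx.
Qed.
End descent_criterion.

(** * Positivity of the Laplace exponent *)

Section exponent_positive.
Context d (T : measurableType d) (R : realType) (P : probability T R).
Variables (X : R -> {RV P >-> R}) (psi : R -> R).
Hypothesis hpsi : has_laplace_exponent X psi.
Hypothesis psi_le0 : forall th, 0 < th -> psi th <= 0.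
Implicit Types (s t : R).

Let above t e : 0 <= t -> 0 < e -> P [set w | e <= X t w] = 0%E.
Proof.
move=> t0 e0; apply/eqP; rewrite eq_le measure_ge0 andbT.
apply/lee_addgt0Pr => eps eps0; rewrite add0e.
(* Large enough for e^(- th e) <= eps. *)
pose th := (eps^-1 + 1) / e.
have ei : 0 < eps^-1 by rewrite invr_gt0.
have th0 : 0 < th by rewrite divr_gt0// addr_gt0.
apply: (le_trans (chernoff (X t) e th0)).
have -> : mmt_gen_fun P (X t) th = (expR (t * psi th))%:E.
  by rewrite -(hpsi t0 (ltW th0)); congr ('E_P[_])%E; apply/funext => w; rewrite /= mulrC.
rewrite -EFinM lee_fin.
apply: (@le_trans _ _ (1 * expR (- (th * e)))).
  rewrite ler_wpM2r ?expR_ge0// expR_le1 mulr_ge0_le0//; exact: psi_le0.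
rewrite mul1r /th mulfVK ?gt_eqF// expRN -[leRHS]invrK lef_pV2 ?posrE ?expR_gt0//.
by apply: le_trans (expR_ge1Dx _); lra.
Qed.

Let measurable_gt (Y : T -> R) a : measurable_fun setT Y -> measurable [set w | a < Y w].
Proof.
move=> mY; rewrite (_ : [set w | a < Y w] = setT `&` Y @^-1` `]a, +oo[).
  by apply: mY => //; exact: measurable_itv.
by rewrite setTI; apply/seteqP; split => w /=; rewrite in_itv/= andbT.
Qed.

Let measurable_ge (Y : T -> R) a : measurable_fun setT Y -> measurable [set w | a <= Y w].
Proof.
move=> mY; rewrite (_ : [set w | a <= Y w] = setT `&` Y @^-1` `[a, +oo[).
  by apply: mY => //; exact: measurable_itv.
by rewrite setTI; apply/seteqP; split => w /=; rewrite in_itv/= andbT.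
Qed.

Lemma probability_positive0 t : 0 <= t -> P [set w | 0 < X t w] = 0%E.
Proof.
move=> t0; apply: (negligibleP P (measurable_gt 0 (measurable_funPT (X t)))).1.
have h : {ae P, forall w, forall n : nat, X t w < n.+1%:R^-1}.
  apply: ae_foralln => n.
  have n0 : 0 < n.+1%:R^-1 :> R by rewrite invr_gt0.
  have := (negligibleP P (measurable_ge n.+1%:R^-1 (measurable_funPT (X t)))).2 (above t0 n0).
  apply: negligibleS => w /= /negP; by rewrite -leNgt.
apply: negligibleS h => w /= w0 H.
have [n _ hn] := near_infty_natSinv_lt (PosNum w0).
by have := H n; apply/negP; rewrite -leNgt; apply/ltW/hn => /=.
Qed.

(** Stationarity transfers the sign of X_t to the increments. *)
Lemma ae_increment_le0 s t : stationary_increments X -> 0 <= s -> 0 <= t ->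
  {ae P, forall w, X (s + t) w <= X s w}.
Proof.
move=> stat s0 t0.
have E := stat s t `]0, +oo[%classic s0 t0 (measurable_itv _).
have : P [set w | 0 < X (s + t) w - X s w] = 0%E.
  rewrite -(probability_positive0 t0).
  rewrite [X in P X = _](_ : _ = [set w | `]0, +oo[%classic (X (s + t) w - X s w)]); last first.
    by apply/seteqP; split => w /=; rewrite in_itv/= andbT.
  rewrite E; congr (P _).
  by apply/seteqP; split => w /=; rewrite in_itv/= andbT.
move/(negligibleP P (measurable_gt 0 (measurable_funB (measurable_funPT (X (s + t))) (measurable_funPT (X s))))).
by apply: negligibleS => w /= /negP; rewrite -ltNge subr_gt0.
Qed.

(** Countably many pairs of times give monotonicity along rational times;
    right-continuity extends it to all times. *)
Lemma ae_nonincreasing_path : levy_process X ->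
  {ae P, forall w, nonincreasing_path (fun t => X t w)}.
Proof.
move=> [_ _ stat cad].
have H : {ae P, forall w, forall n i j : nat,
    X (i%:R / n.+1%:R + j%:R / n.+1%:R) w <= X (i%:R / n.+1%:R) w}.
  apply: ae_foralln => n; apply: ae_foralln => i; apply: ae_foralln => j.
  by apply: ae_increment_le0.
apply: filterS2 H cad => w H [rc _] s t s0; rewrite le_eqVlt => /predU1P[->//|st].
have t0 : 0 <= t by exact: le_trans (ltW st).
(* Grid points strictly to the right of x, as right-limits require. *)
pose u (x : R) (n : nat) : R := (Num.truncn (n.+1%:R * x)).+1%:R / n.+1%:R.
have uc x : 0 <= x -> (forall n, x < u x n) /\ u x n @[n --> \oo] --> x.
  move=> x0; have b n : x < u x n /\ u x n <= x + n.+1%:R^-1.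
    have nx : 0 <= n.+1%:R * x by rewrite mulr_ge0.
    have /andP[h1 h2] := truncn_itv nx.
    rewrite /u ltr_pdivlMr// mulrC; split => //.
    by rewrite ler_pdivrMr// mulrDl mulVf// -[leLHS]natr1 lerD2r [x * _]mulrC.
  split; first by move=> n; case: (b n).
  have h : x + n.+1%:R^-1 @[n --> \oo] --> x + 0.
    by apply: cvgD; [exact: cvg_cst|exact: cvg_harmonic].
  rewrite addr0 in h; apply: (squeeze_cvgr _ (cvg_cst x) h); near=> n.
  by have [h1 h2] := b n; rewrite ltW.
have ls := (cvg_at_rightP _ _ _).1 (rc s s0) _ (uc s s0).
have lt := (cvg_at_rightP _ _ _).1 (rc t t0) _ (uc t t0).
apply: (ler_cvg_to lt ls); near=> n.
pose i := (Num.truncn (n.+1%:R * s)).+1; pose k := (Num.truncn (n.+1%:R * t)).+1.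
have ik : (i <= k)%N.
  rewrite ltnS; apply: le_truncn; by rewrite ler_pM2l// ltW.
have := H n i (k - i)%N.
by rewrite -mulrDl -natrD subnKC.
Unshelve. all: by end_near. Qed.
End exponent_positive.

Lemma laplace_exponent_positive d (T : measurableType d) (R : realType) (P : probability T R)
    (X : R -> {RV P >-> R}) (psi : R -> R) :
  spectrally_negative_levy X -> has_laplace_exponent X psi -> exists2 th, 0 < th & 0 < psi th.
Proof.
move=> [lX _ _ nX] hpsi; apply: contrapT => H; apply: nX.
apply: (ae_nonincreasing_path hpsi) lX => th th0.
by rewrite leNgt; apply/negP => h; apply: H; exists th.
Qed.

(** * The two barriers *)

(** The transform is a finite extended real number, so its integrand is
    integrable. *)
Lemma scale_function_transform (R : realType) (psi W : R -> R) (q s : R) :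
  scale_function psi q W -> right_inverse psi q < s ->
  exp_integrable s W /\ laplace_transform W s = (psi s - q)^-1.
Proof.
move=> [_ cW hL] hs; have E := hL s hs; split; last by rewrite /laplace_transform /Rintegral E.
have mW : measurable_fun (`[0%R, +oo[%classic : set R) W by exact: subspace_continuous_measurable_fun.
have mG : measurable_fun (`[0%R, +oo[%classic : set R) (fun y => expR (- (s * y)) * W y).
  apply: measurable_funM => //; apply: continuous_measurable => //.
  exact: continuous_expRN_mulc.
apply/integrableP; split; first exact/measurable_EFinP.
have := @integral_fin_num_abs _ _ _ (@lebesgue_measure R) (`[0%R, +oo[%classic : set R) _ _ mG.
by move=> ->//; rewrite E.
Qed.

Theorem proposition2p2 (R : realType) (d : measure_display)
    (T : measurableType d) (P : probability T R) (X : R -> {RV P >-> R})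
    (gamma sigma : R) (nu : {measure set R -> \bar R}) (q p : R) (W : R -> R)
    (psi := laplace_exponent gamma sigma nu)
    (Phi := right_inverse psi (p + q))
    (nu0 := fine (nu `]0%R, +oo[%classic))
    (c := gamma + \int[nu]_(x in `]0, 1]) x)
    (hq : 0 <= q) (hp : 0 < p) (hsigma : 0 <= sigma)
    (hnu : levy_measure nu)
    (hX : spectrally_negative_levy X)
    (hpsi : has_laplace_exponent X psi)
    (htail : log_convex (tail nu))
    (hW : scale_function psi q W) :
  [/\ (0 <= b_poisson psi q p W)%E,
      (b_poisson psi q p W <= b_infty W)%E &
      nonconstant_scale_deriv W ->
      ((0 < b_poisson psi q p W)%E <->
       [\/ 0 < sigma /\ Phi ^+ 2 / p < 2 / sigma ^+ 2,
           sigma = 0 /\ nu `]0%R, +oo[%classic = +oo%E |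
           [/\ sigma = 0, (nu `]0%R, +oo[%classic < +oo)%E &
               c * Phi / p * (Phi - p / c) < (q + nu0) / c]])].
Proof.
have [a a0 psi_a] := laplace_exponent_positive hX hpsi.
have star := laplace_exponent_star hnu gamma sigma.
have cont := @laplace_exponent_continuous R nu hnu gamma sigma.
have pq0 : 0 < p + q by lra.
have [psiPhi Phi0] := psi_right_inverse star cont a0 psi_a pq0.
have qPhi := right_inverse_lt star cont a0 psi_a hq hp.
(* The transform of W is known on all of [s1, oo), which contains Phi. *)
pose s1 := (right_inverse psi q + Phi) / 2.
have s1q : right_inverse psi q < s1 by rewrite midf_lt.
have s1Phi : s1 < Phi by rewrite midf_lt.
have s10 : 0 < s1 by apply: le_lt_trans s1q; exact: right_inverse_ge0.
have tr s : s1 <= s -> exp_integrable s W /\ laplace_transform W s = (psi s - q)^-1.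
  by move=> hs; apply: scale_function_transform => //; exact: lt_le_trans hs.
have psi_gt s : s1 <= s -> q < psi s.
  by move=> hs; apply: (right_inverse_gt star cont a0 psi_a hq); exact: lt_le_trans hs.
have LW s : s1 <= s -> (psi s - q) * laplace_transform W s = 1.
  by move=> hs; rewrite (tr s hs).2 mulfV// gt_eqF// subr_gt0 psi_gt.
have [IW _] := tr s1 (lexx s1); have [IPhi _] := tr Phi (ltW s1Phi).
have cW : {within `[0, +oo[%classic, continuous W} by case: hW.
have contW := continuous_half_line_eps cW.
have uW := erlang_increment_convex hnu hq s10 IW LW psi_gt htail.
have Wmono := scale_nondecreasing s10 IW contW uW.
have W0 := scale_ge0 s10 IW contW uW.
have Wconv := scale_increment_convex s10 IW contW uW.
have [w [dW w0 wconv_gt0]] := derive_increment_convex contW Wmono Wconv.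
have wconv x a1 b : 0 < x -> 0 <= a1 -> 0 <= b ->
    (a1 + b) * w (x + a1) <= b * w x + a1 * w (x + a1 + b).
  move=> x0; rewrite le_eqVlt => /predU1P[<- _|a10]; first by rewrite !addr0; lra.
  rewrite le_eqVlt => /predU1P[<-|b0]; first by rewrite !addr0; lra.
  exact: wconv_gt0.
have psi_Phi : psi Phi - q = p by rewrite (psiPhi : psi Phi = p + q) addrK.
have LPhi : p * laplace_transform W Phi = 1 by rewrite -{1}psi_Phi LW// ltW.
split; first exact: last_minimizer_ge0.
  exact: (b_poisson_le_b_infty Phi0 hp psi_Phi IPhi LPhi cW W0 dW w0 wconv).
move=> nc; apply: (iff_trans (b_poisson_gt0 Phi0 hp psi_Phi IPhi LPhi cW W0 Wconv dW wconv nc)).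
have dm x (x0 : 0 < x) := is_derive_scale_density psi_Phi IPhi dW x0.
have cm B (B0 : 0 < B) := scale_density_continuous psi_Phi IPhi cW dW B0.
have mconv := scale_density_convex Phi0 hp psi_Phi IPhi LPhi cW W0 dW Wconv.
have cm0 := scale_density_cvg0 psi_Phi IPhi cW.
apply: (descent_cases hnu hsigma hq hp s10 IW cW LW psi_gt Wmono dW (convex_right_limit w0 wconv)).
  move=> k wk; have := descent_iff dm cm mconv cm0 wk.
  by rewrite (scale_density0 W psi_Phi).
exact: (descent_of_unbounded hp dm cm cm0).
Qed.
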